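(* Let $\rho\ge 2$, $d=\rho-1$, and let $(\boldsymbol{X},Y)=(X_1,\ldots,X_d,Y)$ be a $\rho$-dimensional random vector with continuous distribution function $H$ and copula $A$. Then $\zeta^1$ fulfils the following properties: 1. $\zeta^1(\boldsymbol{X},Y)\in[0,1]$. 2. $\zeta^1(\boldsymbol{X},Y)=0$ if and only if $Y$ and $\boldsymbol{X}$ are independent (or, equivalently, if and only if $L(A)=\Pi_\rho$). 3. $\zeta^1(\boldsymbol{X},Y)=1$ if and only if $Y$ is a function of $\boldsymbol{X}$, i.e., if and only if there exists a measurable function $f:\mathbb{R}^d\to\mathbb{R}$ with $\mathbb{P}(Y=f(\boldsymbol{X}))=1$. 4. If $\varphi_1,\ldots,\varphi_d,\varphi_\rho:\mathbb{R}\to\mathbb{R}$ are functions each of which is strictly increasing or strictly decreasing, then, writing $\boldsymbol{\varphi}(\boldsymbol{X})=(\varphi_1(X_1),\ldots,\varphi_d(X_d))$, we have $\zeta^1(\boldsymbol{\varphi}(\boldsymbol{X}),\varphi_\rho(Y))=\zeta^1(\boldsymbol{X},Y)$. 5. The following chain of inequalities holds: $$\zeta^1(X_1,Y)\le\zeta^1((X_1,X_2),Y)\le\cdots\le\zeta^1((X_1,\ldots,X_d),Y).$$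
   Context: Notation: $\mathbb{I}=[0,1]$; $\lambda^k$ is $k$-dimensional Lebesgue measure, $\lambda=\lambda^1$. For $\rho\ge2$ put $d=\rho-1$. $\mathcal{C}^\rho$ is the set of $\rho$-dimensional copulas; $\mu_A$ is the probability measure on $\mathbb{I}^\rho$ with distribution function $A$; $A^k$ is the marginal copula of the first $k$ coordinates; $\Pi_\rho(x_1,\ldots,x_\rho)=\prod_{i}x_i$ is the product copula. For a copula $C$ on $\mathbb{I}^{m}$ and $1\le k<m$, the Markov kernel $K_C:\mathbb{I}^k\times\mathcal{B}(\mathbb{I}^{m-k})\to\mathbb{I}$ with respect to the first $k$ coordinates is a (version of the) regular conditional distribution of the last $m-k$ coordinates given the first $k$, i.e. $\mu_C(E\times F)=\int_E K_C(\boldsymbol{x},F)\,d\mu_{C^k}(\boldsymbol{x})$ for Borel $E,F$. Linkage: let $(X_1,\ldots,X_d,Y)\sim A\in\mathcal{C}^\rho$ and let $\boldsymbol{R}=(R_1,\ldots,R_d)$ have i.i.d. coordinates uniform on $\mathbb{I}$, with $\boldsymbol{R}$ independent of $(X_1,\ldots,X_d,Y)$. For $i\ge2$ and $r\in\mathbb{I}$ set $F^{r}_{i|1\ldots i-1}(x_i|x_1,\ldots,x_{i-1})=K_{A^i}(x_1,\ldots,x_{i-1},[0,x_i))+r\,K_{A^i}(x_1,\ldots,x_{i-1},\{x_i\})$ and $F_1^{r}(x_1)=x_1$; set $\Phi^{\boldsymbol{r}}(x_1,\ldots,x_d)=(F_1^{r_1}(x_1),F^{r_2}_{2|1}(x_2|x_1),\ldots,F^{r_d}_{d|1\ldots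 d-1}(x_d|x_1,\ldots,x_{d-1}))$. The linkage $L(A)$ of $A$ is the distribution function of $(\Phi^{\boldsymbol{R}}(X_1,\ldots,X_d),Y)$; it is a copula whose first $d$ coordinates are jointly uniform on $\mathbb{I}^d$. For $A,B\in\mathcal{C}^\rho$ set $$D_1(A,B)=\int_{\mathbb{I}}\int_{\mathbb{I}^d}|K_{L(A)}(\boldsymbol{x},[0,y])-K_{L(B)}(\boldsymbol{x},[0,y])|\,d\lambda^d(\boldsymbol{x})\,d\lambda(y),$$ with kernels taken with respect to the first $d$ coordinates. For a random vector $(\boldsymbol{X},Y)$ with $\boldsymbol{X}$ of any dimension $d\ge1$, with continuous distribution function and (unique) copula $A\in\mathcal{C}^{d+1}$, the dependence measure is $\zeta^1(\boldsymbol{X},Y)=\zeta^1(A)=3D_1(A,\Pi_{d+1})$. In particular $\zeta^1((X_1,\ldots,X_k),Y)$ is computed from the copula of $(X_1,\ldots,X_k,Y)$. *)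

(* Defs.v *)
From HB Require Import structures.
From mathcomp Require Import all_boot all_order all_algebra.
From mathcomp Require Import all_classical all_reals all_analysis.

Set Implicit Arguments.
Unset Strict Implicit.
Unset Printing Implicit Defensive.
Import Order.TTheory GRing.Theory Num.Theory.
Import numFieldNormedType.Exports.

Local Open Scope classical_set_scope.
Local Open Scope ring_scope.

(* Points of R^n are n-tuples, which carry the product Borel sigma-algebra.
   A copula is a function on R^n of which only the values on the unit cube
   matter, and measures on the cube are measures on R^n that give it mass 1. *)

HB.instance Definition _ d d' (X : measurableType d) (Y : measurableType d')
  (R : realType) := gen_eqMixin (R.-pker X ~> Y).
HB.instance Definition _ d d' (X : measurableType d) (Y : measurableType d')
  (R : realType) := gen_choiceMixin (R.-pker X ~> Y).
HB.instance Definition _ d d' (X : measurableType d) (Y : measurableType d')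
  (R : realType) := isPointed.Build (R.-pker X ~> Y)
    (kdirac (@measurable_cst _ _ X Y setT point)).

Section tuples.
Context {R : realType}.

(* (x_1, ..., x_k); meant for k <= n, the default 0 is then unused. *)
Definition first_coords (k n : nat) (x : n.-tuple R) : k.-tuple R :=
  [tuple nth 0 x i | i < k].

(* (x_1, ..., x_k, 1, ..., 1) when k <= n, at which a copula takes the value of
   its margin of the first k coordinates. *)
Definition pad1 (n k : nat) (x : k.-tuple R) : n.-tuple R :=
  [tuple nth 1 x i | i < n].

Lemma first_coords_id (n : nat) (x : n.-tuple R) : first_coords n x = x.
Proof. by apply: eq_from_tnth => i; rewrite tnth_mktuple -tnth_nth. Qed.

Definition snoc (n : nat) (x : n.-tuple R) (y : R) : n.+1.-tuple R :=
  [tuple of rcons x y].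

Definition cube (n : nat) : set (n.-tuple R) :=
  [set x | forall i, 0 <= tnth x i <= 1].

Definition lower_orthant (n : nat) (x : n.-tuple R) : set (n.-tuple R) :=
  [set z | forall i, tnth z i <= tnth x i].

End tuples.
Arguments first_coords {R} k {n} x.
Arguments pad1 {R} n {k} x.
Arguments cube {R} n.

Section lebesgue_cube.
Context {R : realType}.

Definition cons_pair (n : nat) (p : measurableTypeR R * n.-tuple R) : n.+1.-tuple R :=
  [tuple of (p.1 : R) :: p.2].

Lemma measurable_cons_pair n : measurable_fun setT (@cons_pair n).
Proof. exact: measurable_cons. Qed.

HB.instance Definition _ n := isMeasurableFun.Build _ _ _ _
  (@cons_pair n) (@measurable_cons_pair n).

Fixpoint lebesgue_cube (n : nat) : probability (n.-tuple R) R :=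
  if n is m.+1 then
    distribution (uniform_prob (@ltr01 R) \x lebesgue_cube m : probability _ R)%E
      (@cons_pair m)
  else \d_ [tuple].

End lebesgue_cube.

Section copulas.
Context {R : realType}.

Definition has_cdf_on_cube (n : nat) (C : n.-tuple R -> R)
    (mu : probability (n.-tuple R) R) : Prop :=
  mu (cube n) = 1%E /\
  forall x, cube n x -> mu (lower_orthant x) = (C x)%:E.

Definition uniform_margins (n : nat) (mu : probability (n.-tuple R) R) : Prop :=
  forall (i : 'I_n) (u : R), 0 <= u <= 1 -> mu [set z | tnth z i <= u] = u%:E.

Definition is_copula (n : nat) (C : n.-tuple R -> R) : Prop :=
  exists2 mu, has_cdf_on_cube C mu & uniform_margins mu.

Definition copula_measure (n : nat) (C : n.-tuple R -> R) :
    probability (n.-tuple R) R :=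
  get [set mu | has_cdf_on_cube C mu].

Definition marginal (n k : nat) (C : n.-tuple R -> R) : k.-tuple R -> R :=
  fun x => C (pad1 n x).
Arguments marginal {n} k C _.

Definition Pi_copula (n : nat) : n.-tuple R -> R :=
  fun x => \prod_(i < n) tnth x i.

Definition is_markov_kernel (k : nat) (C : k.+1.-tuple R -> R)
    (K : R.-pker (k.-tuple R) ~> R) : Prop :=
  (forall x, cube k x -> K x `[0, 1]%classic = 1%E) /\
  forall (E : set (k.-tuple R)) (F : set R), measurable E -> measurable F ->
    copula_measure C [set z | E (first_coords k z) /\ F (tnth z ord_max)] =
    (\int[copula_measure (marginal k C)]_(x in E) K x F)%E.

Definition markov_kernel (k : nat) (C : k.+1.-tuple R -> R) :
    R.-pker (k.-tuple R) ~> R :=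
  get [set K | is_markov_kernel C K].

(* F^r_{i+1 | 1 ... i}: coordinates are counted from 0. *)
Definition cond_cdf (n : nat) (A : n.-tuple R -> R) (i : nat) (r : R)
    (x : i.-tuple R) (xi : R) : R :=
  if i == 0%N then xi
  else let K := markov_kernel (marginal i.+1 A) x in
       fine (K `[0, xi[%classic) + r * fine (K [set xi]).

(* Phi^r *)
Definition rosenblatt (d : nat) (A : d.+1.-tuple R -> R) (r x : d.-tuple R) :
    d.-tuple R :=
  [tuple cond_cdf A (tnth r i) (first_coords i x) (tnth x i) | i < d].

(* The law of (X, Y, R) with (X, Y) ~ A and R independent, uniform on the cube,
   is mu_A \x lambda^d. *)
Definition linkage (d : nat) (A : d.+1.-tuple R -> R) : d.+1.-tuple R -> R :=
  fun u => fine ((copula_measure A \x lebesgue_cube d)%E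
    [set zr | lower_orthant u
       (snoc (rosenblatt A zr.2 (first_coords d zr.1)) (tnth zr.1 ord_max))]).

Definition D1 (d : nat) (A B : d.+1.-tuple R -> R) : \bar R :=
  (\int[lebesgue_measure]_(y in `[0%R, 1%R])
     \int[lebesgue_cube d]_x
       `| markov_kernel (linkage A) x `[0%R, y]%classic -
          markov_kernel (linkage B) x `[0%R, y]%classic |)%E.

Definition zeta1 (d : nat) (A : d.+1.-tuple R -> R) : \bar R :=
  (3%:E * D1 A (@Pi_copula d.+1))%E.

End copulas.

Section random_vectors.
Context {dT : measure_display} {T : measurableType dT} {R : realType}.
Variable P : probability T R.

Definition joint_cdf (n : nat) (Z : T -> n.-tuple R) (x : n.-tuple R) : R :=
  fine (P [set t | lower_orthant x (Z t)]).

Definition marginal_cdf (n : nat) (Z : T -> n.-tuple R) (i : 'I_n) (x : R) : R :=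
  fine (P [set t | tnth (Z t) i <= x]).

(* Row vectors are used here because tuples carry no topology. *)
Definition continuous_cdf (n : nat) (Z : T -> n.-tuple R) : Prop :=
  continuous (fun v : 'rV[R]_n => joint_cdf Z [tuple v ord0 i | i < n]).

(* Sklar's relation H(x) = C(F_1(x_1), ..., F_n(x_n)) *)
Definition is_copula_of (n : nat) (Z : T -> n.-tuple R) (C : n.-tuple R -> R) :
    Prop :=
  is_copula C /\
  forall x, joint_cdf Z x = C [tuple marginal_cdf Z i (tnth x i) | i < n].

Definition copula_of (n : nat) (Z : T -> n.-tuple R) : n.-tuple R -> R :=
  get [set C | is_copula_of Z C].

Definition join_vector (d : nat) (X : T -> d.-tuple R) (Y : T -> R) :
    T -> d.+1.-tuple R :=
  fun t => snoc (X t) (Y t).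

Definition zeta1_rv (d : nat) (X : T -> d.-tuple R) (Y : T -> R) : \bar R :=
  zeta1 (copula_of (join_vector X Y)).

Definition independent_of (d : nat) (X : T -> d.-tuple R) (Y : T -> R) : Prop :=
  forall (E : set (d.-tuple R)) (F : set R), measurable E -> measurable F ->
    P [set t | E (X t) /\ F (Y t)] = (P (X @^-1` E) * P (Y @^-1` F))%E.

End random_vectors.

Definition strictly_monotone (R : realType) (f : R -> R) : Prop :=
  {homo f : x y / x < y} \/ {homo f : x y /~ x < y}.

(* Main.v *)
(* Write V = F_Y(Y), which is uniform, and let M(y) be the supremum over Borel
   sets E of P(X in E, V <= y) - y P(X in E): how much better than chance X
   predicts the event {V <= y}.  The integral of |k - y| against the law of the
   predictors, where k is the conditional probability of {V <= y}, equals 2 M(y),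
   since k has mean y.  Applied to the linkage, this writes zeta^1 as the integral
   of 6 M(y) over [0,1] with M computed from the Rosenblatt transform.  That
   transform may be replaced by X itself: it determines X almost surely, so it
   predicts no worse, and the randomisation it uses is independent of (X, Y), so
   it predicts no better.  The five properties can then be read off M, which only
   depends on the sigma-algebra of X up to null sets: it increases with that
   sigma-algebra (part 5), is unchanged by monotone transformations of the X_i
   (part 4; a decreasing transformation of Y turns M(y) into M(1 - y)), and
   satisfies 0 <= M(y) <= y (1 - y), with integral 1/6 on the right (part 1).
   M is Lipschitz, so the extreme values of zeta^1 force equality for every y:
   M = 0 is independence (part 2), and M(y) = y (1 - y) says that {V <= y} is an
   event of X up to a null set (part 3). *)

Require Import Defs.
From HB Require Import structures.
From mathcomp Require Import all_boot all_order all_algebra.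
From mathcomp Require Import all_classical all_reals all_analysis.
From mathcomp Require unstable.
From mathcomp Require Import measurable_realfun lra ring.

Set Implicit Arguments.
Unset Strict Implicit.
Unset Printing Implicit Defensive.
Import Order.TTheory GRing.Theory Num.Theory.
Import numFieldNormedType.Exports.

Local Open Scope classical_set_scope.
Local Open Scope ring_scope.

(** Copula measures, Markov kernels and copulas of random vectors are selected by [get], so each
    needs an existence proof, and the selected object may be used only through its defining
    property. A measure is pinned down by its values on orthants with corner in the cube; a copula
    of a random vector by the ranges of the margins, which are dense in [0,1]; a kernel enters only
    through its integrals. A kernel must moreover give [0,1] mass 1 at every point of the cube,
    which Radon-Nikodym derivatives, defined up to null sets, do not provide. This is why the kernel
    is built as the law of a quantile function. M is a supremum over events rather than an integral
    of conditional probabilities, so that predictors are compared by comparing events up to null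
    sets. Such comparisons mostly follow one pattern: an inclusion between two events of equal
    probability is an equality up to a null set. In this way the Rosenblatt transform recovers X
    although it is randomised at atoms, and F_Y(Y) recovers Y although F_Y may have flat pieces. *)

(** * Uniqueness of measures from rectangles, orthants and orthants of the cube *)

Section measure_uniqueness.
Context {R : realType}.

Lemma measure_rectangle_unique d1 d2 (T1 : measurableType d1)
    (T2 : measurableType d2) (m1 m2 : {measure set (T1 * T2) -> \bar R}) :
  (m1 setT < +oo)%E ->
  (forall A B, measurable A -> measurable B -> m1 (A `*` B) = m2 (A `*` B)) ->
  forall C, measurable C -> m1 C = m2 C.
Proof.
move=> m1oo m12 C mC.
pose G := [set A `*` B | A in @measurable _ T1 & B in @measurable _ T2].
apply: (@g_sigma_algebra_measure_unique _ R _ G _ (fun=> setT)) => //.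
- by move=> _ [A mA] [B mB] <-; exact: measurableX.
- by move=> _; exists setT => //; exists setT => //; rewrite setXTT.
- by rewrite bigcup_const.
- move=> _ _ [A mA] [B mB] <- [A' mA'] [B' mB'] <-; rewrite -setXI.
  by exists (A `&` A'); [exact: measurableI|exists (B `&` B') => //; exact: measurableI].
- by move=> _ [A mA] [B mB] <-; exact: m12.
- by rewrite -measurable_prod_measurableType.
Qed.

Lemma measurable_preimage d d' (T : measurableType d) (T' : measurableType d')
    (f : T -> T') (B : set T') :
  measurable_fun setT f -> measurable B -> measurable (f @^-1` B).
Proof. by move=> mf mB; rewrite -[X in measurable X]setTI; exact: mf. Qed.

Lemma measurable_rays (S : set (set R)) :
  sigma_algebra setT S -> (forall a, S [set x | x <= a]) -> measurable `<=` S.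
Proof.
move=> sS Sa; rewrite [X in X `<=` _](RGenOInfty.measurableE R).
apply: smallest_sub => // _ [a ->].
have -> : `]a, +oo[%classic = setT `\` [set x | x <= a].
  apply/seteqP; split => x /=; rewrite in_itv /= andbT ltNge.
    by move=> /negP.
  by move=> [_ /negP].
by case: sS => _ + _; apply; exact: Sa.
Qed.

Lemma measurable_set_le d (T : measurableType d) (f : T -> R) (a : R) :
  measurable_fun setT f -> measurable [set t | f t <= a].
Proof.
move=> mf; rewrite -[X in measurable X]setTI.
have -> : [set t | f t <= a] = f @^-1` `]-oo, a]%classic.
  by apply/seteqP; split => t /=; rewrite in_itv.
exact: mf.
Qed.

Lemma measurable_set_lef d (T : measurableType d) (f g : T -> R) :
  measurable_fun setT f -> measurable_fun setT g -> measurable [set t | f t <= g t].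
Proof.
move=> mf mg.
have -> : [set t | f t <= g t] = [set t | (f \- g) t <= 0].
  by apply/seteqP; split => t; rewrite /= subr_le0.
by apply: (@measurable_set_le _ _ (f \- g)); exact: measurable_funB.
Qed.

Lemma measurable_coordinate_le (n : nat) (i : 'I_n) (a : R) :
  measurable [set z : n.-tuple R | tnth z i <= a].
Proof. by apply: (@measurable_set_le _ _ (fun z => tnth z i)); exact: measurable_tnth. Qed.

Lemma lower_orthantE (n : nat) (x : n.-tuple R) :
  lower_orthant x = \bigcap_(i in [set: 'I_n]) [set z | tnth z i <= tnth x i].
Proof. by apply/seteqP; split=> z //= zx i; [move=> _|]; exact: zx. Qed.

Lemma measurable_lower_orthant (n : nat) (x : n.-tuple R) :
  measurable (lower_orthant x).
Proof.
rewrite lower_orthantE; apply: fin_bigcap_measurable => // i _.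
exact: measurable_coordinate_le.
Qed.

Lemma measurable_cube (n : nat) : measurable (@cube R n).
Proof.
have -> : @cube R n = \bigcap_(i in [set: 'I_n])
    ([set z | 0 <= tnth z i] `&` [set z | tnth z i <= 1]).
  apply/seteqP; split=> z /= h i; first by move=> _; apply/andP; exact: h.
  by apply/andP; exact: h.
apply: fin_bigcap_measurable => // i _; apply: measurableI.
  by apply: measurable_set_lef; [exact: measurable_cst|exact: measurable_tnth].
exact: measurable_coordinate_le.
Qed.

Lemma lower_orthantI (n : nat) (x y : n.-tuple R) :
  lower_orthant x `&` lower_orthant y =
  lower_orthant [tuple Num.min (tnth x i) (tnth y i) | i < n].
Proof.
apply/seteqP; split=> z /=.
  by move=> [zx zy] i; rewrite tnth_mktuple le_min zx zy.
by move=> h; split=> i; have := h i; rewrite tnth_mktuple le_min => /andP[].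
Qed.

Lemma bigcup_lower_orthant (n : nat) :
  \bigcup_k lower_orthant (nseq_tuple n k%:R) = [set: n.-tuple R].
Proof.
rewrite -subTset => z _.
exists (\max_(i < n) (Num.truncn `|tnth z i|).+1)%N => // i.
rewrite tnth_nseq; apply: (le_trans (ler_norm _)).
apply: (le_trans (ltW (truncnS_gt _))); rewrite ler_nat.
exact: (@leq_bigmax _ (fun i => (Num.truncn `|tnth z i|).+1)).
Qed.

Lemma coordinate_le_bigcup (n : nat) (i : 'I_n) (a : R) :
  [set z : n.-tuple R | tnth z i <= a] =
  \bigcup_k lower_orthant [tuple if j == i then a else k%:R | j < n].
Proof.
apply/seteqP; split=> z /=; last first.
  by move=> [k _ /(_ i)]; rewrite tnth_mktuple eqxx.
move=> zi; have : (\bigcup_k lower_orthant (nseq_tuple n (k%:R : R))) z.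
  by rewrite bigcup_lower_orthant.
move=> [k _ zk]; exists k => // j; rewrite tnth_mktuple.
by case: eqP => [->//|_]; have := zk j; rewrite tnth_nseq.
Qed.

(** A coordinate half-space is a countable union of orthants whose other bounds grow, and
    half-spaces generate the product sigma-algebra. *)
Lemma measurable_orthants (n : nat) :
  @measurable _ (n.-tuple R) `<=` <<s range (@lower_orthant R n) >>.
Proof.
apply: smallest_sub => //=.
rewrite -bigcup_seq; apply: bigcup_sub => i _ _ [B mB <-]; rewrite setTI.
pose S := [set B : set R | <<s range (@lower_orthant R n) >>
  ((fun z : n.-tuple R => tnth z i) @^-1` B)].
suff : @measurable _ R `<=` S by apply.
apply: measurable_rays => [|a].
  split.
  - by rewrite /S /= preimage_set0; exact: sigma_algebra0.
  - by move=> A SA; rewrite /S /= setTD preimage_setC; exact: sigma_algebraC.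
  - by move=> A SA; rewrite /S /= preimage_bigcup; exact: sigma_algebra_bigcup.
suff : <<s range (@lower_orthant R n) >> [set z | tnth z i <= a] by [].
rewrite coordinate_le_bigcup; apply: sigma_algebra_bigcup => k.
by apply: sub_sigma_algebra; eexists.
Qed.

Lemma orthant_unique (n : nat) (m1 m2 : probability (n.-tuple R) R) :
  (forall x, m1 (lower_orthant x) = m2 (lower_orthant x)) ->
  forall E, measurable E -> m1 E = m2 E.
Proof.
move=> m12 E mE.
apply: (@g_sigma_algebra_measure_unique _ R _ (range (@lower_orthant R n)) _
  (fun k => lower_orthant (nseq_tuple n k%:R))) => //.
- by move=> _ [x _ <-]; exact: measurable_lower_orthant.
- exact: bigcup_lower_orthant.
- by move=> _ _ [x _ <-] [y _ <-]; rewrite lower_orthantI; eexists.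
- by move=> _ [x _ <-]; exact: m12.
- by move=> k; rewrite -ge0_fin_numE// fin_num_measure//; exact: measurable_lower_orthant.
- exact: measurable_orthants.
Qed.

Lemma probability1I d (T : measurableType d) (P : probability T R) (A B : set T) :
  measurable A -> measurable B -> P A = 1%E -> P (B `&` A) = P B.
Proof.
move=> mA mB PA.
have PBA : P (B `\` A) = 0%E.
  apply/eqP; rewrite -measure_le0; have := probability_setC P mA.
  rewrite PA subee// => <-; rewrite le_measure ?inE//.
  - exact: measurableD.
  - exact: measurableC.
by rewrite [in RHS](measureDI P mB mA) -[LHS]add0e; congr (_ + _)%E.
Qed.

(** A copula prescribes values at points of the cube only. For measures carried by the cube this
    suffices: an orthant whose corner has a negative coordinate misses the cube, and any other
    corner may be truncated at 1. *)
Lemma orthant_unique_cube (n : nat) (m1 m2 : probability (n.-tuple R) R) :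
  m1 (cube n) = 1%E -> m2 (cube n) = 1%E ->
  (forall x, cube n x -> m1 (lower_orthant x) = m2 (lower_orthant x)) ->
  forall E, measurable E -> m1 E = m2 E.
Proof.
move=> m1c m2c m12; apply: orthant_unique => x.
have mx := measurable_lower_orthant x; have mc := @measurable_cube n.
rewrite -(probability1I mc mx m1c) -(probability1I mc mx m2c).
have [x0|] := pselect (forall i, 0 <= tnth x i); last first.
  move=> /existsNP[i /negP]; rewrite -ltNge => xi.
  have -> : lower_orthant x `&` cube n = set0; last by rewrite !measure0.
  apply/seteqP; split => // z [/(_ i) zx /(_ i)/andP[z0 _]].
  by have := lt_le_trans xi (le_trans z0 zx); rewrite ltxx.
pose y := [tuple Num.min (tnth x i) 1 | i < n].
have -> : lower_orthant x `&` cube n = lower_orthant y `&` cube n.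
  apply/seteqP; split=> z [zx zc]; split=> // i.
    by rewrite tnth_mktuple le_min zx; have /andP[] := zc i.
  by have := zx i; rewrite tnth_mktuple le_min => /andP[].
have my := measurable_lower_orthant y.
rewrite (probability1I mc my m1c) (probability1I mc my m2c); apply: m12 => i.
by rewrite tnth_mktuple le_min x0 ler01 ge_min lexx orbT.
Qed.

(** [distribution] wants a bundled measurable function; this variant takes the measurability proof
    as an argument. *)
Definition law d d' (T : measurableType d) (T' : measurableType d')
    (P : probability T R) (f : T -> T') (mf : measurable_fun setT f) :
    probability T' R :=
  distribution P (mfun_Sub (mem_set mf : f \in mfun)).

Lemma lawE d d' (T : measurableType d) (T' : measurableType d')
    (P : probability T R) (f : T -> T') (mf : measurable_fun setT f) (E : set T') :
  law P mf E = P (f @^-1` E).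
Proof. by []. Qed.

End measure_uniqueness.

(** * The measure of a copula and its margins *)

Section copula_measures.
Context {R : realType}.

Lemma copula_measureP (n : nat) (C : n.-tuple R -> R) :
  is_copula C -> has_cdf_on_cube C (copula_measure C).
Proof. by move=> [mu muC _]; apply: getPex; exists mu. Qed.

Lemma has_cdf_on_cube_unique (n : nat) (C : n.-tuple R -> R)
    (m1 m2 : probability (n.-tuple R) R) :
  has_cdf_on_cube C m1 -> has_cdf_on_cube C m2 ->
  forall E, measurable E -> m1 E = m2 E.
Proof.
move=> [m1c m1C] [m2c m2C]; apply: orthant_unique_cube => // x xc.
by rewrite m1C// m2C.
Qed.

(** The way to compute with the [get] in [copula_measure]: exhibit any measure with the right
    distribution function. *)
Lemma copula_measureE (n : nat) (C : n.-tuple R -> R)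
    (mu : probability (n.-tuple R) R) :
  has_cdf_on_cube C mu ->
  forall E, measurable E -> copula_measure C E = mu E.
Proof.
move=> muC; apply: (@has_cdf_on_cube_unique _ C) => //.
by apply: getPex; exists mu.
Qed.

Lemma copula_uniform_margins (n : nat) (C : n.-tuple R -> R) :
  is_copula C -> uniform_margins (copula_measure C).
Proof.
move=> [mu muC muU] i u u01; rewrite (copula_measureE muC); first exact: muU.
exact: measurable_coordinate_le.
Qed.

Lemma tnth_first_coords (k n : nat) (x : n.-tuple R) (i : 'I_k) (j : 'I_n) :
  i = j :> nat -> tnth (first_coords k x) i = tnth x j.
Proof. by move=> ij; rewrite tnth_mktuple ij -tnth_nth. Qed.

Lemma first_coords_comp (i k n : nat) (x : n.-tuple R) : (i <= k)%N ->
  first_coords i (first_coords k x) = first_coords i x.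
Proof.
move=> ik; apply: eq_from_tnth => j; rewrite !tnth_mktuple.
have jk : (j < k)%N by exact: leq_trans ik.
by rewrite -(tnth_nth 0 (first_coords k x) (Ordinal jk)) tnth_mktuple.
Qed.

Lemma measurable_nth (n i : nat) :
  measurable_fun setT (fun x : n.-tuple R => nth 0 x i).
Proof.
have [ni|ni] := ltnP i n; last first.
  rewrite (_ : (fun _ => _) = cst 0)//; apply/funext => x.
  by rewrite nth_default ?size_tuple.
rewrite (_ : (fun _ => _) = (@tnth n R)^~ (Ordinal ni)); first exact: measurable_tnth.
by apply/funext => x; rewrite (tnth_nth 0).
Qed.

Lemma measurable_first_coords (k n : nat) :
  measurable_fun setT (@first_coords R k n).
Proof.
apply/measurable_fun_tnthP => i.
rewrite (_ : _ \o _ = fun x : n.-tuple R => nth 0 x i); first exact: measurable_nth.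
by apply/funext => x; rewrite /= tnth_mktuple.
Qed.

Lemma cube_first_coords (k n : nat) (x : n.-tuple R) : (k <= n)%N ->
  cube n x -> cube k (first_coords k x).
Proof.
move=> kn xc i; have := xc (widen_ord kn i).
by rewrite -(@tnth_first_coords k n x i).
Qed.

Lemma cube_pad1 (k n : nat) (x : k.-tuple R) : cube k x -> cube n (pad1 n x).
Proof.
move=> xc i; rewrite tnth_mktuple; have [ik|ki] := ltnP i k.
  by have := xc (Ordinal ik); rewrite (tnth_nth 1).
by rewrite nth_default ?size_tuple// ler01 lexx.
Qed.

(** On the cube the bounds 1 added by the padding are no constraint, which is why [marginal]
    describes the law of the first coordinates. *)
Lemma pad1_orthant (k n : nat) (x : k.-tuple R) : (k <= n)%N ->
  lower_orthant (pad1 n x) `&` cube n =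
  first_coords k @^-1` lower_orthant x `&` cube n.
Proof.
move=> kn; apply/seteqP; split=> z /= [h zc]; split=> // i.
  rewrite (@tnth_first_coords _ _ _ _ (widen_ord kn i))//.
  by have := h (widen_ord kn i); rewrite tnth_mktuple (tnth_nth 1 x i).
rewrite tnth_mktuple; have [ik|ki] := ltnP i k.
  have := h (Ordinal ik).
  by rewrite (@tnth_first_coords _ _ _ _ i)// (tnth_nth 1 x).
by rewrite nth_default ?size_tuple//; have /andP[] := zc i.
Qed.

Lemma marginal_has_cdf (k n : nat) (C : n.-tuple R -> R) : (k <= n)%N ->
  is_copula C ->
  has_cdf_on_cube (@marginal R n k C) (law (copula_measure C) (@measurable_first_coords k n)).
Proof.
move=> kn /copula_measureP [Cc CC]; split.
  rewrite lawE; apply/eqP; rewrite eq_le; apply/andP; split.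
    by apply: probability_le1; apply: measurable_preimage; [exact: measurable_first_coords|exact: measurable_cube].
  rewrite -[leLHS]Cc le_measure ?inE//.
  - exact: measurable_cube.
  - by apply: measurable_preimage; [exact: measurable_first_coords|exact: measurable_cube].
  - by move=> x; exact: cube_first_coords.
move=> x xc; rewrite lawE.
have mo : measurable (first_coords k @^-1` lower_orthant x : set (n.-tuple R)).
  by apply: measurable_preimage; [exact: measurable_first_coords|exact: measurable_lower_orthant].
rewrite -(probability1I (@measurable_cube _ n) mo Cc) -pad1_orthant//.
rewrite (probability1I (@measurable_cube _ n) _ Cc); last exact: measurable_lower_orthant.
by rewrite CC//; exact: cube_pad1.
Qed.

Lemma marginal_is_copula (k n : nat) (C : n.-tuple R -> R) : (k <= n)%N ->
  is_copula C -> is_copula (@marginal R n k C).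
Proof.
move=> kn cC; exists (law (copula_measure C) (@measurable_first_coords k n)).
  exact: marginal_has_cdf.
move=> i u u01; rewrite lawE.
rewrite -[RHS](copula_uniform_margins cC (widen_ord kn i) u01).
congr (copula_measure C _); apply/seteqP; split=> z /=;
  by rewrite (@tnth_first_coords _ _ _ _ (widen_ord kn i)).
Qed.

Lemma copula_measure_marginal (k n : nat) (C : n.-tuple R -> R) E : (k <= n)%N ->
  is_copula C -> measurable E ->
  copula_measure (@marginal R n k C) E = copula_measure C (first_coords k @^-1` E).
Proof. by move=> kn cC mE; rewrite (copula_measureE (marginal_has_cdf kn cC)). Qed.

Lemma copula_last_itv (k : nat) (C : k.+1.-tuple R -> R) : is_copula C ->
  copula_measure C [set z | 0 <= tnth z ord_max <= 1] = 1%E.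
Proof.
move=> /copula_measureP[Cc _]; have m01 : measurable [set z : k.+1.-tuple R | 0 <= tnth z ord_max <= 1].
  have -> : [set z : k.+1.-tuple R | 0 <= tnth z ord_max <= 1] =
      [set z | 0 <= tnth z ord_max] `&` [set z | tnth z ord_max <= 1].
    by apply/seteqP; split => z /= /andP.
  apply: measurableI; last exact: measurable_coordinate_le.
  by apply: measurable_set_lef; [exact: measurable_cst|exact: measurable_tnth].
apply/eqP; rewrite eq_le probability_le1//= -Cc le_measure ?inE//; first exact: measurable_cube.
by move=> z; exact.
Qed.

End copula_measures.

(** * Measures built from kernels and restrictions; the uniform law on [0,1] *)

Section kernel_joint.
Context {R : realType} d1 d2 (T1 : measurableType d1) (T2 : measurableType d2).
Variables (m : probability T1 R) (K : R.-pker T1 ~> T2).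

(** The law of a pair whose first component has law [m] and whose second has conditional law [K x]
    given the first. *)
Definition kernel_joint (C : set (T1 * T2)) : \bar R :=
  (\int[m]_x K x (xsection C x))%E.

Lemma measurable_kernel_xsection (C : set (T1 * T2)) : measurable C ->
  measurable_fun setT (fun x => K x (xsection C x)).
Proof. by move=> mC; by apply: measurable_fun_xsection_finite_kernel; rewrite inE. Qed.

Let kernel_joint0 : kernel_joint set0 = 0%E.
Proof. by apply: integral0_eq => x _; rewrite xsection0 measure0. Qed.

Let kernel_joint_ge0 C : (0 <= kernel_joint C)%E.
Proof. exact: integral_ge0. Qed.

Let kernel_joint_additive : semi_sigma_additive kernel_joint.
Proof.
move=> F mF tF mUF; apply: cvg_toP.
  by apply: is_cvg_ereal_nneg_natsum => n _; exact: integral_ge0.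
rewrite /kernel_joint -integral_nneseries//; last first.
  by move=> n; exact: measurable_kernel_xsection.
apply: eq_integral => x _; rewrite xsection_bigcup.
rewrite measure_bigcup//.
- by apply: eq_eseriesl => i; rewrite in_setT.
- by move=> i _; exact: measurable_xsection.
- exact: trivIset_xsection.
Qed.

HB.instance Definition _ := isMeasure.Build _ _ _ kernel_joint
  kernel_joint0 kernel_joint_ge0 kernel_joint_additive.

Lemma kernel_jointX (A : set T1) (B : set T2) : measurable A -> measurable B ->
  kernel_joint (A `*` B) = (\int[m]_(x in A) K x B)%E.
Proof.
move=> mA mB; rewrite /kernel_joint [RHS]integral_mkcond.
apply: eq_integral => x _; rewrite patchE; case: ifPn => xA.
  by rewrite in_xsectionX.
by rewrite notin_xsectionX// measure0.
Qed.

Lemma kernel_jointT : kernel_joint setT = 1%E.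
Proof.
rewrite -setXTT kernel_jointX//.
under eq_integral do rewrite prob_kernel.
by rewrite integral_cst// mul1e; exact: probability_setT.
Qed.

HB.instance Definition _ := Measure_isProbability.Build _ _ _ kernel_joint
  kernel_jointT.

End kernel_joint.

Section partial_law.
Context {R : realType} d d' (T : measurableType d) (T' : measurableType d').
Variables (P : probability T R) (D : set T) (mD : measurable D).
Variables (f : T -> T') (mf : measurable_fun setT f).

(** The law of [f] on the event [D], not normalised. With one event frozen in [D], an identity for
    pairs of events becomes an equality of measures in the other event, to which the uniqueness
    lemmas apply. *)
Definition partial_law := pushforward (mrestr P mD) (mfun_Sub (mem_set mf : f \in mfun)).

Let partial_law0 : partial_law set0 = 0%E.
Proof. exact: measure0. Qed.

Let partial_law_ge0 E : (0 <= partial_law E)%E.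
Proof. exact: measure_ge0. Qed.

Let partial_law_additive : semi_sigma_additive partial_law.
Proof. exact: measure_semi_sigma_additive. Qed.

HB.instance Definition _ := isMeasure.Build _ _ _ partial_law
  partial_law0 partial_law_ge0 partial_law_additive.

Lemma partial_lawE E : partial_law E = P (f @^-1` E `&` D).
Proof. by []. Qed.

Let partial_law_finite : fin_num_fun partial_law.
Proof.
move=> E mE; rewrite partial_lawE fin_num_measure//.
by apply: measurableI => //; exact: measurable_preimage.
Qed.

HB.instance Definition _ := Measure_isFinite.Build _ _ _ partial_law partial_law_finite.

End partial_law.

Section uniform01.
Context {R : realType}.

Let of_borel (x : measurableTypeR R) : R := x.

Let measurable_of_borel : measurable_fun setT of_borel.
Proof. by move=> _ B mB; rewrite setTI. Qed.

(* lebesgue_measure and uniform_prob live on measurableTypeR R, which has the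
   Borel sets of R but another display. *)
Definition unif01 : probability R R :=
  law (uniform_prob (@ltr01 R)) measurable_of_borel.

Lemma unif01E (U : set R) : measurable U ->
  unif01 U = lebesgue_measure (U `&` `[0, 1]%classic).
Proof.
move=> mU.
have -> : unif01 U = (\int[lebesgue_measure]_(x in U) (uniform_pdf 0 1 x)%:E)%E by [].
rewrite integral_uniform_pdf.
rewrite (eq_integral (cst 1%E)).
  by rewrite integral_cst ?mul1e//; exact: measurableI.
move=> x; rewrite inE /= => -[_]; rewrite in_itv /= => x01.
by rewrite /uniform_pdf x01 subr0 invr1.
Qed.

Lemma unif01_le (c : R) : 0 <= c <= 1 -> unif01 [set v | v <= c] = c%:E.
Proof.
move=> /andP[c0 c1]; rewrite unif01E; last first.
  by apply: (@measurable_set_le R _ R id); exact: measurable_id.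
have -> : [set v | v <= c] `&` `[0, 1]%classic = `[0, c]%classic.
  apply/seteqP; split=> x /=; rewrite !in_itv /=.
    by move=> [-> /andP[->]].
  by move=> /andP[-> xc]; rewrite xc (le_trans xc).
rewrite lebesgue_measure_itv /= lte_fin.
by case: ltgtP c0 => // [c0|<-]; rewrite ?sube0.
Qed.

Lemma unif01_itv : unif01 `[0, 1]%classic = 1%E.
Proof. by rewrite unif01E// setIid lebesgue_measure_itv /= lte01 sube0. Qed.

End uniform01.

Section rational_exhaustion.
Context {R : realType}.

(** Conditional distribution functions will be available at rationals only; along [s] they reach the
    strict ray below a real [t] by monotone convergence. [s] is the running maximum of the
    enumerated rationals in [0, t). *)
Lemma rational_exhaustion (t : R) : 0 < t -> exists s : nat -> rat,
  [/\ forall n, 0 <= s n, forall n, ratr (s n) < t, nondecreasing_seq s &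
      forall x : R, x < t -> exists n, x <= ratr (s n)].
Proof.
move=> t0; pose q (n : nat) : rat := odflt 0 (unpickle n).
pose ok n := (0 <= q n) && (ratr (q n) < t).
pose s := fix s n := if n is m.+1 then
  (if ok m then Num.max (s m) (q m) else s m) else 0 : rat.
have sS n : s n.+1 = if ok n then Num.max (s n) (q n) else s n by [].
exists s; split.
- elim=> // n ih; rewrite sS; case: ifP => // _.
  by rewrite le_max ih.
- elim=> [|n ih]; first by rewrite /= rmorph0.
  rewrite sS; case: ifP => // /andP[_ qt].
  by rewrite /Num.max; case: ifP.
- apply/nondecreasing_seqP => n; rewrite sS; case: ifP => // _.
  by rewrite le_max lexx.
- move=> x xt; have : Num.max x 0 < t by rewrite gt_max xt.
  move=> /rat_in_itvoo[r]; rewrite in_itv /= gt_max => /andP[/andP[xr r0] rt].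
  exists (pickle r).+1; rewrite sS.
  have qr : q (pickle r) = r by rewrite /q pickleK.
  rewrite /ok qr rt -(ler0q R) (ltW r0) /=.
  by rewrite (le_trans (ltW xr))// ler_rat le_max lexx orbT.
Qed.

End rational_exhaustion.

Section pushforward_kernel.
Context {R : realType} d1 d2 d3 (T1 : measurableType d1) (T2 : measurableType d2)
  (T3 : measurableType d3).
Variables (U : probability T2 R) (G : T1 * T2 -> T3) (mG : measurable_fun setT G).

(** The law of [G (x, u)] with [u] drawn from [U]: a probability for every [x], without exceptional
    set. *)
Definition pushforward_kernel (x : T1) : {measure set T3 -> \bar R} :=
  law U (measurable_fun_pair2 x mG).

Let measurable_pushforward_kernel F : measurable F ->
  measurable_fun setT (pushforward_kernel ^~ F).
Proof.
move=> mF; rewrite (_ : (fun _ => _) = fun x => U (xsection (G @^-1` F) x)).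
  exact/measurable_fun_xsection/measurable_preimage.
by apply/funext => x; rewrite xsectionE.
Qed.

HB.instance Definition _ := isKernel.Build _ _ _ _ _ pushforward_kernel
  measurable_pushforward_kernel.

Let pushforward_kernel_prob x : pushforward_kernel x setT = 1%E.
Proof. exact: probability_setT. Qed.

HB.instance Definition _ := Kernel_isProbability.Build _ _ _ _ _
  pushforward_kernel pushforward_kernel_prob.

End pushforward_kernel.

(** * Existence of regular conditional distributions on [0,1] *)

Section disintegration.
Context {R : realType}.

(** On measurable parts of the set where [g < f] the two integrals are forced to be equal, so
    [f = g] almost everywhere on that set. *)
Lemma integral_le_negligible d (T : measurableType d) (m : probability T R)
    (f g : T -> R) :
  measurable_fun setT f -> measurable_fun setT g ->
  (forall x, 0 <= f x) -> (forall x, 0 <= g x) ->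
  (\int[m]_x (f x)%:E < +oo)%E ->
  (forall E, measurable E ->
    (\int[m]_(x in E) (f x)%:E <= \int[m]_(x in E) (g x)%:E)%E) ->
  m.-negligible [set x | g x < f x].
Proof.
move=> mf mg f0 g0 foo fg.
set N := [set x | g x < f x].
have mN : measurable N.
  have -> : N = ~` [set x | f x <= g x].
    by apply/seteqP; split => x /=; rewrite /N /= ltNge => /negP.
  exact/measurableC/measurable_set_lef.
have mfE D : measurable_fun D (EFin \o f) by exact/measurable_funTS/measurable_EFinP.
have mgE D : measurable_fun D (EFin \o g) by exact/measurable_funTS/measurable_EFinP.
have intf : m.-integrable N (EFin \o f).
  apply/integrableP; split=> //; apply: le_lt_trans foo.
  under eq_integral do rewrite /= ger0_norm//.
  by apply: ge0_subset_integral => // x _; rewrite lee_fin.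
have : ae_eq m N (EFin \o f) (EFin \o g).
  apply: integral_ae_eq => // E EN mE; apply/eqP; rewrite eq_le fg//=.
  by apply: ge0_le_integral => //= [x _|x /EN]; rewrite lee_fin => // /ltW.
apply: negligibleS => x /= Nx fgx.
have [fgE] := fgx Nx.
by move: Nx; rewrite /N /= fgE ltxx.
Qed.

Lemma measure_rays_unique (m1 m2 : {measure set R -> \bar R}) :
  (m1 setT < +oo)%E -> (forall t, m1 [set x | x < t] = m2 [set x | x < t]) ->
  forall F, measurable F -> m1 F = m2 F.
Proof.
move=> m1oo m12 F mF.
have rayE (t : R) : [set x | x < t] = `]-oo, t[%classic.
  by apply/seteqP; split => x /=; rewrite in_itv.
have mray (t : R) : measurable [set x | x < t] by rewrite rayE.
apply: (@g_sigma_algebra_measure_unique _ R _ (range (fun t : R => [set x | x < t]))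
   _ (fun k : nat => [set x | x < k%:R])) => //.
- by move=> _ [t _ <-].
- rewrite -subTset => x _; exists (Num.truncn `|x|).+1 => //=.
  by rewrite (le_lt_trans (ler_norm _))// truncnS_gt.
- move=> _ _ [s _ <-] [t _ <-]; exists (Num.min s t) => //.
  by apply/seteqP; split => x /=; rewrite lt_min => /andP.
- by move=> _ [t _ <-]; exact: m12.
- by move=> k; rewrite (le_lt_trans _ m1oo)// le_measure ?inE.
have -> : range (fun t : R => [set x | x < t]) = @RGenInftyO.G R.
  by apply/seteqP; split => [_ [t _ <-]|_ [t ->]]; exists t.
by rewrite [X in X F](RGenInftyO.measurableE R) in mF.
Qed.

Context d d1 (T : measurableType d) (T1 : measurableType d1).
Variables (P : probability T R) (X : T -> T1) (V : T -> R).
Hypotheses (mX : measurable_fun setT X) (mV : measurable_fun setT V).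

(** [f] is a conditional probability of {V <= q} given X: the Radon-Nikodym derivative of the law of
    X on that event. *)
Lemma conditional_density (q : R) : exists f : T1 -> R,
  [/\ forall x, 0 <= f x, measurable_fun setT f &
      forall E, measurable E ->
        P (X @^-1` E `&` [set t | V t <= q]) = (\int[law P mX]_(x in E) (f x)%:E)%E].
Proof.
pose nu := partial_law P (measurable_set_le q mV) mX.
have nuP : nu `<< law P mX.
  apply/null_content_dominatesP => E mE /= PE.
  apply/eqP; rewrite -measure_le0 -PE.
  apply: (@le_measure _ _ _ P (X @^-1` E `&` _) (X @^-1` E)); rewrite ?inE//.
  - apply: measurableI; last exact: measurable_set_le.
    exact: measurable_preimage.
  - exact: measurable_preimage.
have [f [f0 ff intf fE]] := radon_nikodym_sigma_finite nuP.
exists (fine \o f); split => [x||E mE].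
- exact/fine_ge0.
- by apply: measurableT_comp => //; exact: (measurable_int _ intf).
- rewrite [LHS](fE E mE); apply: eq_integral => x _.
  by rewrite /= fineK.
Qed.

Let below q : set T1 -> \bar R := fun E => P (X @^-1` E `&` [set t | V t <= q]).

Let enum_rat (n : nat) : rat := odflt 0 (unpickle n).

Let enum_ratK (q : rat) : enum_rat (pickle q) = q.
Proof. by rewrite /enum_rat pickleK. Qed.

Let belowS (p q : R) E : measurable E -> p <= q -> (below p E <= below q E)%E.
Proof.
move=> mE pq; rewrite le_measure ?inE//.
- by apply: measurableI; [exact: measurable_preimage|exact: measurable_set_le].
- by apply: measurableI; [exact: measurable_preimage|exact: measurable_set_le].
- by move=> t [? /= Vp]; split => //=; exact: le_trans pq.
Qed.

Let below_le (q : R) E : measurable E -> (below q E <= law P mX E)%E.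
Proof.
move=> mE; rewrite lawE le_measure ?inE//.
- by apply: measurableI; [exact: measurable_preimage|exact: measurable_set_le].
- exact: measurable_preimage.
Qed.

(** The conditional probabilities at rational levels are each unique up to null sets. Countably many
    levels leave one common null set [N] where monotonicity or the bound 1 can fail, and there they
    are redefined. *)
Let monotone_density : exists h : rat -> T1 -> R,
  [/\ forall q, measurable_fun setT (h q), forall q x, 0 <= h q x <= 1,
     forall p q x, p <= q -> h p x <= h q x &
     forall q E, measurable E ->
       below (ratr q) E = (\int[law P mX]_(x in E) (h q x)%:E)%E].
Proof.
have [f /all_and3[f0 mf fE]] := choice (fun q : rat => conditional_density (ratr q)).
set m := law P mX.
have foo q : (\int[m]_x (f q x)%:E < +oo)%E.
  by rewrite -fE// (le_lt_trans (below_le _ _))// probability_setT ltry.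
pose bad (p q : rat) := if p <= q then [set x | f q x < f p x] else set0.
pose N := \bigcup_i ([set x | 1 < f (enum_rat i) x] `|`
  \bigcup_j bad (enum_rat i) (enum_rat j)).
have mlt (u v : T1 -> R) : measurable_fun setT u -> measurable_fun setT v ->
    measurable [set x | u x < v x].
  move=> mu mv; have -> : [set x | u x < v x] = ~` [set x | v x <= u x].
    by apply/seteqP; split => x /=; rewrite ltNge => /negP.
  exact/measurableC/measurable_set_lef.
have mN : measurable N.
  apply: bigcupT_measurable => i; apply: measurableU.
    by apply: mlt => //; exact: measurable_cst.
  apply: bigcupT_measurable => j; rewrite /bad; case: ifP => // _.
  exact: mlt.
have negN : m.-negligible N.
  apply: negligible_bigcup => i; apply: negligibleU.
    apply: (@integral_le_negligible _ _ m (f (enum_rat i)) (cst 1)) => //.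
    by move=> E mE; rewrite -fE//= integral_cst// mul1e; exact: below_le.
  apply: negligible_bigcup => j; rewrite /bad; case: ifP => [ij|_]; last exact: negligible_set0.
  apply: integral_le_negligible => // E mE; rewrite -!fE//; apply: belowS => //.
  by rewrite ler_rat.
(* The distribution function of the unit mass at 0, put on the exceptional set. *)
pose c (q : rat) : R := if 0 <= q then 1 else 0.
pose h q x := if x \in N then c q else f q x.
have hE q : h q = (fun x => f q x * \1_(~` N) x + c q * \1_N x).
  apply/funext => x; rewrite /h !indicE in_setC; case: (x \in N) => /=.
    by rewrite mulr0 mulr1 add0r.
  by rewrite mulr0 mulr1 addr0.
have mh q : measurable_fun setT (h q).
  rewrite hE; apply: measurable_funD; apply: measurable_funM => //.
  exact/measurable_indic/measurableC.
have notN x p : x \notin N -> f p x <= 1 /\ forall q, p <= q -> f p x <= f q x.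
  move=> xN; split=> [|q pq]; rewrite leNgt; apply/negP => fx; move/negP: xN; apply.
    by rewrite inE; exists (pickle p); [exact: I|left; rewrite /= enum_ratK].
  rewrite inE; exists (pickle p); [exact: I|right; exists (pickle q); first exact: I].
  by rewrite !enum_ratK /bad pq.
exists h; split => // [q x|p q x pq|q E mE].
- rewrite /h; case: ifPn => [_|xN].
    by rewrite /c; case: ifP; rewrite ?lexx ?ler01.
  by rewrite f0/=; have [] := notN _ q xN.
- rewrite /h; case: ifPn => [_|xN].
    rewrite /c; case: (leP 0 p) => p0; first by rewrite (le_trans p0 pq).
    by case: ifP.
  by have [_] := notN _ p xN; apply.
- rewrite /below fE//; apply: ae_eq_integral => //.
  + exact/measurable_funTS/measurable_EFinP.
  + exact/measurable_funTS/measurable_EFinP.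
  apply: negligibleS negN => x /= hx; apply: contrapT => xN; apply: hx => _.
  by rewrite /h memNset.
Qed.

Hypothesis V01 : P [set t | 0 <= V t <= 1] = 1%E.

Let mV01 : measurable [set t | 0 <= V t <= 1].
Proof.
have -> : [set t | 0 <= V t <= 1] = [set t | 0 <= V t] `&` [set t | V t <= 1].
  by apply/seteqP; split => t /= /andP.
apply: measurableI; last exact: measurable_set_le.
by apply: measurable_set_lef => //; exact: measurable_cst.
Qed.

(** [K x] is the law of [G (x, v)] for uniform [v], where [G (x, .)] is the quantile function of the
    conditional distribution function [h . x]. Since [G] takes values in [0,1], so does every [K x].
    For fixed [E] both sides are measures in [F], to be compared on strict rays. *)
Lemma disintegration : exists K : R.-pker T1 ~> R,
  (forall x, K x `[0, 1]%classic = 1%E) /\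
  forall E F, measurable E -> measurable F ->
    P (X @^-1` E `&` V @^-1` F) = (\int[law P mX]_(x in E) K x F)%E.
Proof.
have [h [mh h01 hmono hE]] := monotone_density.
set m := law P mX in hE *.
(* The default 1 keeps the infimum in [0,1]; it never witnesses [G < t], since the main case below
   has [t <= 1]. *)
pose a n (xv : T1 * R) : R := if (0 <= enum_rat n <= 1) && (xv.2 <= h (enum_rat n) xv.1)
  then ratr (enum_rat n) else 1.
have a01 n xv : 0 <= a n xv <= 1.
  rewrite /a; case: ifP => [/andP[/andP[q0 q1] _]|_]; last by rewrite ler01 lexx.
  by rewrite ler0q q0/= -[leRHS](@ratr_int R 1) ler_rat.
have ma n : measurable_fun setT (a n).
  rewrite /a; case: (0 <= enum_rat n <= 1); last exact: measurable_cst.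
  apply: measurable_fun_ifT; [|exact: measurable_cst|exact: measurable_cst].
  apply: measurable_fun_ler; first exact: measurable_snd.
  by apply: measurableT_comp => //; exact: measurable_fst.
pose G (xv : T1 * R) : R := infs (a ^~ xv) 0.
have mG : measurable_fun setT G.
  apply: measurable_fun_infs => // xv _; exists 0 => _ [n _ <-].
  by have /andP[] := a01 n xv.
have GE xv : G xv = inf (range (a ^~ xv)).
  by rewrite /G /infs; congr inf; apply/seteqP; split => [_ [n _ <-]|_ [n _ <-]]; exists n.
have lbG xv : has_lbound (range (a ^~ xv)).
  by exists 0 => _ [n _ <-]; have /andP[] := a01 n xv.
have neG xv : range (a ^~ xv) !=set0 by exists (a 0%N xv); exists 0%N.
have G01 xv : 0 <= G xv <= 1.
  rewrite GE; apply/andP; split.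
    by apply: lb_le_inf => // _ [n _ <-]; have /andP[] := a01 n xv.
  apply: (@le_trans _ _ (a 0%N xv)); last by have /andP[] := a01 0%N xv.
  by apply: ge_inf => //; exists 0%N.
pose K : R.-pker T1 ~> R := pushforward_kernel unif01 mG.
have KE x F : K x F = unif01 [set v | F (G (x, v))] by [].
have K01 x : K x `[0, 1]%classic = 1%E.
  rewrite KE (_ : [set v | _] = setT); first exact: probability_setT.
  by apply/seteqP; split=> v //= _; rewrite in_itv /= G01.
exists K; split => // E F mE mF.
pose N := kernel_joint m K.
have KN F' : measurable F' -> (\int[m]_(x in E) K x F')%E = N (E `*` F').
  by move=> mF'; rewrite /N kernel_jointX.
have mES : measurable (E `*` [set: R]) by exact: measurableX.
pose m1 : {measure set R -> \bar R} := partial_law P (measurable_preimage mX mE) mV.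
pose m2 : {measure set R -> \bar R} := partial_law N mES (@measurable_snd _ _ T1 R).
have m1E F' : m1 F' = P (X @^-1` E `&` V @^-1` F').
  by rewrite setIC; exact: partial_lawE.
have m2E F' : m2 F' = N (E `*` F').
  have -> : E `*` F' = snd @^-1` F' `&` (E `*` setT).
    by apply/seteqP; split=> -[x v] /= []; [move=> ? ?|move=> ? []].
  exact: partial_lawE.
rewrite KN// -m1E -m2E; apply: measure_rays_unique => //.
  by rewrite m1E (le_lt_trans (probability_le1 _ _)) ?ltry// preimage_setT setIT; exact: measurable_preimage.
move=> t; rewrite m1E m2E.
have mlt : measurable [set v : R | v < t].
  by rewrite (_ : [set v | v < t] = `]-oo, t[%classic)//; apply/seteqP; split => v /=; rewrite in_itv.
rewrite -KN//.
have mXE : measurable (X @^-1` E) by exact: measurable_preimage.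
have mVt : measurable (V @^-1` [set v | v < t]) by exact: measurable_preimage.
(* Outside 0 < t <= 1 both sides are 0 or P(X in E), because [V] almost surely and [G] always lie in
   [0,1]. *)
have [t0|t0] := leP t 0.
  rewrite integral0_eq; last first.
    move=> x _; rewrite KE (_ : [set v | _] = set0) ?measure0//.
    apply/seteqP; split=> v //= /lt_le_trans/(_ t0).
    by rewrite ltNge; have /andP[->] := G01 (x, v).
  rewrite -(probability1I mV01 _ V01); last exact: measurableI.
  rewrite (_ : _ `&` _ = set0) ?measure0//.
  apply/seteqP; split=> s //= [[_ /lt_le_trans/(_ t0)]].
  by rewrite ltNge => /negP V0 /andP[].
have [t1|t1] := ltP 1 t.
  rewrite (eq_integral (cst 1%E)); last first.
    move=> x _; rewrite KE (_ : [set v | _] = setT); first exact: probability_setT.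
    apply/seteqP; split=> v //= _; rewrite (le_lt_trans _ t1)//.
    by have /andP[] := G01 (x, v).
  rewrite integral_cst// mul1e; transitivity (P (X @^-1` E)) => //.
  rewrite -(probability1I mV01 _ V01); last exact: measurableI.
  rewrite -[RHS](probability1I mV01 mXE V01).
  congr (P _); apply/seteqP; split=> s /=; first by move=> [[]].
  by move=> [Es /[dup] Vs /andP[_ V1]]; split => //; split => //; exact: le_lt_trans t1.
have [s [s0 st smono sex]] := rational_exhaustion t0.
have s1 n : s n <= 1.
  by rewrite -(ler_rat R) rmorph1 ltW// (lt_le_trans (st n)) //.
have PE : P (X @^-1` E `&` V @^-1` [set v | v < t]) =
    limn (fun n => \int[m]_(x in E) (h (s n) x)%:E)%E.
  apply/esym/cvg_lim => //.
  under eq_fun do rewrite -hE//.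
  rewrite (_ : X @^-1` E `&` _ =
      \bigcup_n (X @^-1` E `&` [set u | V u <= ratr (s n)])); last first.
    apply/seteqP; split=> u /=.
      by move=> [Eu /sex[n Vn]]; exists n.
    by move=> [n _ [Eu /= Vn]]; split => //=; exact: le_lt_trans (st n).
  apply: nondecreasing_cvg_mu.
  - by move=> n; apply: measurableI => //; exact: measurable_set_le.
  - by apply: bigcupT_measurable => n; apply: measurableI => //; exact: measurable_set_le.
  - move=> i j ij; apply/subsetPset => u /= [Eu Vu]; split => //=.
    by rewrite (le_trans Vu)// ler_rat smono.
rewrite PE.
(* [G (x, v) < t] holds exactly when [v <= h (s n) x] for some n, and the uniform mass of that
   increasing union is the limit of [h (s n) x]. *)
have KtE x : (h (s n) x)%:E @[n --> \oo] --> K x [set v | v < t].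
  under eq_fun do rewrite -unif01_le//.
  have -> : K x [set v | v < t] = unif01 (\bigcup_n [set v | v <= h (s n) x]).
    rewrite KE; congr (unif01 _); apply/seteqP; split=> v /=.
      rewrite GE => /(inf_lt (neG _))[_ [n _ <-]].
      rewrite /a; case: ifP => [/andP[_ /= vh] /sex[i /[!ler_rat] qi]|_]; last by rewrite ltNge t1.
      by exists i => //=; rewrite (le_trans vh)// hmono.
    move=> [n _ /= vh]; apply: le_lt_trans (st n); rewrite GE.
    apply: ge_inf => //; exists (pickle (s n)); [exact: I|].
    by rewrite /a enum_ratK s0 s1 vh.
  have mle n : measurable [set v | v <= h (s n) x].
    by apply: (@measurable_set_le R _ R id); exact: measurable_id.
  apply: nondecreasing_cvg_mu => //; first exact: bigcupT_measurable.
  move=> i j ij; apply/subsetPset => v /= vh.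
  by rewrite (le_trans vh)// hmono// smono.
transitivity (\int[m]_(x in E) limn (fun n => (h (s n) x)%:E))%E; last first.
  by apply: eq_integral => x _; apply/cvg_lim => //; exact: KtE.
apply: cvg_lim => //; apply: cvg_monotone_convergence => //.
- by move=> n; exact/measurable_funTS/measurable_EFinP.
- by move=> n x _; rewrite lee_fin; have /andP[] := h01 (s n) x.
- by move=> x _ i j ij; rewrite lee_fin hmono// smono.
Qed.

End disintegration.
Section markov_kernels.
Context {R : realType}.

(** Gives content to the [get] in [markov_kernel]; every later fact about kernels comes from
    here. *)
Lemma markov_kernelP (k : nat) (C : k.+1.-tuple R -> R) :
  is_copula C -> is_markov_kernel C (markov_kernel C).
Proof.
move=> cC; apply: getPex.
have mX := @measurable_first_coords R k k.+1.
have mV := @measurable_tnth _ R k.+1 ord_max.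
have [K [K01 KE]] := disintegration mX mV (copula_last_itv cC).
exists K; split => [x _|E F mE mF]; first exact: K01.
rewrite [LHS](KE E F mE mF); apply: eq_measure_integral => B mB _.
by first [exact: copula_measure_marginal|apply: esym; exact: copula_measure_marginal].
Qed.

End markov_kernels.

Lemma product_probabilityE {R : realType} d1 d2 (T1 : measurableType d1)
    (T2 : measurableType d2) (P1 : probability T1 R) (P2 : probability T2 R)
    (A : set T1) (B : set T2) : measurable A -> measurable B ->
  (P1 \x P2)%E (A `*` B) = (P1 A * P2 B)%E.
Proof. by move=> mA mB; exact: product_measure1E. Qed.

(** * The randomised distribution function of a law on [0,1] is uniform *)

Section distributional_transform.
Context {R : realType} (nu : probability R R).
Hypothesis nu01 : nu `[0, 1]%classic = 1%E.

Let Fl (x : R) : R := fine (nu `[0, x[%classic).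
Let J (x : R) : R := fine (nu [set x]).
Let F (x : R) : R := fine (nu `[0, x]%classic).

Let nufin (A : set R) : measurable A -> nu A = (fine (nu A))%:E.
Proof. by move=> mA; rewrite fineK// fin_num_measure. Qed.

Let J_ge0 x : 0 <= J x. Proof. exact: fine_ge0. Qed.

Let FE x : 0 <= x -> F x = Fl x + J x.
Proof.
move=> x0; apply: EFin_inj; rewrite EFinD -!nufin// -measureU//.
  by rewrite (@setUitv1 _ R (BLeft 0) x true)// bnd_simp.
by apply/seteqP; split=> y //= -[]; rewrite in_itv /= => /andP[_ +] yx; rewrite yx ltxx.
Qed.

Let F_le x y : x <= y -> F x <= F y.
Proof.
move=> xy; rewrite -lee_fin -!nufin// le_measure ?inE// => z /=.
by rewrite !in_itv /= => /andP[-> /le_trans]; apply.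
Qed.

Let F_le_Fl x y : x < y -> F x <= Fl y.
Proof.
move=> xy; rewrite -lee_fin -!nufin// le_measure ?inE// => z /=.
by rewrite !in_itv /= => /andP[-> /le_lt_trans]; apply.
Qed.

Let F1 : F 1 = 1. Proof. by rewrite /F nu01. Qed.

(** [a] is the least point where [F] reaches [u]. Continuity from below on [0, a) and from above on
    [0, a] give the two inequalities around [u]. *)
Let quantile (u : R) : 0 <= u <= 1 -> exists a, [/\ 0 <= a,
  forall x, 0 <= x < a -> F x < u, Fl a <= u & u <= F a].
Proof.
move=> /andP[u0 u1]; pose S := [set x : R | 0 <= x /\ u <= F x].
have S1 : S 1 by split => //; rewrite F1.
have lbS : has_lbound S by exists 0 => x [].
have a0 : 0 <= inf S by apply: lb_le_inf => [|x []//]; exists 1.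
have ltF x : 0 <= x < inf S -> F x < u.
  move=> /andP[x0 xa]; rewrite ltNge; apply/negP => ux.
  by move: xa; rewrite ltNge => /negP; apply; apply: ge_inf.
exists (inf S); split => //.
- rewrite -lee_fin -nufin//.
  have -> : `[0, inf S[%classic = \bigcup_n `[0, inf S - n.+1%:R^-1]%classic.
    apply/seteqP; split=> x /=; last first.
      move=> [n _]; rewrite /= !in_itv /= => /andP[-> /le_lt_trans]; apply.
      by rewrite ltrBlDr ltrDl.
    rewrite in_itv /= => /andP[x0 xa]; rewrite -subr_gt0 in xa.
    have [n _ /(_ n (leqnn n)) na] := near_infty_natSinv_lt (PosNum xa).
    by exists n => //=; rewrite in_itv /= x0 lerBrDr -lerBrDl ltW.
  have mb n : measurable `[0 : R, inf S - n.+1%:R^-1]%classic by [].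
  have cv := nondecreasing_cvg_mu (mu := nu) mb (bigcupT_measurable _ mb) _.
  rewrite -(cvg_lim _ (cv _))//; last first.
    move=> i j ij; apply/subsetPset => x /=; rewrite !in_itv /= => /andP[-> xi].
    by rewrite (le_trans xi)// lerB// lef_pV2 ?posrE// ler_nat.
  apply: lime_le; first apply/cvgP/cv.
    move=> i j ij; apply/subsetPset => x /=; rewrite !in_itv /= => /andP[-> xi].
    by rewrite (le_trans xi)// lerB// lef_pV2 ?posrE// ler_nat.
  apply: nearW => n /=.
  have [an|an] := ltP (inf S - n.+1%:R^-1) 0.
    rewrite (_ : `[_, _]%classic = set0) ?measure0//.
    by apply/seteqP; split=> x //=; rewrite in_itv /= => /andP[x0 xa];
      have := le_lt_trans (le_trans x0 xa) an; rewrite ltxx.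
  rewrite nufin// lee_fin ltW// ltF// an/=.
  by rewrite ltrBlDr ltrDl.
- rewrite -lee_fin -nufin//.
  have -> : `[0, inf S]%classic = \bigcap_n `[0, inf S + n.+1%:R^-1]%classic.
    apply/seteqP; split=> x /=.
      rewrite in_itv /= => /andP[x0 xa] n _ /=; rewrite in_itv /= x0 /=.
      by rewrite (le_trans xa)// lerDl.
    move=> h; rewrite in_itv /=; apply/andP; split.
      by have := h 0%N Logic.I; rewrite /= in_itv /= => /andP[].
    rewrite leNgt; apply/negP => ax; rewrite -subr_gt0 in ax.
    have [n _ /(_ n (leqnn n)) na] := near_infty_natSinv_lt (PosNum ax).
    have := h n Logic.I; rewrite /= in_itv /= => /andP[_]; rewrite leNgt => /negP; apply.
    by rewrite -ltrBrDl.
  have mb n : measurable `[0 : R, inf S + n.+1%:R^-1]%classic by [].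
  have nd : nonincreasing_seq (fun n => `[0 : R, inf S + n.+1%:R^-1]%classic).
    move=> i j ij; apply/subsetPset => x /=; rewrite !in_itv /= => /andP[-> xi].
    by rewrite (le_trans xi)// lerD// lef_pV2 ?posrE// ler_nat.
  pose b0 : set R := `[0, inf S + 1%:R^-1]%classic.
  have nu0 : (nu b0 < +oo)%E.
    by rewrite (le_lt_trans (probability_le1 nu _)) ?ltry//; exact: measurable_itv.
  have cv := nonincreasing_cvg_mu (mu := nu) nu0 mb (bigcapT_measurable mb) nd.
  rewrite -(cvg_lim _ cv)//; apply: lime_ge; first exact: cvgP cv.
  apply: nearW => n /=; rewrite nufin// lee_fin.
  have : inf S < inf S + n.+1%:R^-1 by rewrite ltrDl.
  move=> /inf_lt[|x [x0 ux] xS]; first by exists 1.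
  exact: le_trans (F_le (ltW xS)).
Qed.

Let V (w : R * R) : R := Fl w.1 + w.2 * J w.1.
Hypothesis mV : measurable_fun setT V.

(** A set of mass exactly [u] squeezed between {V < u} and {V <= u}: everything left of the quantile
    [a], and at [a] itself the share [r <= c] of the atom that fills the mass up to [u]. *)
Let sublevel (u : R) : 0 <= u <= 1 -> exists B, [/\ measurable B,
  (nu \x unif01)%E B = u%:E, B `<=` [set w | V w <= u] `|` [set w | ~ 0 <= w.2 <= 1] &
  [set w | V w < u] `&` (`[0, 1] `*` `[0, 1]) `<=` B].
Proof.
move=> u01; have [a [a0 altF Fla Fa]] := quantile u01.
have [c [c0 c1 cE]] : exists c, [/\ 0 <= c, c <= 1 & Fl a + c * J a = u].
  (* Without an atom at [a] the mass to its left is already [u], and c = 0 will do. *)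
  have FaE := FE a0; have [J0|J0] := eqVneq (J a) 0.
    by exists 0; rewrite mul0r addr0 lexx ler01; split => //; apply/eqP; rewrite eq_le Fla /=; move: Fa; rewrite FaE J0 addr0.
  have Jpos : 0 < J a by rewrite lt_neqAle eq_sym J0 J_ge0.
  exists ((u - Fl a) / J a); split.
  - by rewrite divr_ge0// subr_ge0.
  - by rewrite ler_pdivrMr// mul1r lerBlDl -FaE.
  - by rewrite divfK// addrC subrK.
have mc : measurable [set r : R | r <= c].
  by apply: (@measurable_set_le R _ R id); exact: measurable_id.
pose B1 : set (R * R) := `[0, a[%classic `*` setT.
pose B2 : set (R * R) := [set a] `*` [set r | r <= c].
have mB1 : measurable B1 by exact: measurableX.
have mB2 : measurable B2 by exact: measurableX.
exists (B1 `|` B2); split.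
- exact: measurableU.
- rewrite measureU//; last first.
    apply/seteqP; split=> -[x r] //= [[/= xa _] [/= xE _]].
    by move: xa; rewrite xE in_itv /= ltxx andbF.
  have Q1 : (nu \x unif01)%E B1 = (Fl a)%:E.
    by rewrite product_probabilityE// probability_setT mule1 nufin.
  have Q2 : (nu \x unif01)%E B2 = (c * J a)%:E.
    by rewrite product_probabilityE// unif01_le ?c0// nufin// -EFinM mulrC.
  transitivity ((Fl a)%:E + (c * J a)%:E)%E; last by rewrite -EFinD cE.
  by congr (_ + _)%E; [exact: Q1|exact: Q2].
- move=> [x r] [[/= xa _]|[/= -> rc]].
    have [r01|] := pselect (0 <= r <= 1); last by right.
    left; move: xa; rewrite in_itv /= => xa.
    rewrite /V /= (le_trans _ (ltW (altF _ xa)))// FE; last by case/andP: xa.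
    by rewrite lerD2l ler_piMl//; case/andP: r01.
  by left; rewrite /V /= -cE lerD2l ler_wpM2r.
- move=> [x r] [/= Vu [/=]]; rewrite !in_itv /= => /andP[x0 x1] /andP[r0 r1].
  have [xa|ax|xE] := ltgtP x a.
  + by left; split => //=; rewrite in_itv /= x0.
  + exfalso; move: Vu; rewrite /V /= ltNge => /negP; apply.
    by rewrite (le_trans Fa)// (le_trans (F_le_Fl ax))// lerDl mulr_ge0.
  + right; split => //=; rewrite leNgt; apply/negP => cr.
    move: Vu; rewrite /V /= xE -cE ltNge => /negP; apply.
    by rewrite lerD2l ler_wpM2r// ltW.
Qed.

Let Q : probability (R * R)%type R := (nu \x unif01)%E.

Let mle u : measurable [set w | V w <= u]. Proof. exact: measurable_set_le. Qed.

Let mlt u : measurable [set w | V w < u].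
Proof.
have -> : [set w | V w < u] = ~` [set w | u <= V w].
  by apply/seteqP; split => w /=; rewrite ltNge => /negP.
by apply: measurableC; apply: measurable_set_lef => //; exact: measurable_cst.
Qed.

Let msq : measurable (`[0 : R, 1]%classic `*` `[0 : R, 1]%classic).
Proof. exact: measurableX. Qed.

Let Qsq : Q (`[0, 1] `*` `[0, 1]) = 1%E.
Proof. by rewrite [LHS](product_probabilityE nu unif01)// nu01 unif01_itv mule1. Qed.

Let Q_lt u : 0 <= u <= 1 -> (Q [set w | (V w < u)%R] <= u%:E)%E.
Proof.
move=> u01; have [B [mB QB _ hB]] := sublevel u01.
rewrite -(QB : Q B = u%:E).
rewrite -(probability1I msq (mlt u) Qsq); apply: le_measure; rewrite ?inE//.
by apply: measurableI => //; exact: mlt.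
Qed.

Let Q_le u : 0 <= u <= 1 -> (u%:E <= Q [set w | (V w <= u)%R])%E.
Proof.
move=> u01; have [B [mB QB hB _]] := sublevel u01.
rewrite -(QB : Q B = u%:E).
rewrite -(probability1I msq mB Qsq); apply: le_measure; rewrite ?inE//.
  exact: measurableI.
move=> [x r] [/hB[//|/= r01] [/= _]].
by rewrite in_itv.
Qed.

(** [Q_lt] and [Q_le] bound the mass of {V < u} from above and that of {V <= u} from below. To close
    the gap, apply [Q_lt] at the midpoint [u'] between [u] and the supposedly larger mass [p], using
    that {V <= u} lies in {V < u'}. *)
Lemma distributional_transform u : 0 <= u <= 1 ->
  (nu \x unif01)%E [set w | fine (nu `[0, w.1[%classic) + w.2 * fine (nu [set w.1]) <= u] = u%:E.
Proof.
move=> u01; apply/eqP; rewrite eq_le Q_le// andbT.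
have Qfin : Q [set w | V w <= u] = (fine (Q [set w | V w <= u]))%:E.
  by rewrite fineK// fin_num_measure.
set p := fine _ in Qfin.
have p1 : p <= 1 by rewrite -lee_fin -Qfin probability_le1.
suff : p <= u by rewrite -lee_fin -Qfin.
rewrite leNgt; apply/negP => up.
have /andP[u0 u1] := u01.
pose u' := (u + p) / 2.
have uu' : u < u' by rewrite /u'; lra.
have u'p : u' < p by rewrite /u'; lra.
have : p <= u'.
  have u'01 : 0 <= u' <= 1 by rewrite /u'; lra.
  rewrite -lee_fin -Qfin; apply: le_trans (Q_lt u'01).
  by apply: le_measure; rewrite ?inE// => w /= /le_lt_trans; apply.
by rewrite leNgt u'p.
Qed.

End distributional_transform.

(** * Kernels composed with maps, frozen at a point, or multiplied by an independent law *)

Section comp_kernel.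
Context {R : realType} d1 d2 d3 (T1 : measurableType d1) (T2 : measurableType d2)
  (T3 : measurableType d3).
Variables (K : R.-pker T2 ~> T3) (f : T1 -> T2) (mf : measurable_fun setT f).

Definition comp_kernel (_ : measurable_fun setT f) (x : T1) :
  {measure set T3 -> \bar R} := K (f x).

Let measurable_comp_kernel F : measurable F ->
  measurable_fun setT (comp_kernel mf ^~ F).
Proof.
move=> mF; apply: (@measurableT_comp _ _ _ _ _ _ (K ^~ F) _ f) => //.
exact: measurable_kernel.
Qed.

HB.instance Definition _ := isKernel.Build _ _ _ _ _ (comp_kernel mf)
  measurable_comp_kernel.

Let comp_kernel_prob x : comp_kernel mf x setT = 1%E.
Proof. exact: prob_kernel. Qed.

HB.instance Definition _ := Kernel_isProbability.Build _ _ _ _ _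
  (comp_kernel mf) comp_kernel_prob.

End comp_kernel.

Section kernel_at.
Context {R : realType} d1 d2 (T1 : measurableType d1) (T2 : measurableType d2).
Variables (K : R.-pker T1 ~> T2) (x : T1).

(** [K x] is typed as a measure only; the new name carries the probability structure, so that lemmas
    on probabilities apply. *)
Definition kernel_at (F : set T2) : \bar R := K x F.

Let kernel_at0 : kernel_at set0 = 0%E. Proof. exact: measure0. Qed.

Let kernel_at_ge0 F : (0 <= kernel_at F)%E. Proof. exact: measure_ge0. Qed.

Let kernel_at_additive : semi_sigma_additive kernel_at.
Proof. exact: measure_semi_sigma_additive. Qed.

HB.instance Definition _ := isMeasure.Build _ _ _ kernel_at
  kernel_at0 kernel_at_ge0 kernel_at_additive.

Let kernel_atT : kernel_at setT = 1%E. Proof. exact: prob_kernel. Qed.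

HB.instance Definition _ := Measure_isProbability.Build _ _ _ kernel_at kernel_atT.

End kernel_at.

Section product_kernel.
Context {R : realType} d1 d2 d3 (T1 : measurableType d1) (T2 : measurableType d2)
  (T3 : measurableType d3).
Variables (m : probability T1 R) (K : R.-pker T1 ~> T2) (U : probability T3 R).

Definition product_kernel (x : T1) : {measure set (T2 * T3) -> \bar R} :=
  (kernel_at K x \x U)%E.

Let measurable_product_kernel F : measurable F ->
  measurable_fun setT (product_kernel ^~ F).
Proof.
move=> mF; pose f (w : T1 * T2) := U (xsection F w.2).
rewrite (_ : (fun _ => _) = kfcomp K f)//.
apply: measurable_kfcomp => //.
apply: (@measurableT_comp _ _ _ _ _ _ (fun t => U (xsection F t)) _ snd) => //.
exact: measurable_fun_xsection.
Qed.

HB.instance Definition _ := isKernel.Build _ _ _ _ _ product_kernel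
  measurable_product_kernel.

Let product_kernel_prob x : product_kernel x setT = 1%E.
Proof. exact: probability_setT. Qed.

HB.instance Definition _ := Kernel_isProbability.Build _ _ _ _ _
  product_kernel product_kernel_prob.

Let assoc (w : T1 * (T2 * T3)) : T1 * T2 * T3 := ((w.1, w.2.1), w.2.2).

Let massoc : measurable_fun setT assoc.
Proof.
apply: measurable_fun_pair.
  apply: measurable_fun_pair => //.
  by apply: (@measurableT_comp _ _ _ _ _ _ fst _ snd).
by apply: (@measurableT_comp _ _ _ _ _ _ snd _ snd).
Qed.

(** Conditioning on [x] first leaves the product of [K x] and [U], to which the transform of a
    single law applies. Both sides agree on rectangles. *)
Lemma kernel_joint_product (S : set (T1 * T2 * T3)) : measurable S ->
  (kernel_joint m K \x U)%E S =
  (\int[m]_x product_kernel x [set w | S ((x, w.1), w.2)])%E.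
Proof.
move=> mS.
pose m' := law (kernel_joint m product_kernel) massoc.
transitivity (m' S); last first.
  rewrite [LHS]lawE; apply: eq_integral => x _.
  by rewrite xsectionE.
apply: (@product_measure_unique _ _ _ _ R (kernel_joint m K) U m' _ S mS).
move=> A B mA mB; rewrite [LHS]lawE.
transitivity (\int[m]_x (K x (xsection A x) * U B))%E.
  apply: eq_integral => x _.
  rewrite (_ : xsection _ _ = xsection A x `*` B); last first.
    by apply/seteqP; split=> w; rewrite !xsectionE.
  by rewrite [LHS](product_probabilityE (kernel_at K x) U)//; exact: measurable_xsection.
by rewrite ge0_integralZr//; exact: measurable_kernel_xsection.
Qed.

End product_kernel.

(** * Conditional distributional transform *)

Section randomized_cdf.
Context {R : realType} d1 (T1 : measurableType d1).
Variables (m : probability T1 R) (K : R.-pker T1 ~> R).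

Definition randomized_cdf (w : T1 * R * R) : R :=
  fine (K w.1.1 `[0, w.1.2[%classic) + w.2 * fine (K w.1.1 [set w.1.2]).

Let measurable_kernel_section (S : set (T1 * R * R)) : measurable S ->
  measurable_fun setT (fun w : T1 * R => fine (K w.1 (xsection S w))).
Proof.
move=> mS; apply: (@measurableT_comp _ _ _ _ _ _ (@fine R) _
  (fun w : T1 * R => K w.1 (xsection S w))); first exact: fine_measurable.
exact: (measurable_kernel_xsection (comp_kernel K (@measurable_fst _ _ T1 R)) mS).
Qed.

Let mfst2 : measurable_fun setT (fun w : T1 * R * R => w.1.2).
Proof. by apply: (@measurableT_comp _ _ _ _ _ _ snd _ fst). Qed.

Lemma measurable_kernel_co :
  measurable_fun setT (fun w : T1 * R => fine (K w.1 `[0, w.2[%classic)).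
Proof.
pose S := [set w : T1 * R * R | 0 <= w.2] `&` ~` [set w : T1 * R * R | w.1.2 <= w.2].
rewrite (_ : (fun _ => _) = fun w : T1 * R => fine (K w.1 (xsection S w))).
  apply: measurable_kernel_section; apply: measurableI.
    by apply: measurable_set_lef => //; exact: measurable_cst.
  by apply: measurableC; apply: measurable_set_lef.
apply/funext => -[x t] /=; congr (fine (K x _)).
apply/seteqP; split=> s; rewrite xsectionE /S /= in_itv /=.
  by move=> /andP[s0 st]; split=> //; apply/negP; rewrite -ltNge.
by move=> [-> /negP]; rewrite -ltNge.
Qed.

Lemma measurable_kernel_set1 :
  measurable_fun setT (fun w : T1 * R => fine (K w.1 [set w.2])).
Proof.
pose S := [set w : T1 * R * R | w.2 <= w.1.2] `&` [set w : T1 * R * R | w.1.2 <= w.2].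
rewrite (_ : (fun _ => _) = fun w : T1 * R => fine (K w.1 (xsection S w))).
  by apply: measurable_kernel_section; apply: measurableI; apply: measurable_set_lef.
apply/funext => -[x t] /=; congr (fine (K x _)).
apply/seteqP; split=> s; rewrite xsectionE /S /=; first by move=> ->.
by move=> [st ts]; apply/eqP; rewrite eq_le st.
Qed.

Lemma measurable_randomized_cdf : measurable_fun setT randomized_cdf.
Proof.
apply: measurable_funD.
  exact: (measurableT_comp measurable_kernel_co measurable_fst).
apply: measurable_funM => //.
exact: (measurableT_comp measurable_kernel_set1 measurable_fst).
Qed.

(** Given [x] the randomised distribution function is uniform, so it stays below a level [g x] with
    probability [g x]. A constant level yields uniformity and independence of the past; a level
    depending on the past is what inverts the transform. [D] is there because Markov kernels are
    controlled on the cube only. *)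
Lemma randomized_cdf_le (D E : set T1) (g : T1 -> R) :
  measurable D -> m D = 1%E -> (forall x, D x -> K x `[0, 1]%classic = 1%E) ->
  measurable E -> measurable_fun setT g -> (forall x, 0 <= g x <= 1) ->
  (kernel_joint m K \x unif01)%E [set w | E w.1.1 /\ randomized_cdf w <= g w.1.1] =
  (\int[m]_(x in E) (g x)%:E)%E.
Proof.
move=> mD m1 K01 mE mg g01.
have mfst11 : measurable_fun setT (fun w : T1 * R * R => w.1.1).
  by apply: (@measurableT_comp _ _ _ _ _ _ fst _ fst).
pose S := [set w : T1 * R * R | E w.1.1 /\ randomized_cdf w <= g w.1.1].
have mS : measurable S.
  apply: measurableI; first exact: (measurable_preimage mfst11 mE).
  apply: measurable_set_lef; first exact: measurable_randomized_cdf.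
  exact: measurableT_comp mg mfst11.
rewrite kernel_joint_product// [RHS]integral_mkcond.
pose L : R.-pker T1 ~> _ := product_kernel K (@unif01 R).
pose S' := [set w : T1 * (R * R) | S ((w.1, w.2.1), w.2.2)].
have mS' : measurable S'.
  apply: (@measurable_preimage _ _ _ _
    (fun w : T1 * (R * R) => ((w.1, w.2.1), w.2.2)) S) => //.
  apply: measurable_fun_pair.
    apply: measurable_fun_pair => //.
    by apply: (@measurableT_comp _ _ _ _ _ _ fst _ snd).
  by apply: (@measurableT_comp _ _ _ _ _ _ snd _ snd).
apply: ae_eq_integral => //.
- rewrite (_ : (fun _ => _) = fun x => L x (xsection S' x)).
    exact: measurable_kernel_xsection.
  by apply/funext => x; rewrite xsectionE.
- apply/(measurable_restrictT _ mE)/measurable_funTS/measurable_EFinP => //.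
have : m.-negligible (~` D).
  have mD0 : m (~` D) = 0%E by rewrite probability_setC// m1 subee.
  by apply/negligibleP => //; exact: measurableC.
apply: negligibleS => x /= hx Dx; apply: hx => _.
rewrite patchE; case: ifPn => [/set_mem xE|/negP xE].
  have mV : measurable_fun setT (fun w : R * R =>
      fine (kernel_at K x `[0, w.1[%classic) + w.2 * fine (kernel_at K x [set w.1])).
    rewrite (_ : (fun _ => _) = randomized_cdf \o (fun w : R * R => ((x, w.1), w.2)))//.
    apply: (measurableT_comp measurable_randomized_cdf).
    apply: measurable_fun_pair => //.
    exact: measurable_fun_pair.
  rewrite -(distributional_transform (K01 x Dx : kernel_at K x _ = 1%E) mV (g01 x)).
  by congr (product_kernel _ _ _ _); apply/seteqP; split => w //= [].
rewrite (_ : [set w | _] = set0) ?measure0//.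
by apply/seteqP; split => w //= [] Ex; exfalso; apply: xE; rewrite inE.
Qed.

End randomized_cdf.

(** * Lebesgue measure on the cube and its product structure *)

Section cube_measures.
Context {R : realType}.

Lemma probability1_setC d (T : measurableType d) (P : probability T R) (A : set T) :
  measurable A -> P A = 1%E -> P (~` A) = 0%E.
Proof. by move=> mA PA; rewrite probability_setC// PA subee. Qed.

Lemma probability1_negligible d (T : measurableType d) (P : probability T R)
    (A : set T) : measurable A -> P A = 1%E -> P.-negligible (~` A).
Proof.
move=> mA PA; have PC := probability1_setC mA PA.
by apply/negligibleP => //; exact: measurableC.
Qed.

Lemma probability_negligible_setC d (T : measurableType d) (P : probability T R)
    (A : set T) : measurable A -> P.-negligible (~` A) -> P A = 1%E.
Proof.
move=> mA /measure_negligible -/(_ (measurableC mA)) PC.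
by rewrite -[A]setCK probability_setC ?PC ?sube0//; exact: measurableC.
Qed.

Lemma uniform_margins_cube (n : nat) (m : probability (n.-tuple R) R) :
  uniform_margins m -> m (cube n) = 1%E.
Proof.
move=> mU; apply: probability_negligible_setC; first exact: measurable_cube.
(* Countable unions of negligible sets are indexed by naturals; indices that are not coordinates
   contribute the empty set. *)
pose N (k : nat) : set (n.-tuple R) :=
  if insub k is Some i then [set z | tnth z i <= 0] `|` ~` [set z | tnth z i <= 1]
  else set0.
apply: (@negligibleS _ _ _ _ (\bigcup_k N k)).
  move=> z /existsNP[i /negP]; rewrite negb_and -!ltNge => zi.
  exists i => //; rewrite /N valK; case/orP: zi => zi; first by left; exact: ltW.
  by right => /=; apply/negP; rewrite -ltNge.
apply: negligible_bigcup => k; rewrite /N.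
case: insubP => [i _ _|_]; last exact: negligible_set0.
apply: negligibleU.
  apply/negligibleP; first exact: measurable_coordinate_le.
  by apply: (mU i 0); rewrite lexx ler01.
apply: probability1_negligible; first exact: measurable_coordinate_le.
by apply: (mU i 1); rewrite lexx ler01.
Qed.

Lemma uniform_margins_has_cdf (n : nat) (m : probability (n.-tuple R) R) :
  uniform_margins m -> has_cdf_on_cube (fun x => fine (m (lower_orthant x))) m.
Proof.
move=> mU; split; first exact: uniform_margins_cube.
by move=> x _; rewrite fineK// fin_num_measure//; exact: measurable_lower_orthant.
Qed.

Lemma coordinate_le_orthant (n : nat) (i : 'I_n) (u : R) :
  [set z | tnth z i <= u] `&` cube n =
  lower_orthant [tuple if j == i then u else 1 | j < n] `&` cube n.
Proof.
apply/seteqP; split=> z [zi zc]; split=> //.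
  move=> j; rewrite tnth_mktuple; case: eqP => [->//|_].
  by have /andP[] := zc j.
by have := zi i; rewrite tnth_mktuple eqxx.
Qed.

Lemma lebesgue_cube_cube (n : nat) : lebesgue_cube n (@cube R n) = 1%E.
Proof.
elim: n => [|n ih].
  rewrite /lebesgue_cube (_ : cube 0 = setT) ?probability_setT//.
  by apply/seteqP; split => // x _ [].
rewrite [LHS](_ : _ = (uniform_prob (@ltr01 R) \x lebesgue_cube n)%E
    (@cons_pair R n @^-1` cube n.+1))//.
have -> : @cons_pair R n @^-1` cube n.+1 = `[0, 1]%classic `*` cube n.
  apply/seteqP; split=> -[v z] /=.
    move=> h; split => /=; first by rewrite in_itv; exact: (h ord0).
    by move=> i; have := h (lift ord0 i); rewrite tnthS.
  move=> [/= v01 zc] i; case: (unliftP ord0 i) => [j ->|->].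
    by rewrite tnthS; exact: zc.
  by rewrite tnth0; rewrite in_itv in v01.
rewrite [LHS](product_probabilityE (uniform_prob (@ltr01 R)) (lebesgue_cube n))//.
  by rewrite ih mule1; exact: unif01_itv.
exact: measurable_cube.
Qed.

Lemma lebesgue_cube_orthant (n : nat) (x : n.-tuple R) : cube n x ->
  lebesgue_cube n (lower_orthant x) = (Pi_copula x)%:E.
Proof.
elim: n x => [|n ih] x xc.
  rewrite /Pi_copula big_ord0 /lebesgue_cube.
  rewrite (_ : lower_orthant x = setT) ?probability_setT//.
  by apply/seteqP; split => // z _ [].
rewrite [LHS](_ : _ = (uniform_prob (@ltr01 R) \x lebesgue_cube n)%E
    (@cons_pair R n @^-1` lower_orthant x))//.
have -> : @cons_pair R n @^-1` lower_orthant x =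
    [set v | v <= tnth x ord0] `*` lower_orthant [tuple tnth x (lift ord0 i) | i < n].
  apply/seteqP; split=> -[v z] /=.
    move=> h; split => /=; first exact: (h ord0).
    by move=> i; have := h (lift ord0 i); rewrite tnthS tnth_mktuple.
  move=> [/= vx zx] i; case: (unliftP ord0 i) => [j ->|->].
    by rewrite tnthS; have := zx j; rewrite tnth_mktuple.
  by rewrite tnth0.
have mv : measurable [set v : R | v <= tnth x ord0].
  by apply: (@measurable_set_le R _ R id); exact: measurable_id.
rewrite [LHS](product_probabilityE (uniform_prob (@ltr01 R)) (lebesgue_cube n))//; last first.
  exact: measurable_lower_orthant.
rewrite ih; last by move=> i; rewrite tnth_mktuple.
rewrite /Pi_copula big_ord_recl EFinM; congr (_ * _)%E.
  exact: (unif01_le (xc ord0)).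
by congr EFin; apply: eq_bigr => i _; rewrite tnth_mktuple.
Qed.

Lemma lebesgue_cube_has_cdf (n : nat) :
  has_cdf_on_cube (@Pi_copula R n) (lebesgue_cube n).
Proof. by split; [exact: lebesgue_cube_cube|exact: lebesgue_cube_orthant]. Qed.

Lemma lebesgue_cube_uniform (n : nat) : uniform_margins (@lebesgue_cube R n).
Proof.
move=> i u u01.
rewrite -(probability1I (@measurable_cube R n) _ (lebesgue_cube_cube n)); last first.
  exact: measurable_coordinate_le.
rewrite coordinate_le_orthant.
rewrite (probability1I (@measurable_cube R n) _ (lebesgue_cube_cube n)); last first.
  exact: measurable_lower_orthant.
rewrite lebesgue_cube_orthant; last first.
  by move=> j; rewrite tnth_mktuple; case: ifP => // _; rewrite ler01 lexx.
rewrite /Pi_copula (bigD1 i)//= tnth_mktuple eqxx big1 ?mulr1// => j ji.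
by rewrite tnth_mktuple (negbTE ji).
Qed.

Lemma Pi_is_copula (n : nat) : is_copula (@Pi_copula R n).
Proof.
by exists (lebesgue_cube n); [exact: lebesgue_cube_has_cdf|exact: lebesgue_cube_uniform].
Qed.

Lemma copula_measure_Pi (n : nat) (E : set (n.-tuple R)) : measurable E ->
  copula_measure (@Pi_copula R n) E = lebesgue_cube n E.
Proof. by move=> mE; exact: (copula_measureE (lebesgue_cube_has_cdf n)). Qed.

Lemma marginal_Pi (k n : nat) (x : k.-tuple R) : (k <= n)%N ->
  @marginal R n k (@Pi_copula R n) x = Pi_copula x.
Proof.
move=> kn; rewrite /marginal /Pi_copula.
rewrite (eq_bigr (fun i : 'I_n => nth 1 x i)); last by move=> i _; rewrite tnth_mktuple.
rewrite (eq_bigr (fun i : 'I_k => nth 1 x i)); last by move=> i _; rewrite (tnth_nth 1).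
rewrite -(big_mkord xpredT (nth 1 x)) -(big_mkord xpredT (nth 1 x)).
rewrite (big_cat_nat _ kn)//= [X in _ * X]big_nat_cond [X in _ * X]big1 ?mulr1// => i.
by rewrite andbT => /andP[ki _]; rewrite nth_default// size_tuple.
Qed.

Lemma lebesgue_cube_first_coords (k n : nat) (E : set (k.-tuple R)) : (k <= n)%N ->
  measurable E -> lebesgue_cube n (first_coords k @^-1` E) = lebesgue_cube k E.
Proof.
move=> kn mE; rewrite -copula_measure_Pi; last first.
  by apply: measurable_preimage => //; exact: measurable_first_coords.
rewrite -(@copula_measure_marginal R k n _ E kn (@Pi_is_copula n))//.
rewrite -copula_measure_Pi//; congr (copula_measure _ E).
by apply/funext => x; rewrite marginal_Pi.
Qed.

Lemma orthant_snoc (n : nat) (x : n.+1.-tuple R) :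
  lower_orthant x =
  [set z | lower_orthant (first_coords n x) (first_coords n z) /\
           tnth z ord_max <= tnth x ord_max].
Proof.
apply/seteqP; split=> z /=.
  move=> h; split=> // i.
  by rewrite !(@tnth_first_coords R n n.+1 _ i (widen_ord (leqnSn n) i)).
move=> [h hm] i; have [ilt|] := ltnP i n.
  by have := h (Ordinal ilt); rewrite !(@tnth_first_coords R n n.+1 _ (Ordinal ilt) i).
move=> ni; have -> : i = ord_max; last by [].
by apply/val_inj/eqP; rewrite /= eqn_leq ni -ltnS ltn_ord.
Qed.

Lemma tnth_snoc_first (n : nat) (x : n.-tuple R) (y : R) : first_coords n (snoc x y) = x.
Proof.
apply: eq_from_tnth => i; rewrite tnth_mktuple /= nth_rcons size_tuple ltn_ord.
by rewrite -tnth_nth.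
Qed.

Lemma tnth_snoc_last (n : nat) (x : n.-tuple R) (y : R) : tnth (snoc x y) ord_max = y.
Proof. by rewrite (tnth_nth 0) /= nth_rcons size_tuple ltnn eqxx. Qed.

Lemma tnth_snoc_lt (n : nat) (x : n.-tuple R) (y : R) (i : 'I_n.+1) (ilt : (i < n)%N) :
  tnth (snoc x y) i = tnth x (Ordinal ilt).
Proof.
by rewrite -[in RHS](tnth_snoc_first x y) (@tnth_first_coords R n n.+1 _ _ i).
Qed.

Lemma measurable_snoc (n : nat) d (T : measurableType d) (f : T -> n.-tuple R) (g : T -> R) :
  measurable_fun setT f -> measurable_fun setT g ->
  measurable_fun setT (fun t => snoc (f t) (g t)).
Proof.
move=> mf mg; apply/measurable_fun_tnthP => i.
rewrite (_ : _ \o _ = fun t => if (i < n)%N then nth 0 (f t) i else g t).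
  by case: (i < n)%N => //; exact: (measurableT_comp (@measurable_nth R n i) mf).
apply/funext => t; rewrite /= (tnth_nth 0) /= nth_rcons size_tuple.
case: ifP => // /negbT; rewrite -leqNgt => ni.
by rewrite eqn_leq ni -ltnS ltn_ord.
Qed.

(** The recursion defining [lebesgue_cube] splits off the first coordinate, while the linkage and
    the Rosenblatt transform need the last one. Both measures have distribution function [Pi_copula]
    on the cube. *)
Lemma lebesgue_cube_snoc (n : nat) (G : set (n.-tuple R)) (B : set R) :
  measurable G -> measurable B ->
  lebesgue_cube n.+1 [set z | G (first_coords n z) /\ B (tnth z ord_max)] =
  (lebesgue_cube n G * unif01 B)%E.
Proof.
move=> mG mB.
have mf : measurable_fun setT (fun w : n.-tuple R * R => snoc w.1 w.2).
  exact: measurable_snoc.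
pose m : probability _ R := law (lebesgue_cube n \x unif01 : probability _ R)%E mf.
have mE E F : measurable E -> measurable F ->
    m [set z | E (first_coords n z) /\ F (tnth z ord_max)] =
    (lebesgue_cube n E * unif01 F)%E.
  move=> mE mF.
  have <- := product_probabilityE (lebesgue_cube n) (@unif01 R) mE mF.
  suff -> : E `*` F = (fun w : n.-tuple R * R => snoc w.1 w.2) @^-1`
    [set z | E (first_coords n z) /\ F (tnth z ord_max)] by [].
  by apply/seteqP; split=> -[x y] /=; rewrite tnth_snoc_first tnth_snoc_last.
rewrite -mE//; apply: orthant_unique_cube.
- exact: lebesgue_cube_cube.
- rewrite (_ : cube n.+1 = [set z | cube n (first_coords n z) /\
      `[0, 1]%classic (tnth z ord_max)]).
    rewrite mE//; last exact: measurable_cube.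
    by rewrite lebesgue_cube_cube unif01_itv mule1.
  apply/seteqP; split=> z /=.
    by move=> zc; split; [exact: cube_first_coords|rewrite in_itv /=; exact: zc].
  move=> [h hm] i; have [ilt|] := ltnP i n.
    by have := h (Ordinal ilt); rewrite !(@tnth_first_coords R n n.+1 _ (Ordinal ilt) i).
  move=> ni; have -> : i = ord_max; last by rewrite in_itv in hm.
  by apply/val_inj/eqP; rewrite /= eqn_leq ni -ltnS ltn_ord.
- move=> x xc; rewrite lebesgue_cube_orthant// orthant_snoc.
  rewrite (mE (lower_orthant (first_coords n x)) [set v | v <= tnth x ord_max]); last 2 first.
  + exact: measurable_lower_orthant.
  + by apply: (@measurable_set_le R _ R id); exact: measurable_id.
  rewrite lebesgue_cube_orthant; last exact: cube_first_coords.
  rewrite unif01_le ?xc// -EFinM /Pi_copula big_ord_recr/=; congr (_ * _)%:E.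
  by apply: eq_bigr => i _; rewrite (@tnth_first_coords R n n.+1 _ _ (widen_ord (leqnSn n) i)).
- apply: measurableI.
    by apply: (@measurable_preimage _ _ _ _ (first_coords n) G) => //; exact: measurable_first_coords.
  by apply: (@measurable_preimage _ _ _ _ (fun z => tnth z ord_max) B) => //; exact: measurable_tnth.
Qed.

Lemma lebesgue_cube_coordinates (n i : nat) (G : set (i.-tuple R)) (B : set R) :
  (i < n)%N -> measurable G -> measurable B ->
  lebesgue_cube n [set z | G (first_coords i z) /\ B (nth 0 z i)] =
  (lebesgue_cube n (first_coords i @^-1` G) * unif01 B)%E.
Proof.
move=> ilt mG mB; rewrite (lebesgue_cube_first_coords (ltnW ilt))//.
rewrite -lebesgue_cube_snoc// -(@lebesgue_cube_first_coords i.+1 n)//; last first.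
  apply: measurableI.
    by apply: (@measurable_preimage _ _ _ _ (first_coords i) G) => //; exact: measurable_first_coords.
  by apply: (@measurable_preimage _ _ _ _ (fun z => tnth z ord_max) B) => //; exact: measurable_tnth.
congr (lebesgue_cube n _); apply/seteqP; split=> z /=;
  by rewrite first_coords_comp// (@tnth_first_coords R i.+1 n z ord_max (Ordinal ilt))// (tnth_nth 0).
Qed.

End cube_measures.

(** * Events determined by a random variable up to null sets *)

Section sigma_algebra_mod_null.
Context {R : realType} d d' (T : measurableType d) (T' : measurableType d').
Variables (P : probability T R) (F : T -> T') (mF : measurable_fun setT F).

(** Membership in the sigma-algebra generated by [F], completed by null sets; the operation [+] on
    sets is symmetric difference. *)
Definition almost_determined (B : set T) : Prop :=
  exists2 E, measurable E & P.-negligible (B `+` F @^-1` E).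

Lemma almost_determined_preimage E : measurable E -> almost_determined (F @^-1` E).
Proof. by move=> mE; exists E => //; rewrite setYK; exact: negligible_set0. Qed.

Lemma almost_determined_eq B C : P.-negligible (B `+` C) ->
  almost_determined C -> almost_determined B.
Proof.
move=> BC [E mE CE]; exists E => //.
apply: negligibleS (negligibleU BC CE) => x [[Bx nE]|[Ex nB]].
  by have [Cx|nC] := pselect (C x); [right; left|left; left].
by have [Cx|nC] := pselect (C x); [left; right|right; right].
Qed.

Lemma almost_determined_sigma_algebra : sigma_algebra setT almost_determined.
Proof.
split.
- by rewrite -(preimage_set0 F); exact: almost_determined_preimage.
- move=> B [E mE BE]; exists (~` E); first exact: measurableC.
  apply: negligibleS BE => x [[[_ nB] nE]|[nE nB]].
    by right; split => //; apply: contrapT.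
  by left; split => //; apply: contrapT => ?; apply: nB.
- move=> B BE; pose E n := sval (cid2 (BE n)).
  exists (\bigcup_n E n).
    by apply: bigcupT_measurable => n; rewrite /E; case: cid2.
  apply: (@negligibleS _ _ _ _ (\bigcup_n (B n `+` F @^-1` E n))).
    move=> x [[[n _ Bx] nE]|[[n _ Ex] nB]].
      by exists n => //; left; split => // Ex; apply: nE; exists n.
    by exists n => //; right; split => // Bx; apply: nB; exists n.
  by apply: negligible_bigcup => n; rewrite /E; case: cid2.
Qed.

Lemma almost_determinedC B : almost_determined B -> almost_determined (~` B).
Proof. by have [_ + _] := almost_determined_sigma_algebra; rewrite -setTD; apply. Qed.

Lemma almost_determined_bigcup (B : nat -> set T) : (forall n, almost_determined (B n)) ->
  almost_determined (\bigcup_n B n).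
Proof. by have [_ _] := almost_determined_sigma_algebra; apply. Qed.

Lemma almost_determinedU B C : almost_determined B -> almost_determined C ->
  almost_determined (B `|` C).
Proof.
move=> hB hC; rewrite -bigcup2E; apply: almost_determined_bigcup => -[|[|n]] //=.
by have [] := almost_determined_sigma_algebra.
Qed.

Lemma almost_determinedI B C : almost_determined B -> almost_determined C ->
  almost_determined (B `&` C).
Proof.
move=> hB hC; rewrite -[_ `&` _]setCK setCI; apply: almost_determinedC.
by apply: almost_determinedU; exact: almost_determinedC.
Qed.

Lemma almost_determined_tuple (n : nat) (X : T -> n.-tuple R) :
  (forall i a, almost_determined [set t | tnth (X t) i <= a]) ->
  forall E, measurable E -> almost_determined (X @^-1` E).
Proof.
move=> hX E mE.
pose S := [set E : set (n.-tuple R) | almost_determined (X @^-1` E)].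
suff : @measurable _ (n.-tuple R) `<=` S by apply.
have [h0 hC hU] := almost_determined_sigma_algebra.
apply: smallest_sub; first split.
- by rewrite /S /= preimage_set0.
- by move=> B hB; rewrite /S /= setTD preimage_setC -setTD; exact: hC.
- by move=> B hB; rewrite /S /= preimage_bigcup; exact: hU.
rewrite /= -bigcup_seq; apply: bigcup_sub => i _ _ [B mB <-]; rewrite setTI /S /=.
pose S' := [set B : set R | almost_determined ((fun t => tnth (X t) i) @^-1` B)].
suff : @measurable _ R `<=` S' by apply.
apply: measurable_rays => [|a]; last exact: hX.
split.
- by rewrite /S' /= preimage_set0.
- by move=> B' hB; rewrite /S' /= setTD preimage_setC -setTD; exact: hC.
- by move=> B' hB; rewrite /S' /= preimage_bigcup; exact: hU.
Qed.

Lemma almost_determined_le (f g : T -> R) :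
  (forall q : rat, almost_determined [set t | f t <= ratr q]) ->
  (forall q : rat, almost_determined [set t | g t <= ratr q]) ->
  almost_determined [set t | f t <= g t].
Proof.
move=> hf hg; rewrite -[[set t | _]]setCK; apply: almost_determinedC.
(* The complement is {g < f}, and there some rational q satisfies g <= q < f. *)
pose D n := let q : rat := odflt 0 (unpickle n) in
  [set t | g t <= ratr q] `&` ~` [set t | f t <= ratr q].
rewrite (_ : ~` _ = \bigcup_n D n).
  apply: almost_determined_bigcup => n; apply: almost_determinedI => //.
  exact: almost_determinedC.
apply/seteqP; split=> t /=.
  move=> /negP; rewrite -ltNge => /rat_in_itvoo[q]; rewrite in_itv /= => /andP[gq qf].
  exists (pickle q); first exact: I.
  rewrite /D pickleK /=; split; first exact: ltW.
  by apply/negP; rewrite -ltNge.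
move=> [n _ [/= gq fq] fg]; apply: fq; exact: le_trans gq.
Qed.

End sigma_algebra_mod_null.
(** An inclusion, needed only on an event of probability 1, between events of equal probability
    leaves a null difference. This avoids any discussion of flat pieces and atoms of distribution
    functions. *)
Lemma negligible_setY_eq {R : realType} d (T : measurableType d) (P : probability T R)
    (B C G : set T) : measurable B -> measurable C -> measurable G ->
  P G = 1%E -> B `&` G `<=` C -> P B = P C -> P.-negligible (B `+` C).
Proof.
move=> mB mC mG PG BGC PBC.
have mBG : measurable (B `&` G) by exact: measurableI.
have mCG : measurable (C `&` G) by exact: measurableI.
have mD : measurable (C `&` G `\` B `&` G) by exact: measurableD.
have PD : P (C `&` G `\` B `&` G) = 0%E.
  transitivity (P (C `&` G) - P (C `&` G `&` (B `&` G)))%E.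
    by apply: measureD => //; rewrite (le_lt_trans (probability_le1 P mCG)) ?ltry.
  rewrite (_ : C `&` G `&` (B `&` G) = B `&` G); last first.
    apply/seteqP; split=> x [] // Bx Gx.
    by split => //; split => //; exact: BGC.
  rewrite (probability1I mG mB PG) (probability1I mG mC PG) PBC.
  by rewrite subee// fin_num_measure.
have nG := probability1_negligible mG PG.
have nD : P.-negligible (C `&` G `\` B `&` G) by apply/negligibleP.
apply: negligibleS (negligibleU nG nD) => x [[Bx nC]|[Cx nB]].
  by left => Gx; apply: nC; exact: BGC.
by have [Gx|nGx] := pselect (G x); [right; split => // -[]|left].
Qed.

(** * The Rosenblatt transform: it is uniform on the cube and determines the predictors *)

Section rosenblatt_transform.
Context {R : realType} (d : nat) (A : d.+1.-tuple R -> R).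
Hypothesis cA : is_copula A.

Local Notation mu := (copula_measure A).
Local Notation Om := (d.+1.-tuple R * d.-tuple R)%type.

Definition rosenblatt_prob : probability Om R := (mu \x lebesgue_cube d)%E.
Local Notation Q := rosenblatt_prob.

Local Notation K i := (markov_kernel (@marginal R d.+1 i.+1 A)).

(* The law of the first i coordinates, in the form in which it occurs in
   is_markov_kernel. *)
Local Notation mu_ i := (copula_measure (@marginal R i.+1 i (@marginal R d.+1 i.+1 A))).

Let psi (i : nat) (w : i.-tuple R * R * R) : R :=
  if i == 0%N then w.1.2 else randomized_cdf (K i) w.

Let past (i : nat) (w : Om) : i.-tuple R * R * R :=
  ((first_coords i w.1, nth 0 w.1 i), nth 0 w.2 i).

Let phi i w := psi (past i w).

Definition rosenblatt_rv (w : Om) : d.-tuple R := rosenblatt A w.2 (first_coords d w.1).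
Local Notation Phi := rosenblatt_rv.

Let nth_first_coords (k n i : nat) (x : n.-tuple R) : (i < k)%N ->
  nth 0 (first_coords k x) i = nth 0 x i.
Proof.
by move=> ik; rewrite -(tnth_nth 0 (first_coords k x) (Ordinal ik)) tnth_mktuple.
Qed.

Let PhiE i w : tnth (Phi w) i = phi i w.
Proof.
rewrite /Phi /rosenblatt tnth_mktuple /phi /psi /cond_cdf /past.
rewrite (first_coords_comp _ (ltnW (ltn_ord i))) (tnth_nth 0 w.2) (tnth_nth 0 (first_coords d w.1)).
by rewrite nth_first_coords.
Qed.

Let measurable_psi i : measurable_fun setT (@psi i).
Proof.
rewrite /psi; case: (i == 0)%N; last exact: measurable_randomized_cdf.
by apply: (@measurableT_comp _ _ _ _ _ _ snd _ fst).
Qed.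

Let measurable_x n : measurable_fun setT (fun w : Om => first_coords n w.1).
Proof. exact: (measurableT_comp (@measurable_first_coords R n d.+1) measurable_fst). Qed.

Let measurable_r n : measurable_fun setT (fun w : Om => first_coords n w.2).
Proof. exact: (measurableT_comp (@measurable_first_coords R n d) measurable_snd). Qed.

Let measurable_past i : measurable_fun setT (@past i).
Proof.
apply: measurable_fun_pair.
  apply: measurable_fun_pair; first exact: measurable_x.
  exact: (measurableT_comp (@measurable_nth R d.+1 i) measurable_fst).
exact: (measurableT_comp (@measurable_nth R d i) measurable_snd).
Qed.

Let measurable_phi i : measurable_fun setT (phi i).
Proof. exact: (measurableT_comp (@measurable_psi i) (@measurable_past i)). Qed.

Lemma measurable_rosenblatt_rv : measurable_fun setT Phi.
Proof.
apply/measurable_fun_tnthP => i.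
by rewrite (_ : _ \o _ = phi i)//; apply/funext => w; rewrite /= PhiE.
Qed.

Let QX E F : measurable E -> measurable F ->
  Q (E `*` F) = (mu E * lebesgue_cube d F)%E.
Proof. by move=> mE mF; exact: product_probabilityE. Qed.

Let cA1 i : (i < d)%N -> is_copula (@marginal R d.+1 i.+1 A).
Proof. by move=> ilt; apply: marginal_is_copula => //; exact: ltnW. Qed.

Let mu_E i E : (i < d)%N -> measurable E -> mu_ i E = mu (first_coords i @^-1` E).
Proof.
move=> ilt mE; rewrite copula_measure_marginal//; last exact: cA1.
rewrite copula_measure_marginal//; first 1 last.
- exact: ltnW.
- by apply: measurable_preimage => //; exact: measurable_first_coords.
by congr (copula_measure A _); apply/seteqP; split=> z; rewrite /= first_coords_comp.
Qed.

Let mu_X i (C : set (i.-tuple R * R)) : (i < d)%N -> measurable C ->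
  mu [set z | C (first_coords i z, nth 0 z i)] = kernel_joint (mu_ i) (K i) C.
Proof.
move=> ilt mC.
have mf : measurable_fun setT (fun z : d.+1.-tuple R => (first_coords i z, nth 0 z i)).
  by apply: measurable_fun_pair; [exact: measurable_first_coords|exact: measurable_nth].
apply: (@measure_rectangle_unique R _ _ _ _ (law mu mf) (kernel_joint (mu_ i) (K i))) => //.
  by rewrite (le_lt_trans (probability_le1 (law mu mf) _)) ?ltry.
move=> E F mE mF.
rewrite [RHS](kernel_jointX (mu_ i) (K i) mE mF).
rewrite -(markov_kernelP (cA1 ilt)).2//.
rewrite copula_measure_marginal//; first 1 last.
- exact: ltnW.
- apply: measurableI.
    by apply: (@measurable_preimage _ _ _ _ (first_coords i) E) => //; exact: measurable_first_coords.
  by apply: (@measurable_preimage _ _ _ _ (fun z => tnth z ord_max) F) => //; exact: measurable_tnth.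
rewrite [LHS]lawE; congr (copula_measure A _); apply/seteqP; split=> z /=;
  by rewrite first_coords_comp// (tnth_nth 0) nth_first_coords.
Qed.

Let mu_1 i : (i < d)%N -> mu_ i (cube i) = 1%E.
Proof.
move=> ilt; have : is_copula (@marginal R i.+1 i (@marginal R d.+1 i.+1 A)).
  by apply: marginal_is_copula => //; exact: cA1.
by move=> /copula_measureP[].
Qed.

(** Brings the i-th step of the transform into the form treated by [randomized_cdf_le]: a past, a
    coordinate drawn from the kernel, and an independent uniform randomiser. *)
Let past_law i S : (i < d)%N -> measurable S ->
  Q (@past i @^-1` S) = (kernel_joint (mu_ i) (K i) \x unif01)%E S.
Proof.
move=> ilt mS; apply/esym.
apply: (@product_measure_unique _ _ _ _ R (kernel_joint (mu_ i) (K i)) unif01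
  (law Q (@measurable_past i)) _ S mS) => C B mC mB.
transitivity (Q ([set z | C (first_coords i z, nth 0 z i)] `*`
    [set r | setT (first_coords i r) /\ B (nth 0 r i)])).
  rewrite [LHS]lawE; congr (Q _).
  by apply/seteqP; split=> -[z r] /=; [move=> []|move=> [? []]].
rewrite QX; first 1 last.
- by apply: (@measurable_preimage _ _ _ _ (fun z : d.+1.-tuple R => (first_coords i z, nth 0 z i)) C) => //;
  apply: measurable_fun_pair; [exact: measurable_first_coords|exact: measurable_nth].
- apply: (@measurableI _ _ (first_coords i @^-1` setT) ((fun z : d.-tuple R => nth 0 z i) @^-1` B)).
    by rewrite preimage_setT.
  by apply: (@measurable_preimage _ _ _ _ (fun z : d.-tuple R => nth 0 z i) B) => //; exact: measurable_nth.
by rewrite mu_X// lebesgue_cube_coordinates// preimage_setT probability_setT mul1e.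
Qed.

(** For positive [i] this is [randomized_cdf_le] with a constant level. For i = 0 there is no
    kernel: the uniform margin of the copula takes over, and [E], a set of empty tuples, holds
    everywhere or nowhere. *)
Let phi_le_past i (E : set (i.-tuple R)) u : (i < d)%N -> measurable E -> 0 <= u <= 1 ->
  Q [set w | E (first_coords i w.1) /\ phi i w <= u] =
  (mu (first_coords i @^-1` E) * u%:E)%E.
Proof.
move=> ilt mE u01; case: i => [|i] in E ilt mE *.
  have [Ex|Ex] := pselect (E [tuple]).
    have EE (z : d.+1.-tuple R) : E (first_coords 0 z) by rewrite (tuple0 (first_coords 0 z)).
    rewrite (_ : [set w | _] = [set z | tnth z ord0 <= u] `*` setT); last first.
      apply/seteqP; split=> -[z r] /=; rewrite /phi /psi /past /= (tnth_nth 0).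
        by move=> [_ ?].
      by move=> [? _]; split => //; exact: EE.
    rewrite QX//; last exact: measurable_coordinate_le.
    rewrite probability_setT mule1 (copula_uniform_margins cA)//.
    rewrite (_ : first_coords 0 @^-1` E = setT); last first.
      by apply/seteqP; split=> z //= _; exact: EE.
    by rewrite probability_setT mul1e.
  have EE (z : d.+1.-tuple R) : ~ E (first_coords 0 z) by rewrite (tuple0 (first_coords 0 z)).
  rewrite (_ : [set w | _] = set0); last by apply/seteqP; split=> w //= -[/EE].
  rewrite (_ : first_coords 0 @^-1` E = set0); last by apply/seteqP; split=> w //= /EE.
  by rewrite !measure0 mul0e.
rewrite -mu_E//.
transitivity ((kernel_joint (mu_ i.+1) (K i.+1) \x unif01)%E
    [set w | E w.1.1 /\ randomized_cdf (K i.+1) w <= u]).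
  rewrite -past_law//; apply: measurableI.
    apply: (@measurable_preimage _ _ _ _ (fun w : i.+1.-tuple R * R * R => w.1.1)) => //.
    by apply: (@measurableT_comp _ _ _ _ _ _ fst _ fst).
  by apply: (measurable_set_le _); exact: measurable_randomized_cdf.
rewrite (@randomized_cdf_le _ _ _ _ _ (cube i.+1) E (cst u))//.
- by rewrite (eq_integral (cst u%:E))// integral_cst// muleC.
- exact: measurable_cube.
- exact: mu_1.
- exact: (markov_kernelP (cA1 ilt)).1.
Qed.

Let past_indep i (S : set (i.-tuple R * R * R)) (G : set (i.-tuple R)) : (i < d)%N ->
  measurable S -> measurable G ->
  Q [set w | S (past i w) /\ G (first_coords i w.2)] =
  (lebesgue_cube d (first_coords i @^-1` G) * Q (@past i @^-1` S))%E.
Proof.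
move=> ilt mS mG.
have mGd : measurable (first_coords i @^-1` G : set (d.-tuple R)).
  by apply: measurable_preimage => //; exact: measurable_first_coords.
have mGO : measurable [set w : Om | G (first_coords i w.2)].
  exact: (measurable_preimage (@measurable_r i) mG).
pose c := fine (lebesgue_cube d (first_coords i @^-1` G)).
have c0 : 0 <= c by exact: fine_ge0.
have cE : lebesgue_cube d (first_coords i @^-1` G) = c%:E.
  by rewrite fineK// fin_num_measure.
rewrite cE.
apply: (@measure_rectangle_unique R _ _ _ _ (partial_law Q mGO (@measurable_past i))
  (mscale (NngNum c0) (law Q (@measurable_past i)))) => //.
  rewrite [ltLHS](_ : _ = Q (setT `&` [set w : Om | G (first_coords i w.2)])); last first.
    exact: partial_lawE.
  by rewrite setTI (le_lt_trans (probability_le1 _ _)) ?ltry.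
move=> C B mC mB.
have mCd : measurable [set z : d.+1.-tuple R | C (first_coords i z, nth 0 z i)].
  by apply: (@measurable_preimage _ _ _ _ (fun z : d.+1.-tuple R => (first_coords i z, nth 0 z i)) C) => //;
  apply: measurable_fun_pair; [exact: measurable_first_coords|exact: measurable_nth].
have mBd G' : measurable G' -> measurable [set r : d.-tuple R | G' (first_coords i r) /\ B (nth 0 r i)].
  move=> mG'; apply: measurableI.
    by apply: (@measurable_preimage _ _ _ _ (first_coords i) G') => //; exact: measurable_first_coords.
  by apply: (@measurable_preimage _ _ _ _ (fun z : d.-tuple R => nth 0 z i) B) => //; exact: measurable_nth.
transitivity (Q ([set z | C (first_coords i z, nth 0 z i)] `*`
    [set r | G (first_coords i r) /\ B (nth 0 r i)])).
  rewrite [LHS](partial_lawE Q mGO (@measurable_past i)); congr (Q _).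
  by apply/seteqP; split=> -[z r] /=; [move=> [[]]|move=> [? []]].
pose S0 : set Om := [set z | C (first_coords i z, nth 0 z i)] `*`
    [set r | setT (first_coords i r) /\ B (nth 0 r i)].
transitivity (c%:E * Q S0)%E; last first.
  congr (_ * Q _)%E.
  by apply/seteqP; split=> -[z r] /=; [move=> [? []]|move=> []].
rewrite /S0 !QX//; [|exact: mBd|exact: mBd].
rewrite !lebesgue_cube_coordinates// preimage_setT probability_setT mul1e cE.
by rewrite muleCA.
Qed.

(** Earlier coordinates of the transform use earlier predictors and earlier randomisers, so [phi i]
    must be independent of both together. On rectangles this combines [past_indep] with
    [phi_le_past]. *)
Let phi_indep i (B : set (i.-tuple R * i.-tuple R)) u : (i < d)%N -> measurable B ->
  0 <= u <= 1 ->
  Q [set w | B (first_coords i w.1, first_coords i w.2) /\ phi i w <= u] =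
  (u%:E * Q [set w | B (first_coords i w.1, first_coords i w.2)])%E.
Proof.
move=> ilt mB u01; have /andP[u0 u1] := u01.
have mxr : measurable_fun setT (fun w : Om => (first_coords i w.1, first_coords i w.2)).
  by apply: measurable_fun_pair; [exact: measurable_x|exact: measurable_r].
have mphiu : measurable [set w | phi i w <= u].
  by apply: (measurable_set_le _); exact: measurable_phi.
apply: (@measure_rectangle_unique R _ _ _ _ (partial_law Q mphiu mxr)
  (mscale (NngNum u0) (law Q mxr))) => //.
  rewrite [ltLHS](_ : _ = Q (setT `&` [set w | phi i w <= u])); last first.
    exact: partial_lawE.
  by rewrite setTI (le_lt_trans (probability_le1 _ _)) ?ltry.
move=> E G mE mG.
have mEd : measurable (first_coords i @^-1` E : set (d.+1.-tuple R)).
  by apply: measurable_preimage => //; exact: measurable_first_coords.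
have mGd : measurable (first_coords i @^-1` G : set (d.-tuple R)).
  by apply: measurable_preimage => //; exact: measurable_first_coords.
pose S := [set w : i.-tuple R * R * R | E w.1.1 /\ psi w <= u].
have mS : measurable S.
  apply: measurableI.
    apply: (@measurable_preimage _ _ _ _ (fun w : i.-tuple R * R * R => w.1.1)) => //.
    by apply: (@measurableT_comp _ _ _ _ _ _ fst _ fst).
  by apply: (measurable_set_le _); exact: measurable_psi.
transitivity (Q [set w | S (past i w) /\ G (first_coords i w.2)]).
  rewrite [LHS](partial_lawE Q mphiu mxr); congr (Q _).
  by apply/seteqP; split=> -[z r] /=; [move=> [[]]|move=> [[]]].
rewrite past_indep//.
transitivity (u%:E * Q ((first_coords i @^-1` E) `*` (first_coords i @^-1` G)))%E; last by [].
rewrite QX//.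
pose S0 : set Om := [set w | E (first_coords i w.1) /\ phi i w <= u].
transitivity (lebesgue_cube d (first_coords i @^-1` G) * Q S0)%E; first by [].
by rewrite /S0 phi_le_past// muleC [in RHS]muleA [(u%:E * _)%E]muleC.
Qed.

(** Induction on [i]: the constraints on the first i coordinates form an event [B] of the first i
    predictors and randomisers, so [phi_indep] splits off the factor [u i]. *)
Let phi_orthant (u : nat -> R) : (forall j, 0 <= u j <= 1) -> forall i, (i <= d)%N ->
  Q [set w | forall j, (j < i)%N -> phi j w <= u j] = (\prod_(j < i) u j)%:E.
Proof.
move=> u01; elim=> [_|i ih ilt].
  rewrite big_ord0 (_ : [set w | _] = setT) ?probability_setT//.
  by apply/seteqP; split.
pose B := [set w : i.-tuple R * i.-tuple R | forall j, (j < i)%N ->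
  psi ((first_coords j w.1, nth 0 w.1 j), nth 0 w.2 j) <= u j].
have BE w : B (first_coords i w.1, first_coords i w.2) <->
    forall j, (j < i)%N -> phi j w <= u j.
  split=> h j ji; have := h j ji.
    by rewrite /= first_coords_comp ?(ltnW ji)// !nth_first_coords.
  by rewrite /= first_coords_comp ?(ltnW ji)// !nth_first_coords.
have mB : measurable B.
  have -> : B = \bigcap_j [set w : i.-tuple R * i.-tuple R | (j < i)%N ->
      psi ((first_coords j w.1, nth 0 w.1 j), nth 0 w.2 j) <= u j].
    by apply/seteqP; split=> w /= h j; [move=> _; exact: h|exact: h].
  apply: bigcapT_measurable => j; have [ji|ij] := ltnP j i; last first.
    by rewrite (_ : [set w | _] = setT)//; apply/seteqP; split.
  rewrite (_ : [set w | _] = [set w : i.-tuple R * i.-tuple R |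
      psi ((first_coords j w.1, nth 0 w.1 j), nth 0 w.2 j) <= u j]); last first.
    by apply/seteqP; split=> w /=; [apply|].
  apply: measurable_set_le; apply: (measurableT_comp (@measurable_psi j)).
  apply: measurable_fun_pair.
    apply: measurable_fun_pair.
      exact: (measurableT_comp (@measurable_first_coords R j i) measurable_fst).
    exact: (measurableT_comp (@measurable_nth R i j) measurable_fst).
  exact: (measurableT_comp (@measurable_nth R i j) measurable_snd).
transitivity (Q [set w | B (first_coords i w.1, first_coords i w.2) /\ phi i w <= u i]).
  congr (Q _); apply/seteqP; split=> w /=.
    by move=> h; split; [apply/BE => j ji; apply: h; exact: ltnW|exact: h].
  by move=> [/BE h hi] j; rewrite ltnS leq_eqVlt => /predU1P[->//|]; exact: h.
rewrite phi_indep// big_ord_recr/= EFinM muleC -ih; last exact: ltnW.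
suff -> : [set w : Om | B (first_coords i w.1, first_coords i w.2)] =
    [set w | forall j, (j < i)%N -> phi j w <= u j] by [].
by apply/seteqP; split=> w; [exact: (BE w).1|exact: (BE w).2].
Qed.

Lemma rosenblatt_law E : measurable E -> Q (Phi @^-1` E) = lebesgue_cube d E.
Proof.
move=> mE.
pose L := law Q measurable_rosenblatt_rv.
rewrite -[LHS]/(L E); apply: orthant_unique_cube => //.
- apply: uniform_margins_cube => i u u01.
  transitivity (Q [set w | setT (first_coords i w.1, first_coords i w.2) /\ phi i w <= u]).
    by rewrite [LHS]lawE; congr (Q _); apply/seteqP; split=> w /=; rewrite PhiE => // -[].
  rewrite phi_indep// (_ : [set _ | _] = setT); last by apply/seteqP; split.
  by rewrite probability_setT mule1.
- exact: lebesgue_cube_cube.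
move=> x xc; rewrite lebesgue_cube_orthant//.
have u01 j : 0 <= nth 0 x j <= 1.
  have [jd|dj] := ltnP j d; first by have := xc (Ordinal jd); rewrite (tnth_nth 0).
  by rewrite nth_default ?size_tuple// lexx ler01.
rewrite /Pi_copula (eq_bigr (fun j : 'I_d => nth 0 x j)); last first.
  by move=> j _; rewrite (tnth_nth 0).
rewrite -phi_orthant// [LHS]lawE; congr (Q _); apply/seteqP; split=> w /= h j.
  by move=> jd; have := h (Ordinal jd); rewrite PhiE (tnth_nth 0).
by rewrite PhiE (tnth_nth 0); exact: h.
Qed.

Let phi_determined (i : 'I_d) (a : R) : almost_determined Q Phi [set w | phi i w <= a].
Proof.
rewrite (_ : [set w | _] = Phi @^-1` [set x | tnth x i <= a]).
  by apply: almost_determined_preimage; exact: measurable_coordinate_le.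
by apply/seteqP; split=> w /=; rewrite PhiE.
Qed.

(** The step that inverts the transform. If x_i <= a, then [phi i] is at most the conditional
    distribution function at [a]. Both events have the same probability, the second one because
    [phi i] is uniform given the past, so they differ by a null set. *)
Let coordinate_phi (i : 'I_d) (a : R) : (0 < i)%N ->
  Q.-negligible ([set w : Om | nth 0 w.1 i <= a] `+`
    [set w | phi i w <= fine (K i (first_coords i w.1) `[0, a]%classic)]).
Proof.
move=> i0; have ilt := ltn_ord i.
pose g (x : i.-tuple R) := fine (K i x `[0, a]%classic).
have Kfin x F : measurable F -> K i x F = (fine (K i x F))%:E.
  by move=> mF; rewrite fineK// (@fin_num_measure _ _ _ (kernel_at (K i) x)).
have mg : measurable_fun setT g.
  apply: (@measurableT_comp _ _ _ _ _ _ (@fine R) _ (fun x => K i x `[0, a]%classic)).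
    exact: fine_measurable.
  exact: measurable_kernel.
have g01 x : 0 <= g x <= 1.
  by rewrite /g fine_ge0//= -lee_fin -Kfin// (probability_le1 (kernel_at (K i) x)).
have mxi : measurable_fun setT (fun w : Om => nth 0 w.1 i).
  exact: (measurableT_comp (@measurable_nth R d.+1 i) measurable_fst).
have mri : measurable_fun setT (fun w : Om => nth 0 w.2 i).
  exact: (measurableT_comp (@measurable_nth R d i) measurable_snd).
pose G : set Om := cube d.+1 `*` cube d.
have QG : Q G = 1%E.
  rewrite QX; [|exact: measurable_cube|exact: measurable_cube].
  by rewrite lebesgue_cube_cube mule1; have [] := copula_measureP cA.
apply: (negligible_setY_eq _ _ _ QG).
- exact: measurable_set_le.
- by apply: measurable_set_lef; [exact: measurable_phi|exact: (measurableT_comp mg (@measurable_x i))].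
- by apply: measurableX; exact: measurable_cube.
- move=> -[z r] [/= xa [/= zc rc]].
  have := zc (widen_ord (leqnSn d) i); rewrite (tnth_nth 0) /= => /andP[z0 z1].
  have := rc i; rewrite (tnth_nth 0) => /andP[r0 r1].
  rewrite /phi /psi /past gtn_eqF//= /randomized_cdf /=.
  set k := K i _; set t := nth 0 z i in z0 z1 xa *.
  have kfin F : measurable F -> k F = (fine (k F))%:E by exact: Kfin.
  have kE : fine (k `[0, t]%classic) = fine (k `[0, t[%classic) + fine (k [set t]).
    apply: EFin_inj; rewrite EFinD -!kfin// -measureU//.
      by rewrite (@setUitv1 _ R (BLeft 0) t true)// bnd_simp.
    by apply/seteqP; split=> y //= -[]; rewrite in_itv /= => /andP[_ +] yx; rewrite yx ltxx.
  apply: (@le_trans _ _ (fine (k `[0, t]%classic))).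
    by rewrite kE lerD2l ler_piMl// fine_ge0.
  rewrite -lee_fin -!kfin// le_measure ?inE// => y /=; rewrite !in_itv /= => /andP[-> yt].
  exact: le_trans xa.
transitivity (\int[mu_ i]_x K i x [set t | (t <= a)%R])%E.
  have ma : measurable [set t : R | t <= a].
    by apply: (@measurable_set_le R _ R id); exact: measurable_id.
  rewrite -(kernel_jointX (mu_ i) (K i) measurableT ma).
  rewrite -(@mu_X i _ ilt (measurableX measurableT ma)).
  rewrite (_ : [set w : Om | _] = [set z : d.+1.-tuple R | nth 0 z i <= a] `*` setT); last first.
    by apply/seteqP; split=> -[z r] //= [].
  rewrite QX//; last by apply: measurable_set_le; exact: measurable_nth.
  rewrite probability_setT mule1; congr (copula_measure A _).
  by apply/seteqP; split=> z //= [].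
have ma : measurable [set t : R | t <= a].
  by apply: (@measurable_set_le R _ R id); exact: measurable_id.
transitivity (\int[mu_ i]_x (g x)%:E)%E.
  apply: ae_eq_integral => //.
  - exact: measurable_kernel.
  - exact/measurable_EFinP.
  apply: negligibleS (probability1_negligible (@measurable_cube R i) (mu_1 ilt)).
  move=> x /= hx xc; apply: hx => _; rewrite /g -Kfin//.
  have K1 := (markov_kernelP (cA1 ilt)).1 x xc.
  have m01 : measurable `[0 : R, 1]%classic by [].
  have m0a : measurable `[0 : R, a]%classic by [].
  apply: etrans (esym (@probability1I _ _ _ (kernel_at (K i) x) _ _ m01 ma K1)) _.
  apply: etrans _ (@probability1I _ _ _ (kernel_at (K i) x) _ _ m01 m0a K1).
  congr (kernel_at _ _ _); apply/seteqP; split=> t /=; rewrite !in_itv /=.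
    by move=> [ta /andP[t0 t1]]; rewrite t0 ta t1.
  by move=> [/andP[_ ta] t01].
pose S := [set w : i.-tuple R * R * R | setT w.1.1 /\ randomized_cdf (K i) w <= g w.1.1].
have mfst11 : measurable_fun setT (fun w : i.-tuple R * R * R => w.1.1).
  by apply: (@measurableT_comp _ _ _ _ _ _ fst _ fst).
have mS : measurable S.
  apply: (@measurableI _ _ setT) => //.
  apply: measurable_set_lef; first exact: measurable_randomized_cdf.
  exact: (measurableT_comp mg mfst11).
rewrite -(@randomized_cdf_le _ _ _ (mu_ i) (K i) (cube i) setT g)//; first 1 last.
- exact: measurable_cube.
- exact: mu_1.
- exact: (markov_kernelP (cA1 ilt)).1.
rewrite -past_law//; congr (Q _); apply/seteqP; split=> w /=;
  by rewrite /S /phi /psi gtn_eqF//= => -[].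
Qed.

(** In [coordinate_phi] the level depends on earlier predictors only, and these are already
    determined by induction. The first coordinate is copied unchanged by the transform. *)
Let coordinate_determined n : (n <= d)%N -> forall j a, (j < n)%N ->
  almost_determined Q Phi [set w : Om | nth 0 w.1 j <= a].
Proof.
elim: n => // n ih nd j a; rewrite ltnS leq_eqVlt => /predU1P[->{j}|]; last first.
  by apply: ih; exact: ltnW.
pose i := Ordinal nd; have [n0|n0] := posnP n.
  rewrite (_ : [set w | _] = [set w | phi i w <= a]); first exact: phi_determined.
  by apply/seteqP; split=> w; rewrite /phi /psi /past /= n0.
apply: almost_determined_eq (coordinate_phi (i := i) a n0) _.
apply: almost_determined_le => q; first exact: phi_determined.
pose E := [set x : n.-tuple R | fine (K n x `[0, a]%classic) <= ratr q].
rewrite (_ : [set w | _] = (fun w : Om => first_coords n w.1) @^-1` E)//.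
apply: almost_determined_tuple => [k b|].
  rewrite (_ : [set t | _] = [set w : Om | nth 0 w.1 k <= b]).
    by apply: ih; [exact: ltnW|exact: ltn_ord].
  by apply/seteqP; split=> w /=; rewrite tnth_mktuple.
apply: measurable_set_le.
apply: (@measurableT_comp _ _ _ _ _ _ (@fine R) _ (fun x => K n x `[0, a]%classic)).
  exact: fine_measurable.
exact: measurable_kernel.
Qed.

Lemma rosenblatt_determines E : measurable E ->
  almost_determined Q Phi [set w : Om | E (first_coords d w.1)].
Proof.
move=> mE; apply: (@almost_determined_tuple _ _ _ _ _ _ _ d (fun w : Om => first_coords d w.1)) => // i a.
rewrite (_ : [set t | _] = [set w : Om | nth 0 w.1 i <= a]).
  exact: (@coordinate_determined d).
by apply/seteqP; split=> w /=; rewrite tnth_mktuple.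
Qed.

End rosenblatt_transform.

(** * Prediction advantage and mean deviation of conditional probabilities *)

Section advantage.
Context {R : realType} d d1 (T : measurableType d) (T1 : measurableType d1).
Variables (P : probability T R).

Lemma probability_fineK d0 (T0 : measurableType d0) (P0 : probability T0 R) (A : set T0) :
  measurable A -> P0 A = (fine (P0 A))%:E.
Proof. by move=> mA; rewrite fineK// fin_num_measure. Qed.

(* How much better than chance the event {X in E} predicts {V <= y}, when V is
   uniform. *)
Definition advantage (X : T -> T1) (V : T -> R) (y : R) (E : set T1) : R :=
  fine (P (X @^-1` E `&` [set t | V t <= y])) - y * fine (P (X @^-1` E)).

Definition max_advantage (X : T -> T1) (V : T -> R) (y : R) : \bar R :=
  ereal_sup [set (advantage X V y E)%:E | E in measurable].

Variables (X : T -> T1) (V : T -> R).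
Hypotheses (mX : measurable_fun setT X) (mV : measurable_fun setT V).

Lemma advantage_le_max y E : measurable E ->
  ((advantage X V y E)%:E <= max_advantage X V y)%E.
Proof. by move=> mE; apply: ereal_sup_ubound; exists E. Qed.

Lemma max_advantage_ge0 y : (0 <= max_advantage X V y)%E.
Proof.
apply: (@le_trans _ _ (advantage X V y set0)%:E); last exact: advantage_le_max.
by rewrite /advantage preimage_set0 set0I measure0 /= mulr0 subrr.
Qed.

Let mXE E : measurable E -> measurable (X @^-1` E).
Proof. exact: measurable_preimage. Qed.

Let mVy y : measurable [set t | V t <= y].
Proof. exact: measurable_set_le. Qed.

Let mXV y E : measurable E -> measurable (X @^-1` E `&` [set t | V t <= y]).
Proof. by move=> mE; apply: measurableI => //; exact: mXE. Qed.

Let p y E := fine (P (X @^-1` E `&` [set t | V t <= y])).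
Let q E := fine (P (X @^-1` E)).

Let pU y E F : measurable E -> measurable F -> E `&` F = set0 ->
  p y (E `|` F) = p y E + p y F.
Proof.
move=> mE mF EF; apply: EFin_inj; rewrite EFinD /p -!probability_fineK; try exact: mXV; last first.
  exact/mXV/measurableU.
rewrite preimage_setU setIUl; apply: measureU; try exact: mXV.
by rewrite setIACA -preimage_setI EF preimage_set0 set0I.
Qed.

Let qU E F : measurable E -> measurable F -> E `&` F = set0 -> q (E `|` F) = q E + q F.
Proof.
move=> mE mF EF; apply: EFin_inj; rewrite EFinD /q -!probability_fineK; try exact: mXE; last first.
  exact/mXE/measurableU.
rewrite preimage_setU; apply: measureU; try exact: mXE.
by rewrite -preimage_setI EF preimage_set0.
Qed.

Lemma advantageU y E F : measurable E -> measurable F -> E `&` F = set0 ->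
  advantage X V y (E `|` F) = advantage X V y E + advantage X V y F.
Proof.
move=> mE mF EF; rewrite /advantage -!/(p _ _) -!/(q _) pU// qU//; ring.
Qed.

(** The advantage is additive and that of the whole space is y - y = 0. *)
Lemma advantageC y E : measurable E -> P [set t | V t <= y] = y%:E ->
  advantage X V y (~` E) = - advantage X V y E.
Proof.
move=> mE Py; apply/eqP; rewrite -addr_eq0 addrC -advantageU; last 3 first.
- exact: mE.
- exact: measurableC.
- by rewrite setICr.
by rewrite setUv /advantage preimage_setT setTI Py probability_setT /= mulr1 subrr.
Qed.

Lemma advantage_le y E : measurable E -> P [set t | V t <= y] = y%:E ->
  0 <= y <= 1 -> advantage X V y E <= y * (1 - y).
Proof.
move=> mE Py /andP[y0 y1].
have pq : p y E <= q E.
  rewrite -lee_fin -!probability_fineK; [|exact: mXE|exact: mXV].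
  by apply: le_measure; rewrite ?inE; [exact: mXV|exact: mXE|move=> t []].
have py : p y E <= y.
  rewrite -lee_fin -Py -probability_fineK; last exact: mXV.
  by apply: le_measure; rewrite ?inE; [exact: mXV|exact: mVy|move=> t []].
rewrite /advantage -/(p y E) -/(q E).
apply: (@le_trans _ _ (p y E - y * p y E)); first by rewrite lerD2l lerN2 ler_wpM2l.
have -> : p y E - y * p y E = p y E * (1 - y) by ring.
by rewrite ler_wpM2r// subr_ge0.
Qed.

Lemma max_advantage_le y : P [set t | V t <= y] = y%:E -> 0 <= y <= 1 ->
  (max_advantage X V y <= (y * (1 - y))%:E)%E.
Proof.
move=> Py y01; apply: ge_ereal_sup => _ [E mE <-].
by rewrite lee_fin; exact: advantage_le.
Qed.

Lemma max_advantage_fin_num y : P [set t | V t <= y] = y%:E -> 0 <= y <= 1 ->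
  max_advantage X V y \is a fin_num.
Proof.
move=> Py y01; rewrite ge0_fin_numE ?max_advantage_ge0//.
by rewrite (le_lt_trans (max_advantage_le Py y01))// ltry.
Qed.

Section conditional_density.
Variables (y : R) (k : T1 -> R).
Hypotheses (mk : measurable_fun setT k) (k0 : forall x, 0 <= k x) (y0 : 0 <= y).
Hypothesis Py : P [set t | V t <= y] = y%:E.
Hypothesis kE : forall E, measurable E ->
  P (X @^-1` E `&` [set t | V t <= y]) = (\int[law P mX]_(x in E) (k x)%:E)%E.

Let m := law P mX.
Let E0 := ~` [set x | k x <= y].

Let mE0 : measurable E0. Proof. by apply: measurableC; exact: measurable_set_le. Qed.

Let mE0C : measurable (~` E0). Proof. exact: measurableC. Qed.

Let mkE D : measurable_fun D (EFin \o k).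
Proof. exact/measurable_funTS/measurable_EFinP. Qed.

Let intk E : measurable E -> (\int[m]_(x in E) (k x)%:E = (p y E)%:E)%E.
Proof. by move=> mE; rewrite -kE// /p -probability_fineK//; exact: mXV. Qed.

Let inty E : measurable E -> (\int[m]_(x in E) (cst y%:E x) = (y * q E)%:E)%E.
Proof.
move=> mE; rewrite integral_cst// EFinM; congr (_ * _)%E.
by rewrite [LHS]probability_fineK.
Qed.

(** The best prediction is made exactly where the conditional probability exceeds [y]: a set outside
    [E0] adds a non-positive amount, and a piece of [E0] left out would have added a non-negative
    one. *)
Lemma max_advantage_attained : max_advantage X V y = (advantage X V y E0)%:E.
Proof.
have adv_ge0 B : measurable B -> B `<=` E0 -> 0 <= advantage X V y B.
  move=> mB BE0; rewrite /advantage subr_ge0 -lee_fin -inty// -intk//.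
  apply: ge0_le_integral => //= x /BE0 /negP.
  by rewrite -ltNge lee_fin => /ltW.
have adv_le0 B : measurable B -> B `<=` ~` E0 -> advantage X V y B <= 0.
  move=> mB BE0; rewrite /advantage subr_le0 -lee_fin -inty// -intk//.
  by apply: ge0_le_integral => //= x /BE0 /contrapT; rewrite lee_fin.
apply/eqP; rewrite eq_le advantage_le_max// andbT.
apply: ge_ereal_sup => _ [E mE <-]; rewrite lee_fin.
have mEI : measurable (E `&` E0) by exact: measurableI.
have mED : measurable (E `\` E0) by exact: measurableD.
have mE0D : measurable (E0 `\` E) by exact: measurableD.
have eE : advantage X V y E = advantage X V y (E `&` E0) + advantage X V y (E `\` E0).
  rewrite -advantageU//; first by rewrite setUIDK.
  by apply/seteqP; split=> [z [[_ ?] []]|z []].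
have eE0 : advantage X V y E0 = advantage X V y (E `&` E0) + advantage X V y (E0 `\` E).
  rewrite -advantageU//; first by rewrite (setIC E E0) setUIDK.
  by apply/seteqP; split=> [z [[? _] []]|z []].
have h1 : advantage X V y (E `\` E0) <= 0 by apply: adv_le0 => // x [].
have h2 : 0 <= advantage X V y (E0 `\` E) by apply: adv_ge0 => // x [].
by rewrite eE eE0 lerD2l (le_trans h1).
Qed.

(** The integral of |k - y| is the advantage of [E0] on [E0] and minus the advantage of the
    complement elsewhere; by [advantageC] the two halves are equal. *)
Lemma integral_kernel_dev :
  (\int[m]_x (`|k x - y|)%:E = 2%:E * max_advantage X V y)%E.
Proof.
have mdev D : measurable_fun D (fun x => `|k x - y|%:E).
  apply/measurable_funTS/measurable_EFinP/measurableT_comp => //.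
  by apply: measurable_funB.
have intE0 : (\int[m]_(x in E0) `|k x - y|%:E = (advantage X V y E0)%:E)%E.
  (* Written as a sum of non-negative integrals, so that the subtraction takes place between real
     numbers only. *)
  have : (\int[m]_(x in E0) (k x)%:E =
      \int[m]_(x in E0) `|k x - y|%:E + \int[m]_(x in E0) (cst y%:E x))%E.
    rewrite -ge0_integralD//; apply: eq_integral => x; rewrite inE => /negP.
    by rewrite -ltNge => yk; rewrite /= -EFinD ger0_norm ?subr_ge0 ?ltW// subrK.
  rewrite intk// inty// => h; apply/eqP.
  have : (\int[m]_(x in E0) `|k x - y|%:E)%E \is a fin_num.
    rewrite ge0_fin_numE ?integral_ge0//.
    rewrite (@le_lt_trans _ _ (p y E0)%:E)// ?ltry// h leeDl// lee_fin.
    by rewrite mulr_ge0// fine_ge0.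
  move=> /fineK hE; rewrite -hE eqe; move: h; rewrite -hE -EFinD => -[h].
  by rewrite /advantage -/(p y E0) -/(q E0) h addrK.
have intE0C : (\int[m]_(x in ~` E0) `|k x - y|%:E = (- advantage X V y (~` E0))%:E)%E.
  have : (\int[m]_(x in ~` E0) (cst y%:E x) =
      \int[m]_(x in ~` E0) `|k x - y|%:E + \int[m]_(x in ~` E0) (k x)%:E)%E.
    rewrite -ge0_integralD//; last by move=> x _; rewrite lee_fin.
    apply: eq_integral => x; rewrite inE => /contrapT /= ky.
    by rewrite -EFinD ler0_norm ?subr_le0// opprB subrK.
  rewrite intk// inty// => h; apply/eqP.
  have : (\int[m]_(x in ~` E0) `|k x - y|%:E)%E \is a fin_num.
    rewrite ge0_fin_numE ?integral_ge0//.
    rewrite (@le_lt_trans _ _ (y * q (~` E0))%:E)// ?ltry// h leeDl// lee_fin.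
    by rewrite fine_ge0.
  move=> /fineK hE; rewrite -hE eqe; move: h; rewrite -hE -EFinD => -[h].
  by rewrite /advantage -/(p y (~` E0)) -/(q (~` E0)) h opprB addrK.
rewrite max_advantage_attained -[setT](setUv E0) ge0_integral_setU//; last first.
  by apply/disj_setPS; rewrite setICr.
rewrite intE0 intE0C (advantageC mE0 Py) opprK -EFinD -EFinM; congr EFin; ring.
Qed.

End conditional_density.

End advantage.

Section advantage_comparison.
Context {R : realType} d (T : measurableType d) (P : probability T R).

Lemma negligible_setY_measure (A B : set T) : measurable A -> measurable B ->
  P.-negligible (A `+` B) -> P A = P B.
Proof.
move=> mA mB nAB.
have le (C D : set T) : measurable C -> measurable D ->
    P.-negligible (C `\` D) -> (P C <= P D)%E.
  move=> mC mD /measure_negligible -/(_ (measurableD mC mD)) CD.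
  have -> : P C = P (C `&` D).
    rewrite [LHS](measureDI P mC mD); apply: etrans (add0e _).
    by congr (_ + _)%E.
  by apply: le_measure; rewrite ?inE//; exact: measurableI.
apply/eqP; rewrite eq_le; apply/andP; split; apply: le => //.
  by apply: negligibleS nAB => x h; left.
by apply: negligibleS nAB => x h; right.
Qed.

Lemma max_advantage_mono d1 d2 (T1 : measurableType d1) (T2 : measurableType d2)
    (X1 : T -> T1) (X2 : T -> T2) (V : T -> R) (y : R) :
  measurable_fun setT X1 -> measurable_fun setT X2 -> measurable_fun setT V ->
  (forall E, measurable E -> almost_determined P X2 (X1 @^-1` E)) ->
  (max_advantage P X1 V y <= max_advantage P X2 V y)%E.
Proof.
move=> mX1 mX2 mV h; apply: ge_ereal_sup => _ [E mE <-].
have [E' mE' EE'] := h E mE.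
rewrite (_ : advantage P X1 V y E = advantage P X2 V y E'); first exact: advantage_le_max.
have m1 : measurable (X1 @^-1` E) by exact: measurable_preimage.
have m2 : measurable (X2 @^-1` E') by exact: measurable_preimage.
have m3 : measurable [set t | V t <= y] by exact: measurable_set_le.
rewrite /advantage (negligible_setY_measure m1 m2 EE'); congr (fine _ - _).
apply: negligible_setY_measure; [exact: measurableI|exact: measurableI|].
apply: negligibleS EE' => t [[[Et Vt] nE]|[[Et Vt] nE]].
  by left; split => // ?; exact: nE.
by right; split => // ?; exact: nE.
Qed.

End advantage_comparison.

(** * The measure of the linkage and the formula for zeta^1 *)

Section linkage_formula.
Context {R : realType}.

Lemma product_probability_ysection d1 d2 (T1 : measurableType d1)
    (T2 : measurableType d2) (P1 : probability T1 R) (P2 : probability T2 R)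
    (S : set (T1 * T2)) : measurable S ->
  (P1 \x P2)%E S = (\int[P2]_r P1 (ysection S r))%E.
Proof.
move=> mS.
transitivity ((P1 \x^ P2)%E S); last by [].
apply: (@product_measure_unique _ _ _ _ R P1 P2 (P1 \x^ P2)%E _ S mS) => B C mB mC.
exact: product_measure2E.
Qed.

Section one_copula.
Variables (d : nat) (A : d.+1.-tuple R -> R).
Hypothesis cA : is_copula A.

Local Notation mu := (copula_measure A).
Local Notation Om := (d.+1.-tuple R * d.-tuple R)%type.
Local Notation Q := (rosenblatt_prob A).
Local Notation Phi := (@rosenblatt_rv R d A).
Local Notation predictors := (@first_coords R d d.+1).
Local Notation response := (fun z : d.+1.-tuple R => tnth z ord_max).

Let Yl (w : Om) : R := tnth w.1 ord_max.

Let mYl : measurable_fun setT Yl.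
Proof. exact: (measurableT_comp (@measurable_tnth _ R d.+1 ord_max) measurable_fst). Qed.

Let mPhi := @measurable_rosenblatt_rv R d A.

Let mW : measurable_fun setT (fun w : Om => snoc (Phi w) (Yl w)).
Proof. exact: measurable_snoc. Qed.

Let Q_fst E : measurable E -> Q (fst @^-1` E) = mu E.
Proof.
move=> mE; rewrite (_ : fst @^-1` E = E `*` setT); last first.
  by apply/seteqP; split=> w //= [].
by rewrite [LHS]product_probabilityE// probability_setT mule1.
Qed.

Let Yl_le y : 0 <= y <= 1 -> Q [set w | Yl w <= y] = y%:E.
Proof.
move=> y01.
rewrite (_ : [set w | _] = fst @^-1` [set z | tnth z ord_max <= y])//.
rewrite Q_fst; last exact: measurable_coordinate_le.
exact: copula_uniform_margins.
Qed.

Let W_uniform : uniform_margins (law Q mW).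
Proof.
move=> i u u01; rewrite [LHS]lawE; have [ilt|] := ltnP i d; last first.
  move=> di; have iE : i = ord_max.
    by apply/val_inj/eqP; rewrite /= eqn_leq di -ltnS ltn_ord.
  rewrite (_ : _ @^-1` _ = [set w | Yl w <= u]); first exact: Yl_le.
  by apply/seteqP; split=> w; rewrite /= iE tnth_snoc_last.
rewrite (_ : _ @^-1` _ = Phi @^-1` [set x | tnth x (Ordinal ilt) <= u]).
  rewrite rosenblatt_law//; last exact: measurable_coordinate_le.
  exact: lebesgue_cube_uniform.
by apply/seteqP; split=> w; rewrite /= tnth_snoc_lt.
Qed.

Let linkage_has_cdf : has_cdf_on_cube (linkage A) (law Q mW).
Proof. exact: uniform_margins_has_cdf. Qed.

Lemma linkage_is_copula : is_copula (linkage A).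
Proof. by exists (law Q mW). Qed.

Lemma copula_measure_linkage E : measurable E ->
  copula_measure (linkage A) E =
  Q [set w | E (snoc (Phi w) (tnth w.1 ord_max))].
Proof. by move=> mE; rewrite (copula_measureE linkage_has_cdf mE). Qed.

Lemma linkage_marginal E : measurable E ->
  copula_measure (@marginal R d.+1 d (linkage A)) E = lebesgue_cube d E.
Proof.
move=> mE; rewrite copula_measure_marginal//; last exact: linkage_is_copula.
rewrite copula_measure_linkage; last first.
  by apply: measurable_preimage => //; exact: measurable_first_coords.
rewrite -(rosenblatt_law cA mE); congr (Q _).
by apply/seteqP; split=> w; rewrite /= tnth_snoc_first.
Qed.

Lemma linkage_kernel E F : measurable E -> measurable F ->
  (\int[lebesgue_cube d]_(x in E) markov_kernel (linkage A) x F)%E =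
  Q (Phi @^-1` E `&` Yl @^-1` F).
Proof.
move=> mE mF.
transitivity (\int[copula_measure (@marginal R d.+1 d (linkage A))]_(x in E)
    markov_kernel (linkage A) x F)%E.
  by apply: eq_measure_integral => B mB _; apply: esym; exact: linkage_marginal.
rewrite -(markov_kernelP linkage_is_copula).2// copula_measure_linkage.
  congr (Q _).
  by apply/seteqP; split=> w; rewrite /= tnth_snoc_first tnth_snoc_last.
apply: measurableI.
  by apply: (@measurable_preimage _ _ _ _ (first_coords d) E) => //; exact: measurable_first_coords.
by apply: (@measurable_preimage _ _ _ _ (fun z => tnth z ord_max) F) => //; exact: measurable_tnth.
Qed.

Let mpred : measurable_fun setT (fun w : Om => predictors w.1).
Proof. exact: (measurableT_comp (@measurable_first_coords R d d.+1) measurable_fst). Qed.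

Let mresp : measurable_fun setT response.
Proof. exact: measurable_tnth. Qed.

Let max_advantage_fst y :
  max_advantage Q (fun w : Om => predictors w.1) Yl y = max_advantage mu predictors response y.
Proof.
rewrite /max_advantage; congr ereal_sup; apply: eq_imagel => E mE.
rewrite /advantage; congr (EFin (fine _ - y * fine _)).
  rewrite -Q_fst//; apply: measurableI.
    by apply: measurable_preimage => //; exact: measurable_first_coords.
  exact: measurable_coordinate_le.
by rewrite -Q_fst//; apply: measurable_preimage => //; exact: measurable_first_coords.
Qed.

(* The randomisation is independent of (X, Y), so it does not help to predict Y:
   an event of the transformed predictors is a mixture of events of X. *)
Let max_advantage_rosenblatt_le y : 0 <= y <= 1 ->
  (max_advantage Q Phi Yl y <= max_advantage mu predictors response y)%E.
Proof.
move=> y01; have /andP[y0 y1] := y01.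
have Py : mu [set z | response z <= y] = y%:E by exact: copula_uniform_margins.
have Mfin := max_advantage_fin_num (@measurable_first_coords R d d.+1) mresp Py y01.
have M0 := max_advantage_ge0 mu predictors response y.
set M := max_advantage mu _ _ _ in Mfin M0 *.
apply: ge_ereal_sup => _ [E mE <-].
have mPE : measurable (Phi @^-1` E) by exact: measurable_preimage.
have mYy : measurable [set w | Yl w <= y] by exact: measurable_set_le.
have mPEY : measurable (Phi @^-1` E `&` [set w | Yl w <= y]) by exact: measurableI.
have le1 : (Q (Phi @^-1` E `&` [set w | (Yl w <= y)%R]) <= M + y%:E * Q (Phi @^-1` E))%E.
  rewrite [leLHS]product_probability_ysection//.
  rewrite [X in (_ <= _ + _ * X)%E]product_probability_ysection//.
  have mint (S : set Om) : measurable S ->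
      measurable_fun setT (fun r => mu (ysection S r)).
    by move=> mS; exact: measurable_fun_ysection.
  rewrite -ge0_integralZl//; last exact: mint.
  rewrite -[M]mule1 -(@probability_setT _ _ _ (lebesgue_cube d)) -integral_cst//.
  rewrite -ge0_integralD//; [|by move=> r _; rewrite mule_ge0|]; last first.
    by apply: measurable_funeM; exact: mint.
  apply: ge0_le_integral => //.
  - exact: mint.
  - by apply: emeasurable_funD => //; apply: measurable_funeM; exact: mint.
  move=> r _ /=.
  pose Er := [set x : d.-tuple R | E (rosenblatt A r x)].
  have Er_ysec : ysection (Phi @^-1` E) r = predictors @^-1` Er.
    by apply/seteqP; split=> z; rewrite ysectionE.
  have mEr : measurable Er.
    (* The section at [r] is a measurable set of (d+1)-tuples that ignores the response, so any
       value, here 0, may be filled in to see that [Er] is measurable. *)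
    pose pad (x : d.-tuple R) : d.+1.-tuple R := snoc x 0.
    have mpad : measurable_fun setT pad.
      by apply: measurable_snoc => //; exact: measurable_cst.
    rewrite (_ : Er = pad @^-1` (ysection (Phi @^-1` E) r)).
      by apply: measurable_preimage => //; exact: measurable_ysection.
    rewrite Er_ysec; apply/seteqP; split=> x; by rewrite /= tnth_snoc_first.
  rewrite Er_ysec (_ : ysection _ r = predictors @^-1` Er `&` [set z | response z <= y]); last first.
    by rewrite -Er_ysec; apply/seteqP; split=> z; rewrite !ysectionE.
  have m1 : measurable (predictors @^-1` Er `&` [set z | response z <= y]).
    apply: measurableI; last exact: measurable_coordinate_le.
    by apply: measurable_preimage => //; exact: measurable_first_coords.
  have m2 : measurable (predictors @^-1` Er).
    by apply: measurable_preimage => //; exact: measurable_first_coords.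
  have := advantage_le_max mu predictors response y mEr; rewrite -/M /advantage.
  rewrite (probability_fineK mu m1) (probability_fineK mu m2) -EFinM.
  by rewrite -(fineK Mfin) -EFinD !lee_fin lerBlDr.
rewrite /advantage; move: le1.
rewrite (probability_fineK Q mPEY) (probability_fineK Q mPE) -EFinM.
by rewrite -(fineK Mfin) -EFinD !lee_fin lerBlDr.
Qed.

Lemma max_advantage_rosenblatt y : 0 <= y <= 1 ->
  max_advantage Q Phi Yl y = max_advantage mu predictors response y.
Proof.
move=> y01; apply/eqP; rewrite eq_le max_advantage_rosenblatt_le//=.
rewrite -max_advantage_fst; apply: max_advantage_mono => //.
by move=> E mE; exact: rosenblatt_determines.
Qed.

Lemma integral_linkage_kernel_dev y : 0 <= y <= 1 ->
  (\int[lebesgue_cube d]_x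
     (`|fine (markov_kernel (linkage A) x `[0%R, y]%classic) - y|)%:E =
   2%:E * max_advantage mu predictors response y)%E.
Proof.
move=> y01; have /andP[y0 y1] := y01.
have lawPhi B : measurable B -> lebesgue_cube d B = law Q mPhi B.
  by move=> mB; rewrite -(rosenblatt_law cA mB).
rewrite -max_advantage_rosenblatt//.
transitivity (\int[law Q mPhi]_x
     (`|fine (markov_kernel (linkage A) x `[0%R, y]%classic) - y|)%:E)%E.
  by apply: eq_measure_integral => B mB _; exact: lawPhi.
have mK : measurable_fun setT (fun x => markov_kernel (linkage A) x `[0%R, y]%classic).
  exact: measurable_kernel.
apply: integral_kernel_dev => //.
- exact: (measurableT_comp (@fine_measurable R setT measurableT) mK).
- exact: Yl_le.
move=> E mE.
transitivity (\int[lebesgue_cube d]_(x in E)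
    (fine (markov_kernel (linkage A) x `[0%R, y]%classic))%:E)%E; last first.
  by apply: eq_measure_integral => B mB _; exact: lawPhi.
transitivity (\int[lebesgue_cube d]_(x in E)
    markov_kernel (linkage A) x `[0%R, y]%classic)%E; last first.
  apply: eq_integral => x _.
  exact: (probability_fineK (kernel_at (markov_kernel (linkage A)) x)).
rewrite linkage_kernel//.
(* The kernel is evaluated on [0, y], the advantage on {Yl <= y}; they match because the response is
   almost surely non-negative. *)
have mge0 : measurable [set w | 0 <= Yl w].
  by apply: measurable_set_lef => //; exact: measurable_cst.
have Qge0 : Q [set w | 0 <= Yl w] = 1%E.
  rewrite (_ : [set w | _] = fst @^-1` [set z | 0 <= tnth z ord_max])// Q_fst; last first.
    by apply: measurable_set_lef; [exact: measurable_cst|exact: measurable_tnth].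
  have mo : measurable [set z : d.+1.-tuple R | 0 <= tnth z ord_max].
    by apply: measurable_set_lef; [exact: measurable_cst|exact: measurable_tnth].
  apply: (probability_negligible_setC mo).
  apply: (@negligibleS _ _ _ _ [set z : d.+1.-tuple R | tnth z ord_max <= 0]).
    by move=> z /= /negP; rewrite -ltNge => /ltW.
  apply/negligibleP; first exact: measurable_coordinate_le.
  by apply: (@copula_uniform_margins R _ A cA ord_max 0); rewrite lexx ler01.
have m1 : measurable (Phi @^-1` E `&` [set w | Yl w <= y]).
  by apply: measurableI; [exact: measurable_preimage|exact: measurable_set_le].
have m2 : measurable (Phi @^-1` E `&` Yl @^-1` `[0, y]%classic).
  by apply: measurableI; exact: measurable_preimage.
apply: etrans (esym (probability1I mge0 m1 Qge0)) _.
apply: etrans _ (probability1I mge0 m2 Qge0).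
congr (Q _); apply/seteqP; split=> w /=; rewrite in_itv /=.
  by move=> [[? ?] Y0]; rewrite Y0.
by move=> [[? /andP[? ?]] ?].
Qed.

End one_copula.

Lemma max_advantage_Pi (d : nat) y : 0 <= y <= 1 ->
  max_advantage (copula_measure (@Pi_copula R d.+1)) (@first_coords R d d.+1)
    (fun z => tnth z ord_max) y = 0%E.
Proof.
move=> y01.
have adv0 E : measurable E -> advantage (copula_measure (@Pi_copula R d.+1))
    (@first_coords R d d.+1) (fun z => tnth z ord_max) y E = 0.
  move=> mE; rewrite /advantage.
  have mo : measurable [set v : R | v <= y].
    by apply: (@measurable_set_le R _ R id); exact: measurable_id.
  have mpE : measurable (@first_coords R d d.+1 @^-1` E).
    by apply: measurable_preimage => //; exact: measurable_first_coords.
  rewrite !copula_measure_Pi//; last first.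
    by apply: measurableI => //; exact: measurable_coordinate_le.
  rewrite lebesgue_cube_first_coords//.
  rewrite [X in fine X - _](lebesgue_cube_snoc mE mo) unif01_le//.
  by rewrite (probability_fineK (lebesgue_cube d) mE) -EFinM /= mulrC subrr.
apply/eqP; rewrite eq_le max_advantage_ge0 andbT.
by apply: ge_ereal_sup => _ [E mE <-]; rewrite adv0.
Qed.

(** The linkage of the product copula is never computed: its maximal advantage is 0, so by the
    formula just proved the kernel has mean deviation 0 from [y]. *)
Lemma linkage_Pi_kernel (d : nat) y : 0 <= y <= 1 ->
  \forall x \ae lebesgue_cube d,
    fine (markov_kernel (linkage (@Pi_copula R d.+1)) x `[0%R, y]%classic) = y.
Proof.
move=> y01; have := integral_linkage_kernel_dev (@Pi_is_copula R d.+1) y01.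
rewrite max_advantage_Pi// mule0.
pose k (x : d.-tuple R) : R :=
  fine (markov_kernel (linkage (@Pi_copula R d.+1)) x `[0%R, y]%classic).
have mk : measurable_fun setT k.
  apply: (@measurableT_comp _ _ _ _ _ _ (@fine R) _ (fun x =>
    markov_kernel (linkage (@Pi_copula R d.+1)) x `[0%R, y]%classic)).
    exact: fine_measurable.
  exact: measurable_kernel.
move=> int0.
have : ae_eq (lebesgue_cube d) setT (fun x => (k x - y)%:E) (cst 0%E).
  apply/ae_eq_integral_abs => //.
  by apply/measurable_EFinP/measurable_funB.
by apply: filterS => x /(_ Logic.I) [] /eqP; rewrite subr_eq0 => /eqP.
Qed.

Theorem zeta1E (d : nat) (A : d.+1.-tuple R -> R) : is_copula A ->
  zeta1 A = (3%:E * \int[lebesgue_measure]_(y in `[0%R, 1%R])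
    (2%:E * max_advantage (copula_measure A) (@first_coords R d d.+1)
       (fun z => tnth z ord_max) y))%E.
Proof.
move=> cA; rewrite /zeta1 /D1; congr (_ * _)%E.
apply: eq_integral => y; rewrite inE /= in_itv /= => y01.
rewrite -integral_linkage_kernel_dev//.
have mK C : measurable_fun setT (fun x : d.-tuple R => markov_kernel C x `[0%R, y]%classic).
  exact: measurable_kernel.
have KE C x : markov_kernel C x `[0%R, y]%classic =
    (fine (markov_kernel C x `[0%R, y]%classic))%:E :> \bar R.
  exact: (probability_fineK (kernel_at (markov_kernel C) x)).
apply: ae_eq_integral => //.
- apply: measurableT_comp => //; apply: emeasurable_funB; exact: mK.
- apply/measurable_EFinP/measurableT_comp => //; apply: measurable_funB => //.
  exact: (measurableT_comp (@fine_measurable R setT measurableT) (mK _)).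
apply: filterS (linkage_Pi_kernel d y01) => x kx _.
have dist_fine (a b : \bar R) : a = (fine a)%:E -> b = y%:E ->
    `|a - b|%E = (`|fine a - y|)%:E by move=> -> ->.
exact: dist_fine (KE _ (linkage A) x) (etrans (KE _ _ x) (congr1 EFin kx)).
Qed.

End linkage_formula.

(** * The probability integral transform of an atomless variable *)

Section continuous_cdf.
Context {R : realType} d (T : measurableType d) (P : probability T R).
Variables (Y : T -> R) (mY : measurable_fun setT Y).
Hypothesis Y_atomless : forall a, P [set t | Y t = a] = 0%E.

(** [marginal_cdf P Z i] is convertible to [cdf_of] of the i-th coordinate, so what follows applies
    to margins as well. *)
Definition cdf_of (a : R) : R := fine (P [set t | Y t <= a]).

Let mle a : measurable [set t | Y t <= a]. Proof. exact: measurable_set_le. Qed.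

Lemma cdf_ofE a : P [set t | Y t <= a] = (cdf_of a)%:E.
Proof. exact: probability_fineK. Qed.

Lemma cdf_of_le a b : a <= b -> cdf_of a <= cdf_of b.
Proof.
move=> ab; rewrite -lee_fin -!cdf_ofE; apply: le_measure; rewrite ?inE//.
by move=> t /= /le_trans; apply.
Qed.

Lemma cdf_of_01 a : 0 <= cdf_of a <= 1.
Proof. by rewrite fine_ge0//= -lee_fin -cdf_ofE probability_le1. Qed.

Lemma measurable_cdf_of : measurable_fun setT cdf_of.
Proof. by apply: nondecreasing_measurable => // x y; exact: cdf_of_le. Qed.

Let small_measure (S : (set T)^nat) e : (forall n, measurable (S n)) ->
  nonincreasing_seq S -> \bigcap_n S n = set0 -> 0 < e ->
  exists n, fine (P (S n)) < e.
Proof.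
move=> mS niS S0 e0; apply: contrapT => /forallNP h.
have S0oo : (P (S 0%N) < +oo)%E by rewrite (le_lt_trans (probability_le1 P (mS 0%N))) ?ltry.
have mcap : measurable (\bigcap_n S n) by exact: bigcapT_measurable.
have cv := nonincreasing_cvg_mu (mu := P) S0oo mS mcap niS.
have : (e%:E <= P (\bigcap_n S n))%E.
  rewrite -(cvg_lim _ cv)//; apply: lime_ge; first exact: cvgP cv.
  apply: nearW => n /=; rewrite (probability_fineK P (mS n)) lee_fin leNgt.
  exact/negP/h.
by rewrite S0 measure0 lee_fin leNgt e0.
Qed.

(** An intermediate value argument at the supremum of {F <= u}. Continuity from the right holds for
    every distribution function; continuity from the left uses that there is no atom at the
    supremum. *)
Lemma cdf_of_surj u : 0 < u < 1 -> exists a, cdf_of a = u.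
Proof.
move=> /andP[u0 u1]; pose S := [set x | cdf_of x <= u].
have [n0 hn0] : exists n, cdf_of (- n%:R) < u.
  apply: (small_measure (S := fun n => [set t | Y t <= - n%:R])) => //.
    by move=> i j ij; apply/subsetPset => t /= /le_trans; apply; rewrite lerN2 ler_nat.
  apply/seteqP; split=> t //= h; have := h (Num.truncn `|Y t|).+1 Logic.I; rewrite /= lerNr.
  by rewrite leNgt (le_lt_trans (ler_norm _))// normrN truncnS_gt.
have [n1 hn1] : exists n, u < cdf_of n%:R.
  have u1' : 0 < 1 - u by rewrite subr_gt0.
  have [|||n hn] := small_measure (S := fun n => ~` [set t | Y t <= n%:R]) _ _ _ u1'.
  - by move=> n; exact: measurableC.
  - by move=> i j ij; apply/subsetPset => t /=; apply: contra_not => /le_trans; apply; rewrite ler_nat.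
  - apply/seteqP; split=> t //= h; apply: (h (Num.truncn `|Y t|).+1 Logic.I).
    by rewrite /= ltW// (le_lt_trans (ler_norm _))// truncnS_gt.
  by exists n; move: hn; rewrite probability_setC// cdf_ofE -EFinD /= ltrD2l ltrN2.
have S0 : S (- n0%:R) by rewrite /S /= ltW.
have ubS : ubound S n1%:R.
  move=> x /= Sx; rewrite leNgt; apply/negP => n1x.
  by have := lt_le_trans hn1 (le_trans (cdf_of_le (ltW n1x)) Sx); rewrite ltxx.
have hasS : has_sup S by split; [exists (- n0%:R)|exists n1%:R].
exists (sup S); apply/eqP; rewrite eq_le; apply/andP; split.
- have -> : cdf_of (sup S) = fine (P (\bigcup_n [set t | Y t <= sup S - n.+1%:R^-1])).
    have mb : measurable (\bigcup_n [set t | Y t <= sup S - n.+1%:R^-1]).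
      exact: bigcupT_measurable.
    apply: EFin_inj; rewrite -cdf_ofE -probability_fineK//.
    apply: negligible_setY_measure => //.
    apply: (@negligibleS _ _ _ _ [set t | Y t = sup S]); last first.
      apply/negligibleP; last exact: Y_atomless.
      by apply: (@measurable_preimage _ _ _ _ Y [set sup S]) => //; exact: measurable_set1.
    move=> t /= [[Yt nb]|[[n _ /= Yt] nS]].
      apply/eqP; rewrite eq_le Yt/= leNgt; apply/negP => Ylt; rewrite -subr_gt0 in Ylt.
      have [n _ /(_ n (leqnn n)) na] := near_infty_natSinv_lt (PosNum Ylt).
      by apply: nb; exists n => //=; rewrite lerBrDr -lerBrDl ltW.
    by exfalso; apply: nS; rewrite (le_trans Yt)// gerBl.
  have mb n : measurable [set t | Y t <= sup S - n.+1%:R^-1] by [].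
  have nd : nondecreasing_seq (fun n => [set t | Y t <= sup S - n.+1%:R^-1]).
    move=> i j ij; apply/subsetPset => t /= /le_trans; apply.
    by rewrite lerB// lef_pV2 ?posrE// ler_nat.
  have cv := nondecreasing_cvg_mu (mu := P) mb (bigcupT_measurable _ mb) nd.
  rewrite -lee_fin -probability_fineK; last exact: bigcupT_measurable.
  rewrite -(cvg_lim _ cv)//; apply: lime_le; first exact: cvgP cv.
  apply: nearW => n /=; rewrite cdf_ofE lee_fin.
  have : sup S - n.+1%:R^-1 < sup S by rewrite ltrBlDr ltrDl.
  move=> /sup_gt[|x Sx xS]; first by exists (- n0%:R).
  exact: le_trans (cdf_of_le (ltW xS)) Sx.
- have mb n : measurable [set t | Y t <= sup S + n.+1%:R^-1] by [].
  have ni : nonincreasing_seq (fun n => [set t | Y t <= sup S + n.+1%:R^-1]).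
    move=> i j ij; apply/subsetPset => t /= /le_trans; apply.
    by rewrite lerD2l lef_pV2 ?posrE// ler_nat.
  have P0 : (P [set t | Y t <= sup S + 1%:R^-1]%R < +oo)%E by rewrite cdf_ofE ltry.
  have cv := nonincreasing_cvg_mu (mu := P) P0 mb (bigcapT_measurable mb) ni.
  rewrite -lee_fin -cdf_ofE.
  have -> : [set t | Y t <= sup S] = \bigcap_n [set t | Y t <= sup S + n.+1%:R^-1].
    apply/seteqP; split=> t /=.
      by move=> Yt n _ /=; rewrite (le_trans Yt)// lerDl.
    move=> h; rewrite leNgt; apply/negP => ax; rewrite -subr_gt0 in ax.
    have [n _ /(_ n (leqnn n)) na] := near_infty_natSinv_lt (PosNum ax).
    have := h n Logic.I; rewrite /= leNgt => /negP; apply.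
    by rewrite -ltrBrDl.
  rewrite -(cvg_lim _ cv)//; apply: lime_ge; first exact: cvgP cv.
  apply: nearW => n /=; rewrite cdf_ofE lee_fin leNgt; apply/negP => /ltW hS.
  have : sup S + n.+1%:R^-1 <= sup S by apply: sup_upper_bound.
  by rewrite gerDl leNgt invr_gt0 ltr0n.
Qed.

Let mVle u : measurable [set t | cdf_of (Y t) <= u].
Proof.
by apply: measurable_set_le; exact: (measurableT_comp measurable_cdf_of mY).
Qed.

Let V_lt u : 0 < u < 1 -> (P (~` [set t | (u <= cdf_of (Y t))%R]) <= u%:E)%E.
Proof.
move=> u01; have [a aE] := cdf_of_surj u01; rewrite -aE -cdf_ofE.
apply: le_measure; rewrite ?inE//.
  apply: measurableC; apply: measurable_set_lef; first exact: measurable_cst.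
  exact: (measurableT_comp measurable_cdf_of mY).
move=> t /= /negP; rewrite -ltNge => Yu; rewrite leNgt; apply/negP => aY.
by have := lt_le_trans Yu (cdf_of_le (ltW aY)); rewrite ltxx.
Qed.

Lemma cdf_of_uniform u : 0 <= u <= 1 -> P [set t | cdf_of (Y t) <= u] = u%:E.
Proof.
move=> /andP[u0 u1].
set p := fine (P [set t | cdf_of (Y t) <= u]).
have pE : P [set t | cdf_of (Y t) <= u] = p%:E by rewrite -probability_fineK.
have p0 : 0 <= p by exact: fine_ge0.
have p1 : p <= 1 by rewrite -lee_fin -pE probability_le1.
rewrite pE; congr EFin; apply/eqP; rewrite eq_le; apply/andP; split.
  rewrite leNgt; apply/negP => up; pose u' := (u + p) / 2.
  have u'01 : 0 < u' < 1 by rewrite /u'; lra.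
  have : p <= u'.
    rewrite -lee_fin -pE; apply: le_trans (V_lt u'01).
    apply: le_measure; rewrite ?inE//.
      apply: measurableC; apply: measurable_set_lef; first exact: measurable_cst.
      exact: (measurableT_comp measurable_cdf_of mY).
    by move=> t /= Vu /(le_trans) /(_ Vu); rewrite /u'; lra.
  by rewrite /u'; lra.
move: u0; rewrite [0 <= u]le_eqVlt => /orP[/eqP <- //|u0].
move: u1; rewrite [u <= 1]le_eqVlt => /orP[/eqP u1|u1].
  rewrite -lee_fin -pE (_ : [set t | _] = setT) ?probability_setT ?u1//.
  by apply/seteqP; split=> t //= _; have /andP[] := cdf_of_01 (Y t).
have [a aE] : exists a, cdf_of a = u by apply: cdf_of_surj; rewrite u0.
rewrite -lee_fin -pE -[X in (X%:E <= _)%E]aE -cdf_ofE.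
apply: le_measure; rewrite ?inE// => t /= Ya.
by rewrite -aE; exact: cdf_of_le.
Qed.

(** Inclusion and equal probability [cdf_of a]. Hence Y and its transform determine the same events
    up to null sets, even where the distribution function is flat. *)
Lemma cdf_of_le_ae a :
  P.-negligible ([set t | Y t <= a] `+` [set t | cdf_of (Y t) <= cdf_of a]).
Proof.
apply: (negligible_setY_eq (G := setT)) => //.
- exact: probability_setT.
- by move=> t /= [Ya _]; exact: cdf_of_le.
- by rewrite cdf_of_uniform ?cdf_of_01// cdf_ofE.
Qed.

Lemma cdf_of_dense u e : 0 <= u <= 1 -> 0 < e -> exists a, `|cdf_of a - u| <= e.
Proof.
move=> /andP[u0 u1] e0; pose s := Num.min e 2^-1.
have s0 : 0 < s by rewrite lt_min e0 invr_gt0 ltr0n.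
have se : s <= e by rewrite ge_min lexx.
have s1 : s <= 2^-1 by rewrite ge_min lexx orbT.
(* The values 0 and 1 need not be attained, so [u] is moved towards 1/2 into the open interval, by
   at most [s <= e]. *)
have [a aE] : exists a, cdf_of a = u * (1 - s) + s / 2.
  by apply: cdf_of_surj; nra.
exists a; rewrite aE.
have -> : u * (1 - s) + s / 2 - u = s * (2^-1 - u) by ring.
rewrite normrM (gtr0_norm s0); apply: le_trans se.
apply: ler_piMr; first exact: ltW.
by rewrite ler_norml; lra.
Qed.

End continuous_cdf.

(** * Existence and uniqueness of the copula of a random vector with atomless margins *)

Section random_vector_copula.
Context {R : realType} dT (T : measurableType dT) (P : probability T R).

(** Copulas are Lipschitz: what the first orthant has in excess is covered by n slabs, one per
    coordinate, each of mass at most [e] by the uniform margin. *)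
Lemma orthant_le_uniform_margins (n : nat) (m : probability (n.-tuple R) R)
    (u v : n.-tuple R) (e : R) :
  uniform_margins m -> cube n u -> cube n v ->
  (forall i, tnth u i <= tnth v i + e) -> 0 <= e ->
  fine (m (lower_orthant u)) <= fine (m (lower_orthant v)) + n%:R * e.
Proof.
move=> mU uc vc uv e0.
pose S (i : 'I_n) := [set z : n.-tuple R | tnth z i <= tnth u i] `\` [set z | tnth z i <= tnth v i].
have mS i : measurable (S i) by apply: measurableD; exact: measurable_coordinate_le.
have Se i : (m (S i) <= e%:E)%E.
  have [uvi|vui] := leP (tnth u i) (tnth v i).
    rewrite (_ : S i = set0) ?measure0 ?lee_fin//.
    by apply/seteqP; split=> z //= [/le_trans/(_ uvi)].
  have -> : m (S i) = (m [set z | (tnth z i <= tnth u i)%R] -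
                      m [set z | (tnth z i <= tnth v i)%R])%E.
    rewrite [LHS]measureD//=; [|exact: measurable_coordinate_le|exact: measurable_coordinate_le|].
      congr (_ - m _)%E; apply/seteqP; split=> z //= [] // zv; split => //.
      by rewrite (le_trans zv)// ltW.
    by rewrite (mU i _ (uc i)) ltry.
  rewrite (mU i _ (uc i)) (mU i _ (vc i)) -EFinD lee_fin lerBlDl.
  exact: uv.
have mo w : measurable (lower_orthant w : set (n.-tuple R)) by exact: measurable_lower_orthant.
pose B (k : nat) : set (n.-tuple R) := if insub k is Some i then S i else set0.
have mB k : measurable (B k) by rewrite /B; case: insubP => [i _ _|_].
have sub : lower_orthant u `\` lower_orthant v `<=` \big[setU/set0]_(k < n) B k.
  move=> z [zu /existsNP[i zv]]; rewrite -bigcup_mkord; exists i => //=.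
  by rewrite /B valK; split; [exact: zu|].
have mDuv : measurable (lower_orthant u `\` lower_orthant v) by exact: measurableD.
have le1 : (m (lower_orthant u `\` lower_orthant v) <= (n%:R * e)%:E)%E.
  apply: (le_trans (content_subadditive m (fun k _ => mB k) mDuv sub)) => //.
  rewrite (@le_trans _ _ (\sum_(k < n) e%:E)%E)//.
    by apply: lee_sum => k _; rewrite /B valK; exact: Se.
  by rewrite sumEFin sumr_const card_ord mulr_natl.
rewrite -lee_fin EFinD -!probability_fineK//.
rewrite [leLHS](measureDI m (mo u) (mo v)) addeC.
by apply: leeD => //; apply: le_measure; rewrite ?inE//; exact: measurableI.
Qed.

Variables (n : nat) (Z : T -> n.-tuple R) (mZ : measurable_fun setT Z).
Hypothesis Z_atomless : forall i a, P [set t | tnth (Z t) i = a] = 0%E.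

Let mZi i : measurable_fun setT (fun t => tnth (Z t) i).
Proof. exact: (measurableT_comp (@measurable_tnth _ R n i) mZ). Qed.

Definition margin_transform (x : n.-tuple R) : n.-tuple R :=
  [tuple marginal_cdf P Z i (tnth x i) | i < n].

Lemma measurable_margin_transform : measurable_fun setT margin_transform.
Proof.
apply/measurable_fun_tnthP => i.
rewrite (_ : _ \o _ = fun x => marginal_cdf P Z i (tnth x i)); last first.
  by apply/funext => x; rewrite /= tnth_mktuple.
exact: (measurableT_comp (measurable_cdf_of P (mZi i)) (@measurable_tnth _ R n i)).
Qed.

Let U t := margin_transform (Z t).

Let mU : measurable_fun setT U.
Proof. exact: (measurableT_comp measurable_margin_transform mZ). Qed.

Let U_uniform : uniform_margins (law P mU).
Proof.
move=> i u u01; rewrite [LHS]lawE -(cdf_of_uniform (mZi i) (Z_atomless i) u01).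
by congr (P _); apply/seteqP; split=> t /=; rewrite tnth_mktuple.
Qed.

Let orthant_transform x :
  P [set t | lower_orthant x (Z t)] =
  P [set t | lower_orthant (margin_transform x) (U t)].
Proof.
have mx y (f : T -> n.-tuple R) : measurable_fun setT f ->
    measurable [set t | lower_orthant y (f t)].
  move=> mf; apply: (@measurable_preimage _ _ _ _ f (lower_orthant y)) => //.
  exact: measurable_lower_orthant.
apply: negligible_setY_measure; [exact: mx|exact: mx|].
pose N (k : nat) := if insub k is Some i then
  [set t | tnth (Z t) i <= tnth x i] `+`
  [set t | marginal_cdf P Z i (tnth (Z t) i) <= marginal_cdf P Z i (tnth x i)] else set0.
apply: (@negligibleS _ _ _ _ (\bigcup_k N k)); last first.
  apply: negligible_bigcup => k; rewrite /N; case: insubP => [i _ _|_]; last exact: negligible_set0.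
  exact: (cdf_of_le_ae (mZi i) (Z_atomless i)).
move=> t [[/= Zx /existsNP[i]]|[/= Ux /existsNP[i]]].
  rewrite !tnth_mktuple => nU; exists i => //; rewrite /N valK; left; split => //.
  exact: Zx.
move=> nZ; exists i => //; rewrite /N valK; right; split => //=.
by have := Ux i; rewrite !tnth_mktuple.
Qed.

(** Existence in Sklar's theorem: the law of the vector of transformed margins is a copula of
    [Z]. *)
Lemma is_copula_of_law : is_copula_of P Z (fun x => fine (law P mU (lower_orthant x))).
Proof.
split; last by move=> x; rewrite /joint_cdf orthant_transform.
by exists (law P mU) => //; exact: uniform_margins_has_cdf.
Qed.

(** Uniqueness in Sklar's theorem: Sklar's relation fixes [C] at points [v] whose coordinates are
    values of the margins. These approximate every point of the cube, and both distribution
    functions are Lipschitz. *)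
Lemma is_copula_of_has_cdf C : is_copula_of P Z C -> has_cdf_on_cube C (law P mU).
Proof.
move=> [cC CZ]; split; first exact: uniform_margins_cube.
move=> u uc; have [_ CE] := copula_measureP cC.
have muU := copula_uniform_margins cC.
rewrite -CE// [LHS]probability_fineK; last exact: measurable_lower_orthant.
rewrite [RHS]probability_fineK; last exact: measurable_lower_orthant.
congr EFin; apply/eqP; rewrite -subr_eq0 -normr_le0; apply/ler_addgt0Pr => e e0.
rewrite add0r.
(* Passing from [u] to [v] costs n e' for each of the two measures; [n.+1] covers n = 0. *)
pose e' := e / (2 * n.+1%:R).
have e'0 : 0 < e' by rewrite divr_gt0// mulr_gt0.
have ne' : 2 * (n%:R * e') <= e.
  have -> : 2 * (n%:R * e') = e * (n%:R / n.+1%:R).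
    by rewrite /e'; field; apply/negP => /eqP; have := ler0n R n; lra.
  apply: ler_piMr; first exact: ltW.
  by rewrite ler_pdivrMr// mul1r ler_nat.
have [x xE] := choice (fun i => cdf_of_dense (mZi i) (Z_atomless i) (uc i) e'0).
pose v := margin_transform [tuple x i | i < n].
have vE i : tnth v i = cdf_of P (fun t => tnth (Z t) i) (x i).
  by rewrite /v /margin_transform !tnth_mktuple.
have vc : cube n v by move=> i; rewrite vE; exact: cdf_of_01.
have uv i : tnth u i <= tnth v i + e'.
  by have := xE i; rewrite -vE ler_distlC => /andP[]; rewrite lerBlDr.
have vu i : tnth v i <= tnth u i + e'.
  by have := xE i; rewrite -vE ler_distl => /andP[].
have eqv : fine (copula_measure C (lower_orthant v)) = fine (law P mU (lower_orthant v)).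
  by rewrite CE//= -(CZ [tuple x i | i < n]) /joint_cdf orthant_transform.
have h1 := orthant_le_uniform_margins muU uc vc uv (ltW e'0).
have h2 := orthant_le_uniform_margins muU vc uc vu (ltW e'0).
have h3 := orthant_le_uniform_margins U_uniform uc vc uv (ltW e'0).
have h4 := orthant_le_uniform_margins U_uniform vc uc vu (ltW e'0).
rewrite ler_norml; move: h1 h2 h3 h4 ne'; rewrite eqv.
set a1 := fine _; set a2 := fine _; set a3 := fine _; lra.
Qed.

Lemma copula_of_measure C E : is_copula_of P Z C -> measurable E ->
  copula_measure C E = P [set t | E (margin_transform (Z t))].
Proof. by move=> CZ mE; rewrite (copula_measureE (is_copula_of_has_cdf CZ) mE). Qed.

Lemma is_copula_of_copula_of : is_copula_of P Z (copula_of P Z).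
Proof. by apply: getPex; eexists; exact: is_copula_of_law. Qed.

End random_vector_copula.

Section continuous_joint_cdf.
Context {R : realType} dT (T : measurableType dT) (P : probability T R).

(** With the other coordinates bounded by N, the mass on Z_i = a is at most the drop of the joint
    distribution function when the i-th argument moves slightly below a. Continuity makes it 0, and
    N runs through the naturals. *)
Lemma continuous_cdf_atomless (n : nat) (Z : T -> n.-tuple R) :
  measurable_fun setT Z -> continuous_cdf P Z ->
  forall i a, P [set t | tnth (Z t) i = a] = 0%E.
Proof.
move=> mZ cZ i a.
have mZi j : measurable_fun setT (fun t => tnth (Z t) j).
  exact: (measurableT_comp (@measurable_tnth _ R n j) mZ).
have mo x : measurable [set t | lower_orthant x (Z t)].
  apply: (@measurable_preimage _ _ _ _ Z (lower_orthant x)) => //.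
  exact: measurable_lower_orthant.
have mia : measurable [set t | tnth (Z t) i = a].
  by apply: (@measurable_preimage _ _ _ _ (fun t => tnth (Z t) i) [set a]) => //; exact: measurable_set1.
apply: measure_negligible => //.
pose x (N : nat) (b : R) : n.-tuple R := [tuple if j == i then b else N%:R | j < n].
apply: (@negligibleS _ _ _ _ (\bigcup_N ([set t | tnth (Z t) i = a] `&`
    [set t | lower_orthant (x N a) (Z t)]))).
  move=> t /= Zia.
  have : [set z : n.-tuple R | tnth z i <= a] (Z t) by rewrite /= Zia.
  by rewrite coordinate_le_bigcup => -[N _ h]; exists N.
apply: negligible_bigcup => N.
have mB : measurable ([set t | tnth (Z t) i = a] `&` [set t | lower_orthant (x N a) (Z t)]).
  exact: measurableI.
apply/negligibleP => //.
set B := _ `&` _ in mB *.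
rewrite [LHS]probability_fineK//; congr EFin; apply/eqP; rewrite eq_le fine_ge0// andbT.
rewrite leNgt; apply/negP => c0; set c := fine _ in c0.
pose v b : 'rV[R]_n := \row_j tnth (x N b) j.
have vE b : [tuple v b ord0 j | j < n] = x N b.
  by apply: eq_from_tnth => j; rewrite tnth_mktuple mxE.
have := cZ (v a); rewrite /continuous_at => /cvgrPdist_lt /(_ c c0).
move=> /nbhs_ballP[e e0 he].
have ball_v : ball (v a) e (v (a - e / 2)).
  split=> // j k; rewrite !mxE !tnth_mktuple; case: eqP => _; last exact: ballxx.
  rewrite /ball /= opprB addrC subrK ger0_norm ?divr_ge0 ?ltW//.
  by rewrite ltr_pdivrMr// ltr_pMr// ltr1n.
have := he _ ball_v; rewrite !vE /joint_cdf.
set h1 := fine _; set h2 := fine _.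
suff : h2 + c <= h1 by move=> h; rewrite ltr_norml; lra.
rewrite -lee_fin EFinD /h1 /h2 /c -!probability_fineK//.
rewrite -[leLHS]measureU//; last first.
  apply/seteqP; split=> t //= [] /(_ i) + [Zia _].
  by rewrite tnth_mktuple eqxx Zia => h; exfalso; move: h; rewrite leNgt ltrBlDr ltrDl divr_gt0.
apply: le_measure; rewrite ?inE//; first exact: measurableU.
move=> t [/= h j|[_ //]]; have := h j; rewrite !tnth_mktuple; case: eqP => // _.
by move=> /le_trans; apply; rewrite gerBl divr_ge0 ?ltW.
Qed.

End continuous_joint_cdf.

(** * Lipschitz functions on [0,1] and their integrals *)

Section unit_interval_integrals.
Context {R : realType}.
Local Notation leb := (@lebesgue_measure R).

Definition clamp01 (y : R) : R := Num.max 0 (Num.min y 1).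

Lemma clamp01_itv y : 0 <= clamp01 y <= 1.
Proof. by rewrite /clamp01 le_max lexx/= ge_max ler01 ge_min lexx orbT. Qed.

Lemma clamp01_id y : 0 <= y <= 1 -> clamp01 y = y.
Proof. by move=> /andP[y0 y1]; rewrite /clamp01 (min_idPl y1) (max_idPr y0). Qed.

Lemma clamp01_dist a b : `|clamp01 a - clamp01 b| <= `|a - b|.
Proof.
wlog ab : a b / a <= b.
  move=> h; have [ab|/ltW ba] := leP a b; first exact: h.
  by rewrite distrC [leRHS]distrC; exact: h.
rewrite distrC [leRHS]distrC (ger0_norm (x := b - a)) ?subr_ge0//.
have clampE c : clamp01 c = if c <= 0 then 0 else if c <= 1 then c else 1.
  rewrite /clamp01; have [c1|c1] := leP c 1; last by rewrite max_r// leNgt (lt_trans ltr01 c1).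
  by have [c0|c0] := leP c 0.
rewrite !clampE ler_norml.
have [a0|a0] := leP a 0; have [b0|b0] := leP b 0;
  have [a1|a1] := leP a 1; have [b1|b1] := leP b 1; lra.
Qed.

Definition lipschitz_le (L : R) (g : R -> R) : Prop :=
  forall a b, `|g a - g b| <= L * `|a - b|.

Lemma lipschitz_le_continuous L g : lipschitz_le L g -> continuous g.
Proof.
move=> hg x; apply/cvgrPdist_lt => e e0.
have L1 : 0 < `|L| + 1 by rewrite ltr_pwDr.
near=> z; apply: (le_lt_trans (hg x z)).
apply: (@le_lt_trans _ _ ((`|L| + 1) * `|x - z|)).
  by rewrite ler_wpM2r// (le_trans (ler_norm _))// lerDl.
rewrite mulrC -ltr_pdivlMr//; near: z.
by apply: cvgr_dist_lt => //; rewrite divr_gt0.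
Unshelve. all: by end_near. Qed.

Lemma continuous_measurable_EFin (g : R -> R) (D : set (measurableTypeR R)) :
  continuous g -> @measurable_fun _ _ (measurableTypeR R) _ D (fun y => (g y)%:E).
Proof.
move=> cg; apply: measurable_funTS; apply/measurable_EFinP.
exact: (continuous_measurable_fun cg).
Qed.

Lemma lipschitz_le_integral0 (L : R) (g : R -> R) : 0 < L -> lipschitz_le L g ->
  (forall y, 0 <= g y) ->
  (\int[leb]_(y in `[0%R, 1%R]) (g y)%:E = 0)%E -> forall y, 0 <= y <= 1 -> g y = 0.
Proof.
move=> L0 hg g0 intg y /andP[y0 y1].
apply/eqP; rewrite eq_le g0 andbT leNgt; apply/negP => gy.
(* The first bound keeps g >= g y / 2 within distance [e] of [y]; the second lets an interval of
   length [e] ending or starting at [y] fit into [0,1], on the side of the midpoint. *)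
pose e := Num.min (g y / (2 * L)) 2^-1.
have e0 : 0 < e by rewrite lt_min divr_gt0 ?mulr_gt0//= invr_gt0.
have e2 : e <= 2^-1 by rewrite ge_min lexx orbT.
have eg : L * e <= g y / 2.
  have : e <= g y / (2 * L) by rewrite ge_min lexx.
  have -> : g y / 2 = L * (g y / (2 * L)) by field; rewrite gt_eqF.
  by rewrite ler_pM2l.
have [a [b [ab ab01 aby]]] : exists a b, [/\ b = a + e, 0 <= a /\ b <= 1 &
    forall z, a <= z <= b -> `|y - z| <= e].
  have [y2|y2] := leP y 2^-1.
    exists y, (y + e); split => //; first by split => //; lra.
    by move=> z /andP[yz zy]; rewrite ler_norml; lra.
  exists (y - e), y; split; [by rewrite subrK|by split; lra|].
  by move=> z /andP[yz zy]; rewrite ler_norml; lra.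
have gz z : a <= z <= b -> g y / 2 <= g z.
  move=> /aby yz; have := hg y z.
  have : L * `|y - z| <= L * e by rewrite ler_wpM2l// ltW.
  by move=> h1 /le_trans /(_ h1); rewrite ler_norml => /andP[_]; lra.
have mg D := @continuous_measurable_EFin g D (lipschitz_le_continuous hg).
have : ((g y / 2)%:E * e%:E <= \int[leb]_(y in `[0%R, 1%R]) (g y)%:E)%E.
  have -> : e%:E = leb `[a, b]%classic.
    by rewrite lebesgue_measure_itv /= lte_fin ab ltrDl e0 -EFinB addrAC subrr add0r.
  rewrite -integral_cst//.
  apply: (@le_trans _ _ (\int[leb]_(z in `[a, b]) (g z)%:E)%E).
    apply: ge0_le_integral => //.
    - by move=> z _; rewrite /= lee_fin divr_ge0// ltW.
  apply: ge0_subset_integral => //.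
    by move=> z _; rewrite lee_fin.
  by move=> z /=; rewrite !in_itv /= => /andP[az zb]; case: ab01; lra.
rewrite intg -EFinM lee_fin leNgt => /negP; apply.
by rewrite mulr_gt0// divr_gt0.
Qed.

(** The beta integral B(2,2) = 1! 1! / 3!. *)
Lemma integral_variance01 :
  (\int[leb]_(y in `[0%R, 1%R]) (y * (1 - y))%:E = (6^-1)%:E)%E.
Proof.
have <- : beta_fun 2 2 = 6^-1 :> R by rewrite (@beta_fun_fact R 1 1) mul1r.
rewrite EFin_beta_fun [LHS]integral_mkcond; apply: eq_integral => x _.
by rewrite !patchE; case: ifP => //= _; rewrite /XMonemX /= !expr1.
Qed.

End unit_interval_integrals.

(** * The integrated advantage: range, extreme values and reflection *)

Section integrated_advantage.
Context {R : realType} d d1 (T : measurableType d) (T1 : measurableType d1).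
Variables (P : probability T R) (X : T -> T1) (V : T -> R).
Hypotheses (mX : measurable_fun setT X) (mV : measurable_fun setT V).
Hypothesis V_uniform : forall y, 0 <= y <= 1 -> P [set t | V t <= y] = y%:E.
Local Notation leb := (@lebesgue_measure R).

(** The right-hand side of [zeta1E] for arbitrary predictors: 3 normalises [zeta1], 2 comes from
    [integral_kernel_dev]. *)
Definition integrated_advantage : \bar R :=
  (3%:E * \int[leb]_(y in `[0%R, 1%R]) (2%:E * max_advantage P X V y))%E.

Let M y := fine (max_advantage P X V y).

Let ME y : 0 <= y <= 1 -> max_advantage P X V y = (M y)%:E.
Proof.
move=> y01; rewrite fineK//; apply: max_advantage_fin_num => //.
exact: V_uniform.
Qed.

Let M_ge0 y : 0 <= M y. Proof. by rewrite fine_ge0// max_advantage_ge0. Qed.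

Let M_le y : 0 <= y <= 1 -> M y <= y * (1 - y).
Proof. by move=> y01; rewrite -lee_fin -ME//; apply: max_advantage_le => //; exact: V_uniform. Qed.

(** From [y] to [z] both terms of the advantage grow by an amount in [0, z - y], so their difference
    moves by at most z - y. The bound is uniform in [E] and passes to the supremum. *)
Let advantage_dist y z E : measurable E -> 0 <= y <= 1 -> 0 <= z <= 1 -> y <= z ->
  `|advantage P X V y E - advantage P X V z E| <= z - y.
Proof.
move=> mE y01 z01 yz.
have mp c : measurable (X @^-1` E `&` [set t | V t <= c]).
  by apply: measurableI; [exact: measurable_preimage|exact: measurable_set_le].
have mq : measurable (X @^-1` E) by exact: measurable_preimage.
have mS : measurable ([set t | V t <= z] `\` [set t | V t <= y]).
  by apply: measurableD; exact: measurable_set_le.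
rewrite /advantage.
set py := fine (P (_ `&` [set t | V t <= y])).
set pz := fine (P (_ `&` [set t | V t <= z])).
set q := fine (P (X @^-1` E)).
have q0 : 0 <= q by exact: fine_ge0.
have q1 : q <= 1 by rewrite -lee_fin -probability_fineK// probability_le1.
have py_pz : py <= pz.
  rewrite -lee_fin -!probability_fineK//; apply: le_measure; rewrite ?inE//.
  by move=> t [Et /= Vy]; split => //=; exact: le_trans Vy yz.
have pz_py : pz <= py + (z - y).
  rewrite -lee_fin EFinD -!probability_fineK//.
  have -> : (z - y)%:E = P ([set t | V t <= z] `\` [set t | V t <= y]).
    transitivity (P [set t | (V t <= z)%R] - P ([set t | (V t <= z)%R] `&` [set t | (V t <= y)%R]))%E.
      rewrite setIidr; last by move=> t /= Vy; exact: le_trans Vy yz.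
      by rewrite !V_uniform.
    have Pz : (P [set t | (V t <= z)%R] < +oo)%E by rewrite V_uniform ?ltry.
    by apply/esym/measureD; [exact: measurable_set_le|exact: measurable_set_le|exact: Pz].
  rewrite -measureU//; last first.
    by apply/seteqP; split=> t //= [[_ ?] []].
  apply: le_measure; rewrite ?inE//; first exact: measurableU.
  move=> t [Et /= Vz]; have [Vy|Vy] := pselect (V t <= y); first by left.
  by right.
by rewrite ler_norml; nra.
Qed.

Let max_advantage_dist y z : 0 <= y <= 1 -> 0 <= z <= 1 -> `|M y - M z| <= `|y - z|.
Proof.
move=> y01 z01.
have le (a b : R) : 0 <= a <= 1 -> 0 <= b <= 1 -> M a <= M b + `|a - b|.
  move=> a01 b01; rewrite -lee_fin -ME//; apply: ge_ereal_sup => _ [E mE <-].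
  rewrite lee_fin.
  have h1 : advantage P X V b E <= M b by rewrite -lee_fin -ME//; exact: advantage_le_max.
  have h2 : `|advantage P X V a E - advantage P X V b E| <= `|a - b|.
    have [ab|/ltW ba] := leP a b.
      by rewrite (distrC a) (ger0_norm (x := b - a)) ?subr_ge0//; exact: advantage_dist.
    by rewrite distrC (ger0_norm (x := a - b)) ?subr_ge0//; exact: advantage_dist.
  by move: h2; rewrite ler_norml => /andP[_]; lra.
have h1 := le _ _ y01 z01; have := le _ _ z01 y01.
by rewrite (distrC z) => h2; rewrite ler_norml; lra.
Qed.

(* M extended by its boundary values, so as to be defined and Lipschitz on all of R. *)
Let f y := M (clamp01 y).

Let f_id y : 0 <= y <= 1 -> f y = M y.
Proof. by move=> y01; rewrite /f clamp01_id. Qed.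

Let f_ge0 y : 0 <= f y. Proof. exact: M_ge0. Qed.

Let f_lipschitz : lipschitz_le 1 f.
Proof.
move=> a b; rewrite mul1r.
apply: le_trans (clamp01_dist a b); apply: max_advantage_dist; exact: clamp01_itv.
Qed.

Let mf D := @continuous_measurable_EFin R f D (lipschitz_le_continuous f_lipschitz).

Let integratedE : integrated_advantage = (6%:E * \int[leb]_(y in `[0%R, 1%R]) (f y)%:E)%E.
Proof.
rewrite /integrated_advantage.
have -> : (6%:E = 3%:E * 2%:E :> \bar R)%E by rewrite -EFinM; congr EFin; lra.
rewrite -muleA; congr (_ * _)%E.
rewrite -ge0_integralZl//; first last.
  by move=> y _; rewrite lee_fin.
apply: eq_integral => y; rewrite inE /= in_itv /= => y01.
by rewrite f_id// ME.
Qed.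

Let int_ge0 : (0 <= \int[leb]_(y in `[0%R, 1%R]) (f y)%:E)%E.
Proof. by apply: integral_ge0 => y _; rewrite lee_fin. Qed.

(** The deficit from the largest possible advantage. The integrals of [f] and [g] add up to 1/6, so
    the value 1 means that the integral of [g] vanishes. *)
Let g y := clamp01 y * (1 - clamp01 y) - f y.

Let g_ge0 y : 0 <= g y.
Proof. by rewrite subr_ge0; apply: M_le; exact: clamp01_itv. Qed.

Let g_lipschitz : lipschitz_le 2 g.
Proof.
move=> a b; have := f_lipschitz a b; have := clamp01_dist a b.
have := clamp01_itv a; have := clamp01_itv b; rewrite /g mul1r.
set x := clamp01 a; set z := clamp01 b; set u := f a; set v := f b => /andP[z0 z1] /andP[x0 x1] xz uv.
have h : `|x * (1 - x) - z * (1 - z)| <= `|x - z|.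
  have -> : x * (1 - x) - z * (1 - z) = (x - z) * (1 - x - z) by ring.
  rewrite normrM ler_piMr// ler_norml; lra.
have -> : x * (1 - x) - u - (z * (1 - z) - v) =
    (x * (1 - x) - z * (1 - z)) + (v - u) by ring.
apply: (le_trans (ler_normD _ _)); rewrite (distrC v).
by lra.
Qed.

Let mg D := @continuous_measurable_EFin R g D (lipschitz_le_continuous g_lipschitz).

Let int_fg : (\int[leb]_(y in `[0%R, 1%R]) (f y)%:E + \int[leb]_(y in `[0%R, 1%R]) (g y)%:E =
  (6^-1)%:E)%E.
Proof.
rewrite -integral_variance01 -ge0_integralD//; first last.
- by move=> y _; rewrite lee_fin.
- by move=> y _; rewrite lee_fin.
apply: eq_integral => y; rewrite inE /= in_itv /= => y01.
by rewrite -EFinD /g clamp01_id// addrC subrK.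
Qed.

Let intg_ge0 : (0 <= \int[leb]_(y in `[0%R, 1%R]) (g y)%:E)%E.
Proof. by apply: integral_ge0 => y _; rewrite lee_fin. Qed.

Let int_fin : (\int[leb]_(y in `[0%R, 1%R]) (f y)%:E)%E \is a fin_num.
Proof.
rewrite ge0_fin_numE//; apply: (@le_lt_trans _ _ (6^-1)%:E); last by rewrite ltry.
by rewrite -int_fg leeDl.
Qed.

Let intg_fin : (\int[leb]_(y in `[0%R, 1%R]) (g y)%:E)%E \is a fin_num.
Proof.
rewrite ge0_fin_numE//; apply: (@le_lt_trans _ _ (6^-1)%:E); last by rewrite ltry.
by rewrite -int_fg leeDr.
Qed.

Lemma measurable_max_advantage : @measurable_fun _ _ (measurableTypeR R) _ `[0, 1]%classic
  (max_advantage P X V).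
Proof.
apply: eq_measurable_fun (@mf _) => y.
by rewrite inE /= in_itv /= => y01; rewrite f_id// ME.
Qed.

Lemma integrated_advantage_itv : (0 <= integrated_advantage <= 1)%E.
Proof.
rewrite integratedE mule_ge0//=.
have : (\int[leb]_(y in `[0%R, 1%R]) (f y)%:E <= (6^-1)%:E)%E by rewrite -int_fg leeDl.
rewrite -(fineK int_fin) -EFinM !lee_fin; lra.
Qed.

Lemma integrated_advantage_eq0 : integrated_advantage = 0%E <->
  forall y, 0 <= y <= 1 -> max_advantage P X V y = 0%E.
Proof.
rewrite integratedE; split=> [I0 y y01|h].
  rewrite ME//; congr EFin; rewrite -f_id//.
  apply: (lipschitz_le_integral0 ltr01 f_lipschitz) => //.
  move: I0 => /eqP; rewrite mule_eq0 => /orP[|/eqP//].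
  by rewrite eqe pnatr_eq0.
rewrite integral0_eq ?mule0// => y /=; rewrite in_itv /= => y01.
by rewrite f_id// -ME// h.
Qed.

Lemma integrated_advantage_eq1 : integrated_advantage = 1%E <->
  forall y, 0 <= y <= 1 -> max_advantage P X V y = (y * (1 - y))%:E.
Proof.
have int_g0 : integrated_advantage = 1%E <-> (\int[leb]_(y in `[0%R, 1%R]) (g y)%:E)%E = 0%E.
  have := int_fg; rewrite integratedE -(fineK int_fin) -(fineK intg_fin) -EFinM -EFinD.
  move=> [h]; split=> -[h']; congr EFin; lra.
rewrite int_g0; split=> [I0 y y01|h].
  rewrite ME//; congr EFin; rewrite -f_id//; apply/esym/eqP.
  rewrite -subr_eq0 -{1 2}(clamp01_id y01) -/(g y); apply/eqP.
  exact: (lipschitz_le_integral0 (ltr0n _ 2) g_lipschitz).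
apply: integral0_eq => y /=; rewrite in_itv /= => y01.
congr EFin; rewrite /g clamp01_id// f_id//; apply/eqP; rewrite subr_eq0; apply/eqP.
by apply: EFin_inj; rewrite -ME// h.
Qed.

(** For decreasing transformations of Y, which turn V into 1 - V. *)
Lemma integrated_advantage_onem :
  integrated_advantage =
  (3%:E * \int[leb]_(y in `[0%R, 1%R]) (2%:E * max_advantage P X V (1 - y)%R))%E.
Proof.
rewrite integratedE.
have -> : (6%:E = 3%:E * 2%:E :> \bar R)%E by rewrite -EFinM; congr EFin; lra.
rewrite -muleA; congr (_ * _)%E.
have cf : continuous f by exact: lipschitz_le_continuous f_lipschitz.
rewrite (@integration_by_substitution_onem R f 1) ?lexx ?ler01//; last first.
  exact: continuous_subspaceT.
rewrite unstable.onem1 -ge0_integralZl//; first last.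
- by move=> y _; rewrite lee_fin.
- apply: continuous_measurable_EFin => x.
  apply: (@continuous_comp _ _ _ (@unstable.onem R) f); last exact: cf.
  by apply: continuousB => //; exact: cvg_cst.
apply: eq_integral => y; rewrite inE /= in_itv /= => y01.
have y01' : 0 <= 1 - y <= 1 by lra.
by rewrite /unstable.onem f_id// ME.
Qed.

End integrated_advantage.

Lemma integrated_advantage_mono {R : realType} d d1 d2 (T : measurableType d)
    (T1 : measurableType d1) (T2 : measurableType d2) (P : probability T R)
    (X1 : T -> T1) (X2 : T -> T2) (V : T -> R) :
  measurable_fun setT X1 -> measurable_fun setT X2 -> measurable_fun setT V ->
  (forall y, 0 <= y <= 1 -> P [set t | V t <= y] = y%:E) ->
  (forall E, measurable E -> almost_determined P X2 (X1 @^-1` E)) ->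
  (integrated_advantage P X1 V <= integrated_advantage P X2 V)%E.
Proof.
move=> mX1 mX2 mV Vu h; apply: lee_wpmul2l => //.
apply: ge0_le_integral => //.
- by move=> y _; rewrite mule_ge0// max_advantage_ge0.
- by apply: measurable_funeM; exact: measurable_max_advantage.
- by apply: measurable_funeM; exact: measurable_max_advantage.
- by move=> y _; apply: lee_wpmul2l => //; exact: max_advantage_mono.
Qed.

(** * From copulas to random vectors *)

Section zeta1_of_random_vectors.
Context {R : realType} dT (T : measurableType dT) (P : probability T R).

Lemma max_advantage_image d1 d2 (T1 : measurableType d1) (T2 : measurableType d2)
    (m : probability T1 R) (W : T -> T1) (X : T1 -> T2) (V : T1 -> R) y :
  measurable_fun setT X -> measurable_fun setT V ->
  (forall E, measurable E -> m E = P [set t | E (W t)]) ->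
  max_advantage m X V y = max_advantage P (X \o W) (V \o W) y.
Proof.
move=> mX mV mE; rewrite /max_advantage; congr ereal_sup; apply: eq_imagel => E mE'.
have mXE : measurable (X @^-1` E) by exact: measurable_preimage.
rewrite /advantage; congr (EFin (fine _ - y * fine _)); rewrite mE//.
by apply: measurableI => //; exact: measurable_set_le.
Qed.

Variables (d : nat) (X : T -> d.-tuple R) (Y : T -> R).
Hypotheses (mX : measurable_fun setT X) (mY : measurable_fun setT Y).
Hypothesis X_atomless : forall i a, P [set t | tnth (X t) i = a] = 0%E.
Hypothesis Y_atomless : forall a, P [set t | Y t = a] = 0%E.

Let Z := join_vector X Y.
Let V t := cdf_of P Y (Y t).
Let UX t := margin_transform P X (X t).

Lemma measurable_join_vector : measurable_fun setT Z.
Proof. exact: measurable_snoc. Qed.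

Lemma join_vector_atomless i a : P [set t | tnth (Z t) i = a] = 0%E.
Proof.
have [ilt|di] := ltnP i d.
  rewrite -(X_atomless (Ordinal ilt) a); congr (P _).
  by apply/seteqP; split=> t; rewrite /= /Z/join_vector tnth_snoc_lt.
have -> : i = ord_max by apply/val_inj/eqP; rewrite /= eqn_leq di -ltnS ltn_ord.
rewrite -(Y_atomless a); congr (P _).
by apply/seteqP; split=> t; rewrite /= /Z/join_vector tnth_snoc_last.
Qed.

Lemma measurable_probability_transform : measurable_fun setT V.
Proof. exact: (measurableT_comp (measurable_cdf_of P mY) mY). Qed.

Let mUX : measurable_fun setT UX.
Proof. exact: (measurableT_comp (measurable_margin_transform P mX) mX). Qed.

Let mXi i : measurable_fun setT (fun t => tnth (X t) i).
Proof. exact: (measurableT_comp (@measurable_tnth _ R d i) mX). Qed.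

Lemma margin_transform_join t :
  margin_transform P Z (Z t) = snoc (UX t) (V t).
Proof.
apply: eq_from_tnth => i; rewrite tnth_mktuple.
have [ilt|di] := ltnP i d.
  rewrite /Z /join_vector !tnth_snoc_lt tnth_mktuple /marginal_cdf; congr (fine (P _)).
  by apply/seteqP; split=> s; rewrite /= tnth_snoc_lt.
have -> : i = ord_max by apply/val_inj/eqP; rewrite /= eqn_leq di -ltnS ltn_ord.
rewrite /Z /join_vector !tnth_snoc_last /marginal_cdf; congr (fine (P _)).
by apply/seteqP; split=> s; rewrite /= tnth_snoc_last.
Qed.

Lemma margin_transform_determines E : measurable E -> almost_determined P UX (X @^-1` E).
Proof.
apply: almost_determined_tuple => // i a.
apply: (almost_determined_eq (cdf_of_le_ae (mXi i) (X_atomless i) a)).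
pose c := cdf_of P (fun t => tnth (X t) i) a.
rewrite (_ : [set t | _] = UX @^-1` [set x | tnth x i <= c]).
  by apply: almost_determined_preimage; exact: measurable_coordinate_le.
by apply/seteqP; split=> t; rewrite /= tnth_mktuple.
Qed.

(** The copula sees the transformed predictors [UX] instead of X; they determine the same events up
    to null sets. Any copula of [Z] is allowed, which later links a given copula to the one chosen
    by [copula_of]. *)
Lemma max_advantage_copula A y : is_copula_of P Z A -> 
  max_advantage (copula_measure A) (@first_coords R d d.+1) (fun z => tnth z ord_max) y =
  max_advantage P X V y.
Proof.
move=> AZ.
have mE E : measurable E -> copula_measure A E = P [set t | E (margin_transform P Z (Z t))].
  exact: (copula_of_measure measurable_join_vector join_vector_atomless AZ).
rewrite (max_advantage_image _ _ _ mE); [|exact: measurable_first_coords|exact: measurable_tnth].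
transitivity (max_advantage P UX V y).
  congr (max_advantage P _ _ y); apply/funext => t /=; rewrite margin_transform_join.
    exact: tnth_snoc_first.
  exact: tnth_snoc_last.
have mV := measurable_probability_transform.
apply/eqP; rewrite eq_le; apply/andP; split; apply: max_advantage_mono => // E mE'.
  rewrite (_ : UX @^-1` E = X @^-1` (margin_transform P X @^-1` E))//.
  apply: almost_determined_preimage; apply: measurable_preimage => //.
  exact: measurable_margin_transform.
exact: margin_transform_determines.
Qed.

Lemma zeta1_copula A : is_copula_of P Z A -> zeta1 A = integrated_advantage P X V.
Proof.
move=> AZ; rewrite zeta1E; last by case: AZ.
congr (_ * _)%E; apply: eq_integral => y _.
by rewrite max_advantage_copula.
Qed.

Lemma zeta1_rvE : zeta1_rv P X Y = integrated_advantage P X V.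
Proof.
apply: zeta1_copula.
exact: (is_copula_of_copula_of measurable_join_vector join_vector_atomless).
Qed.

Lemma probability_transform_uniform y : 0 <= y <= 1 -> P [set t | V t <= y] = y%:E.
Proof. exact: cdf_of_uniform. Qed.

Lemma zeta1_rv_itv : (0 <= zeta1_rv P X Y <= 1)%E.
Proof.
rewrite zeta1_rvE; apply: integrated_advantage_itv => //.
  exact: measurable_probability_transform.
exact: probability_transform_uniform.
Qed.

End zeta1_of_random_vectors.

(** * Strictly monotone transformations and the chain of inequalities *)

Section monotone_transformations.
Context {R : realType} dT (T : measurableType dT) (P : probability T R).

Lemma strictly_monotone_inj (f : R -> R) : strictly_monotone f -> injective f.
Proof.
move=> hf x y fxy; apply/eqP; rewrite eq_le !leNgt; apply/andP.
by case: hf => hf; split; apply/negP => /hf; rewrite fxy ltxx.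
Qed.

Lemma strictly_monotone_measurable (f : R -> R) : strictly_monotone f -> measurable_fun setT f.
Proof.
case=> hf; [apply: nondecreasing_measurable|apply: nonincreasing_measurable] => // x y;
  by rewrite le_eqVlt => /predU1P[->//|/hf/ltW].
Qed.

Lemma injective_atomless (Y : T -> R) (f : R -> R) : injective f ->
  (forall a, P [set t | Y t = a] = 0%E) -> forall a, P [set t | f (Y t) = a] = 0%E.
Proof.
move=> fI Ya a; have [[x fx]|nx] := pselect (exists x, f x = a).
  rewrite -(Ya x); congr (P _); apply/seteqP; split=> t /=; last by move=> ->.
  by rewrite -fx => /fI.
rewrite (_ : [set t | _] = set0) ?measure0//.
by apply/seteqP; split=> t //= h; apply: nx; exists (Y t).
Qed.

(** {1 - V <= y} is the complement of {V <= 1 - y} up to a null set, so the advantage of each [E]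
    changes sign; passing to the complement of [E] changes it back. *)
Lemma max_advantage_onem d1 (T1 : measurableType d1) (X : T -> T1) (V : T -> R) y :
  measurable_fun setT X -> measurable_fun setT V ->
  P [set t | V t <= 1 - y] = (1 - y)%:E -> P [set t | 1 - V t <= y] = y%:E ->
  max_advantage P X (fun t => 1 - V t) y = max_advantage P X V (1 - y).
Proof.
move=> mX mV Vy Vy'.
have mB : measurable [set t | V t <= 1 - y] by exact: measurable_set_le.
have mC : measurable [set t | 1 - V t <= y].
  by apply: measurable_set_le; exact: measurable_funB.
have BC : P.-negligible (~` [set t | V t <= 1 - y] `+` [set t | 1 - V t <= y]).
  apply: (negligible_setY_eq (G := setT)) => //.
  - exact: measurableC.
  - exact: probability_setT.
  - by move=> t /= [/negP]; lra.
  - by rewrite probability_setC// Vy Vy' -EFinB; congr EFin; lra.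
have advE E : measurable E ->
    advantage P X (fun t => 1 - V t) y E = - advantage P X V (1 - y) E.
  move=> mE; have mXE : measurable (X @^-1` E) by exact: measurable_preimage.
  rewrite /advantage.
  have -> : P (X @^-1` E `&` [set t | 1 - V t <= y]) = P (X @^-1` E `\` [set t | V t <= 1 - y]).
    apply: negligible_setY_measure; [exact: measurableI|exact: measurableD|].
    apply: negligibleS BC => t [[[Et Ct] h]|[[Et nB] h]].
      by right; split => // nB; apply: h.
    by left; split => // Ct; apply: h.
  have := measureDI P mXE mB.
  rewrite [LHS]probability_fineK// [X in _ = X -> _](_ : _ =
    (fine (P (X @^-1` E `\` [set t | V t <= 1 - y])) +
     fine (P (X @^-1` E `&` [set t | V t <= 1 - y])))%:E); last first.
    rewrite EFinD -!probability_fineK//; [exact: measurableI|exact: measurableD].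
  by move=> [->]; lra.
apply/eqP; rewrite eq_le; apply/andP; split; apply: ge_ereal_sup => _ [E mE <-].
  rewrite advE// -advantageC//; apply: advantage_le_max; exact: measurableC.
rewrite -[E]setCK advantageC//; last exact: measurableC.
by rewrite -advE; [apply: advantage_le_max|]; exact: measurableC.
Qed.

Variables (d : nat) (X : T -> d.-tuple R) (Y : T -> R).
Hypotheses (mX : measurable_fun setT X) (mY : measurable_fun setT Y).
Hypothesis X_atomless : forall i a, P [set t | tnth (X t) i = a] = 0%E.
Hypothesis Y_atomless : forall a, P [set t | Y t = a] = 0%E.

Let V t := cdf_of P Y (Y t).

Lemma cdf_of_increasing (psi : R -> R) : {homo psi : x y / x < y} ->
  (fun t => cdf_of P (psi \o Y) (psi (Y t))) = V.
Proof.
move=> hpsi; apply/funext => t; congr (fine (P _)).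
by apply/seteqP; split=> s; rewrite /= (le_mono hpsi).
Qed.

Lemma cdf_of_decreasing (psi : R -> R) : {homo psi : x y /~ x < y} ->
  (fun t => cdf_of P (psi \o Y) (psi (Y t))) = (fun t => 1 - V t).
Proof.
move=> hpsi; apply/funext => t; rewrite /V /cdf_of.
have mle : measurable [set s | Y s <= Y t] by exact: measurable_set_le.
have mge : measurable [set s | Y t <= Y s] by apply: measurable_set_lef.
have -> : [set s | (psi \o Y) s <= psi (Y t)] = [set s | Y t <= Y s].
  by apply/seteqP; split=> s; rewrite /= (le_nmono hpsi).
have -> : P [set s | Y t <= Y s] = P (~` [set s | Y s <= Y t]).
  apply: negligible_setY_measure => //; first exact: measurableC.
  apply: (@negligibleS _ _ _ _ [set s | Y s = Y t]); last first.
    apply/negligibleP; last exact: Y_atomless.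
    by apply: (@measurable_preimage _ _ _ _ Y [set Y t]) => //; exact: measurable_set1.
  move=> s /= [[ts /contrapT st]|[/negP + nts]]; first by apply/eqP; rewrite eq_le ts st.
  by rewrite -ltNge => /ltW.
by rewrite probability_setC// [in LHS]probability_fineK.
Qed.

Lemma zeta1_rv_strictly_monotone (phi : 'I_d -> R -> R) (psi : R -> R) :
  (forall i, strictly_monotone (phi i)) -> strictly_monotone psi ->
  zeta1_rv P (fun t => [tuple phi i (tnth (X t) i) | i < d]) (psi \o Y) = zeta1_rv P X Y.
Proof.
move=> hphi hpsi.
pose G (x : d.-tuple R) := [tuple phi i (tnth x i) | i < d].
have mphi i := strictly_monotone_measurable (hphi i).
have mpsi := strictly_monotone_measurable hpsi.
have mG : measurable_fun setT G.
  apply/measurable_fun_tnthP => i.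
  rewrite (_ : _ \o _ = fun x => phi i (tnth x i)); last first.
    by apply/funext => x; rewrite /= tnth_mktuple.
  exact: (measurableT_comp (mphi i) (@measurable_tnth _ R d i)).
have mGX : measurable_fun setT (G \o X) by exact: measurableT_comp.
have mpsiY : measurable_fun setT (psi \o Y) by exact: measurableT_comp.
have psiY_atomless := injective_atomless (strictly_monotone_inj hpsi) Y_atomless.
have mV : measurable_fun setT V by exact: measurable_probability_transform.
have Vu : forall y, 0 <= y <= 1 -> P [set t | V t <= y] = y%:E.
  exact: probability_transform_uniform.
have max_GX y V' : measurable_fun setT V' ->
    max_advantage P (G \o X) V' y = max_advantage P X V' y.
  move=> mV'; apply/eqP; rewrite eq_le; apply/andP; split; apply: max_advantage_mono => // E mE.
    by apply: (almost_determined_preimage _ _ (measurable_preimage mG mE)).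
  apply: almost_determined_tuple => // i a.
  (* A strictly monotone map reflects the order, so the ray event of X_i is exactly a ray event of
     its image, upper or lower. *)
  have [B mB BE] : exists2 B : set (d.-tuple R), measurable B &
      [set t | tnth (X t) i <= a] = (G \o X) @^-1` B.
    case: (hphi i) => h.
      exists [set z | tnth z i <= phi i a]; first exact: measurable_coordinate_le.
      by apply/seteqP; split=> t; rewrite /= tnth_mktuple (le_mono h).
    exists [set z | phi i a <= tnth z i].
      by apply: measurable_set_lef; [exact: measurable_cst|exact: measurable_tnth].
    by apply/seteqP; split=> t; rewrite /= tnth_mktuple (le_nmono h).
  by rewrite BE; exact: almost_determined_preimage.
rewrite !zeta1_rvE//; last first.
  move=> i a; rewrite -(injective_atomless (strictly_monotone_inj (hphi i)) (X_atomless i) a).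
  by congr (P _); apply/seteqP; split=> t; rewrite /= tnth_mktuple.
case: hpsi => hpsi.
  rewrite cdf_of_increasing//; congr (_ * _)%E; apply: eq_integral => y _.
  by rewrite max_GX.
rewrite cdf_of_decreasing// [RHS]integrated_advantage_onem//.
congr (_ * _)%E; apply: eq_integral => y; rewrite inE /= in_itv /= => y01.
rewrite max_GX; last exact: measurable_funB.
rewrite max_advantage_onem//; first by apply: Vu; lra.
rewrite -(probability_transform_uniform mpsiY psiY_atomless y01).
by congr (P _); apply/seteqP; split=> t /=; rewrite -(congr1 (@^~ t) (cdf_of_decreasing hpsi)).
Qed.

Lemma zeta1_rv_first_coords (k l : nat) : (k <= l)%N -> (l <= d)%N ->
  (zeta1_rv P (first_coords k \o X) Y <= zeta1_rv P (first_coords l \o X) Y)%E.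
Proof.
move=> kl ld.
have mfX j : measurable_fun setT (first_coords j \o X).
  exact: (measurableT_comp (@measurable_first_coords R j d) mX).
have atomless j : (j <= d)%N -> forall i a, P [set t | tnth ((first_coords j \o X) t) i = a] = 0%E.
  move=> jd i a; rewrite -(X_atomless (widen_ord jd i) a); congr (P _).
  by apply/seteqP; split=> t; rewrite /= (@tnth_first_coords R j d (X t) i (widen_ord jd i)).
rewrite !zeta1_rvE//; [|exact: atomless|by apply: atomless; exact: leq_trans ld].
apply: integrated_advantage_mono; [exact: mfX|exact: mfX| | |].
- exact: measurable_probability_transform.
- exact: probability_transform_uniform.
move=> E mE; rewrite (_ : _ @^-1` E = (first_coords l \o X) @^-1` (first_coords k @^-1` E)).
  apply: almost_determined_preimage; apply: measurable_preimage => //.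
  exact: measurable_first_coords.
by apply/seteqP; split=> t /=; rewrite first_coords_comp.
Qed.

End monotone_transformations.

(** * Vanishing advantage, independence and the product linkage *)

Section independence.
Context {R : realType} dT (T : measurableType dT) (P : probability T R).

(** If no event has positive advantage, none has a negative one, because its complement would have a
    positive one. *)
Lemma max_advantage_eq0 d1 (T1 : measurableType d1) (X : T -> T1) (V : T -> R) y :
  measurable_fun setT X -> measurable_fun setT V ->
  P [set t | V t <= y] = y%:E ->
  max_advantage P X V y = 0%E <->
  forall E, measurable E -> P (X @^-1` E `&` [set t | V t <= y]) = (P (X @^-1` E) * y%:E)%E.
Proof.
move=> mX mV Vy.
have adv0 E : measurable E -> advantage P X V y E = 0 <->
    P (X @^-1` E `&` [set t | V t <= y]) = (P (X @^-1` E) * y%:E)%E.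
  move=> mE; have mXE : measurable (X @^-1` E) by exact: measurable_preimage.
  have mXV : measurable (X @^-1` E `&` [set t | V t <= y]).
    by apply: measurableI => //; exact: measurable_set_le.
  rewrite (probability_fineK P mXE) (probability_fineK P mXV) -EFinM /advantage mulrC.
  split=> [/eqP|[->]]; last by rewrite subrr.
  by rewrite subr_eq0 => /eqP ->.
split=> [M0 E mE|h].
  apply/adv0 => //; apply/eqP; rewrite eq_le -oppr_le0 -advantageC//.
  have le0 F : measurable F -> advantage P X V y F <= 0.
    by move=> mF; rewrite -lee_fin -[leRHS]M0; exact: advantage_le_max.
  by rewrite !le0//; exact: measurableC.
apply/eqP; rewrite eq_le max_advantage_ge0 andbT.
by apply: ge_ereal_sup => _ [E mE <-]; rewrite (adv0 E mE).2// h.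
Qed.

Variables (d : nat) (X : T -> d.-tuple R) (Y : T -> R).
Hypotheses (mX : measurable_fun setT X) (mY : measurable_fun setT Y).
Hypothesis Y_atomless : forall a, P [set t | Y t = a] = 0%E.

Let V t := cdf_of P Y (Y t).
Let mV : measurable_fun setT V. Proof. exact: measurable_probability_transform. Qed.
Let V_uniform y : 0 <= y <= 1 -> P [set t | V t <= y] = y%:E.
Proof. exact: probability_transform_uniform. Qed.

Lemma max_advantage_independent :
  (forall y, 0 <= y <= 1 -> max_advantage P X V y = 0%E) <-> independent_of P X Y.
Proof.
split=> [M0 E F mE mF|ind y y01]; last first.
  apply/max_advantage_eq0 => //; first exact: V_uniform.
  move=> E mE; rewrite -V_uniform//.
  pose F := [set z | cdf_of P Y z <= y].
  have mF : measurable F by apply: measurable_set_le; exact: measurable_cdf_of.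
  exact: (ind E F mE mF).
have mXE : measurable (X @^-1` E) by exact: measurable_preimage.
pose m1 : {measure set R -> \bar R} := partial_law P mXE mY.
pose m2 : {measure set R -> \bar R} :=
  mscale (NngNum (fine_ge0 (measure_ge0 P (X @^-1` E)))) (law P mY).
have m1E F' : m1 F' = P (X @^-1` E `&` Y @^-1` F').
  by rewrite setIC; exact: partial_lawE.
have m2E F' : m2 F' = (P (X @^-1` E) * P (Y @^-1` F'))%E.
  by rewrite [in RHS](probability_fineK P mXE).
rewrite -m2E (_ : [set t | _] = X @^-1` E `&` Y @^-1` F)// -m1E.
apply: measure_rays_unique => //.
  by rewrite m1E (le_lt_trans (probability_le1 _ _)) ?ltry//; rewrite preimage_setT setIT.
move=> a; rewrite m1E m2E.
have mVa : measurable [set t | V t <= cdf_of P Y a] by exact: measurable_set_le.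
have mlt : measurable (Y @^-1` [set x | x < a]).
  apply: measurable_preimage => //.
  by rewrite (_ : [set v | v < a] = `]-oo, a[%classic)//; apply/seteqP; split => v /=; rewrite in_itv.
(* Uniqueness of measures is tested on strict rays of Y; the boundary Y = a is null. *)
have ae : P.-negligible (Y @^-1` [set x | x < a] `+` [set t | V t <= cdf_of P Y a]).
  have N0 : P.-negligible [set t | Y t = a].
    apply/negligibleP; last exact: Y_atomless.
    by apply: (@measurable_preimage _ _ _ _ Y [set a]) => //; exact: measurable_set1.
  apply: negligibleS (negligibleU N0 (cdf_of_le_ae mY Y_atomless a)).
  move=> t [[/= Ya nV]|[Va /= nY]].
    by right; left; split => //=; exact: ltW.
  have [Ya|Ya] := eqVneq (Y t) a; first by left.
  right; right; split => //= Ya'; apply: nY; rewrite lt_neqAle Ya//.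
have -> : P (X @^-1` E `&` Y @^-1` [set x | x < a]) =
    P (X @^-1` E `&` [set t | V t <= cdf_of P Y a]).
  apply: negligible_setY_measure; [exact: measurableI|exact: measurableI|].
  apply: negligibleS ae => t [[[Et Ct] h]|[[Et Ct] h]].
    by left; split => // ?; apply: h.
  by right; split => // ?; apply: h.
rewrite (negligible_setY_measure mlt mVa ae) V_uniform ?cdf_of_01//.
by move: E mE {m1 m2 m1E m2E mXE}; apply/max_advantage_eq0 => //;
  [apply: V_uniform|apply: M0]; exact: cdf_of_01.
Qed.

End independence.

Section linkage_independence.
Context {R : realType} (d : nat) (A : d.+1.-tuple R -> R) (cA : is_copula A).

(** The advantage may be computed from the Rosenblatt transform. Its vanishing makes the response
    independent of a uniform vector, so that the law behind the linkage is Lebesgue measure on the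
    cube. *)
Lemma max_advantage_linkage :
  (forall y, 0 <= y <= 1 ->
    max_advantage (copula_measure A) (@first_coords R d d.+1) (fun z => tnth z ord_max) y = 0%E) <->
  forall x, cube d.+1 x -> linkage A x = Pi_copula x.
Proof.
set Q := rosenblatt_prob A.
pose Phi := @rosenblatt_rv R d A.
pose Yl (w : d.+1.-tuple R * d.-tuple R) : R := tnth w.1 ord_max.
have mPhi : measurable_fun setT Phi by exact: measurable_rosenblatt_rv.
have mYl : measurable_fun setT Yl.
  exact: (measurableT_comp (@measurable_tnth _ R d.+1 ord_max) measurable_fst).
have mle y : measurable [set v : R | v <= y].
  by apply: (@measurable_set_le R _ R id); exact: measurable_id.
have jointE E y : measurable E ->
    Q (Phi @^-1` E `&` [set w | Yl w <= y]) =
    copula_measure (linkage A) [set z | E (first_coords d z) /\ tnth z ord_max <= y].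
  move=> mE; rewrite copula_measure_linkage//; last first.
    apply: measurableI; last exact: measurable_coordinate_le.
    by apply: measurable_preimage => //; exact: measurable_first_coords.
  by congr (Q _); apply/seteqP; split=> w /=; rewrite tnth_snoc_first tnth_snoc_last.
have Yl_uniform y : 0 <= y <= 1 -> Q [set w | Yl w <= y] = y%:E.
  move=> y01; rewrite -[[set w | _]]setTI -[setT](preimage_setT Phi) jointE//.
  rewrite -(copula_uniform_margins (linkage_is_copula cA) ord_max y01).
  by congr (copula_measure _ _); apply/seteqP; split=> z //= [].
split=> [M0 x xc|h y y01].
  have [_ xE] := copula_measureP (linkage_is_copula cA).
  apply: EFin_inj; rewrite -xE//.
  rewrite -lebesgue_cube_orthant// orthant_snoc -jointE; last exact: measurable_lower_orthant.
  have x01 := xc ord_max.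
  have M0' : max_advantage Q Phi Yl (tnth x ord_max) = 0%E.
    by rewrite max_advantage_rosenblatt// M0.
  rewrite (max_advantage_eq0 mPhi mYl (Yl_uniform _ x01)).1//; last exact: measurable_lower_orthant.
  rewrite rosenblatt_law//; last exact: measurable_lower_orthant.
  rewrite -unif01_le//; apply/esym/lebesgue_cube_snoc => //.
  exact: measurable_lower_orthant.
rewrite -max_advantage_rosenblatt//; apply/(max_advantage_eq0 mPhi mYl (Yl_uniform _ y01)).
move=> E mE; rewrite jointE//.
have cdfPi : has_cdf_on_cube (linkage A) (lebesgue_cube d.+1).
  split; first exact: lebesgue_cube_cube.
  by move=> x xc; rewrite h// lebesgue_cube_orthant.
rewrite (copula_measureE cdfPi); last first.
  apply: measurableI; last exact: measurable_coordinate_le.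
  by apply: measurable_preimage => //; exact: measurable_first_coords.
rewrite rosenblatt_law// -unif01_le//.
exact: lebesgue_cube_snoc.
Qed.

End linkage_independence.

(** * Full advantage and functional dependence *)

Section functional_dependence.
Context {R : realType} dT (T : measurableType dT) (P : probability T R).
Context d1 (T1 : measurableType d1).
Variables (X : T -> T1) (mX : measurable_fun setT X).

(** For each rational q pick a set E_q with {Y <= q} = {X in E_q} up to a null set. Outside the
    countable union of these null sets, Y is the infimum of the q with X in E_q, which is a function
    of X. *)
Lemma almost_determined_function (Y : T -> R) : measurable_fun setT Y ->
  (forall a, almost_determined P X [set t | Y t <= a]) ->
  exists f : T1 -> R, measurable_fun setT f /\ P [set t | Y t = f (X t)] = 1%E.
Proof.
move=> mY hY; pose r (n : nat) : R := ratr (odflt 0 (unpickle n) : rat).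
have [E EP] := choice (fun n => let: ex_intro2 E mE nE := hY (r n) in
  ex_intro (fun E => measurable E /\ P.-negligible ([set t | Y t <= r n] `+` X @^-1` E))
    E (conj mE nE)).
have {EP} [mE nE] : (forall n, measurable (E n)) /\
    forall n, P.-negligible ([set t | Y t <= r n] `+` X @^-1` E n).
  by split=> n; have [] := EP n.
(* The value +oo removes an index from the infimum. *)
pose g n x : \bar R := if x \in E n then (r n)%:E else +oo%E.
have mg n : measurable_fun setT (g n).
  apply: measurable_fun_ifT; [|exact: measurable_cst|exact: measurable_cst].
  apply: (measurable_fun_bool true); by rewrite setTI preimage_mem_true.
pose f x := fine (einfs (g ^~ x) 0%N).
have mf : measurable_fun setT f.
  by apply: measurableT_comp => //; exact: measurable_fun_einfs.
exists f; split => //; apply: probability_negligible_setC.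
  have -> : [set t | Y t = f (X t)] = [set t | Y t <= f (X t)] `&` [set t | f (X t) <= Y t].
    apply/seteqP; split=> t /= => [->//|[h1 h2]]; apply/eqP; rewrite eq_le h1 h2//.
  have mfX : measurable_fun setT (f \o X) by exact: measurableT_comp.
  by apply: measurableI; exact: measurable_set_lef.
apply: negligibleS (negligible_bigcup nE) => t nYf.
apply: contrapT => nN; apply: nYf => /=.
have Er n : E n (X t) <-> Y t <= r n.
  split=> h; apply: contrapT => nh; apply: nN; exists n => //; [by right|by left].
rewrite /f (_ : einfs _ _ = (Y t)%:E)//; apply/eqP; rewrite eq_le; apply/andP; split.
  apply/lee_addgt0Pr => e e0; have : Y t < Y t + e by rewrite ltrDl.
  move=> /rat_in_itvoo[q]; rewrite in_itv /= => /andP[Yq qe].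
  have rq : r (pickle q) = ratr q by rewrite /r pickleK.
  apply: (@le_trans _ _ (ratr q)%:E); last by rewrite -EFinD lee_fin ltW.
  apply: ereal_inf_lbound; exists (pickle q); first by [].
  by rewrite /g mem_set ?rq//; apply/Er; rewrite rq ltW.
apply: le_ereal_inf_tmp => _ [n _ <-]; rewrite /g.
by case: ifPn => [/set_mem/Er|_]; rewrite ?lee_fin ?leey.
Qed.

Lemma full_advantage_determined (V : T -> R) y : measurable_fun setT V ->
  0 < y < 1 -> P [set t | V t <= y] = y%:E ->
  max_advantage P X V y = (y * (1 - y))%:E -> almost_determined P X [set t | V t <= y].
Proof.
move=> mV /andP[y0 y1] Vy.
have [k [k0 mk kE]] := conditional_density P mX mV y.
rewrite (max_advantage_attained mV mk k0 (ltW y0) kE).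
set E := ~` _; have mE : measurable E by apply: measurableC; exact: measurable_set_le.
have mXE : measurable (X @^-1` E) by exact: measurable_preimage.
have mB : measurable [set t | V t <= y] by exact: measurable_set_le.
set B := [set t | V t <= y] in mB Vy *.
have mI : measurable (X @^-1` E `&` B) by exact: measurableI.
rewrite /advantage -/B.
set p := fine (P (_ `&` _)); set q := fine (P (X @^-1` E)) => -[pq].
have pE : P (X @^-1` E `&` B) = p%:E by exact: probability_fineK.
have qE : P (X @^-1` E) = q%:E by exact: probability_fineK.
have p_q : p <= q by rewrite -lee_fin -pE -qE; apply: le_measure; rewrite ?inE// => t [].
have p_y : p <= y by rewrite -lee_fin -pE -Vy; apply: le_measure; rewrite ?inE// => t [].
have py : p = y.
  apply/eqP; rewrite eq_le p_y/= -(ler_pM2r (x := 1 - y)) ?subr_gt0//.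
  by rewrite -pq mulrBr mulr1 lerD2l lerN2 mulrC ler_pM2l.
have qy : q = y.
  by apply: (mulfI (lt0r_neq0 y0)); move: pq; rewrite py; lra.
exists E => //.
have n1 : P.-negligible (X @^-1` E `&` B `+` X @^-1` E).
  apply: (negligible_setY_eq (G := setT)) => //; first exact: probability_setT.
    by move=> t [[]].
  by rewrite pE qE py qy.
have n2 : P.-negligible (X @^-1` E `&` B `+` B).
  apply: (negligible_setY_eq (G := setT)) => //; first exact: probability_setT.
    by move=> t [[]].
  by rewrite pE Vy py.
apply: negligibleS (negligibleU n1 n2) => t [[Bt nE]|[Et nB]].
  by right; right; split => // -[].
by left; right; split => // -[].
Qed.

Lemma determined_full_advantage (V : T -> R) y : measurable_fun setT V ->
  0 <= y <= 1 -> P [set t | V t <= y] = y%:E ->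
  almost_determined P X [set t | V t <= y] -> max_advantage P X V y = (y * (1 - y))%:E.
Proof.
move=> mV y01 Vy [E mE BE]; apply/eqP; rewrite eq_le max_advantage_le//=.
apply: (@le_trans _ _ (advantage P X V y E)%:E); last exact: advantage_le_max.
have mXE : measurable (X @^-1` E) by exact: measurable_preimage.
have mB : measurable [set t | V t <= y] by exact: measurable_set_le.
have -> : advantage P X V y E = y - y * y.
  rewrite /advantage -(negligible_setY_measure mB mXE BE) Vy/=.
  have -> : P (X @^-1` E `&` [set t | V t <= y]) = y%:E; last by [].
  rewrite -Vy; apply: negligible_setY_measure => //; first exact: measurableI.
  apply: negligibleS BE => t [[[_ Vt] //]|[Vt nEV]].
  by left; split => // Et; apply: nEV.
by rewrite lee_fin mulrBr mulr1.
Qed.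

Variables (Y : T -> R) (mY : measurable_fun setT Y).
Hypothesis Y_atomless : forall a, P [set t | Y t = a] = 0%E.

Let V t := cdf_of P Y (Y t).
Let mV : measurable_fun setT V. Proof. exact: measurable_probability_transform. Qed.
Let V_uniform y : 0 <= y <= 1 -> P [set t | V t <= y] = y%:E.
Proof. exact: probability_transform_uniform. Qed.

Lemma max_advantage_function :
  (forall y, 0 <= y <= 1 -> max_advantage P X V y = (y * (1 - y))%:E) <->
  exists f : T1 -> R, measurable_fun setT f /\ P [set t | Y t = f (X t)] = 1%E.
Proof.
split=> [M1|[f [mf Yf]] y y01].
  apply: almost_determined_function => // a.
  apply: (almost_determined_eq (cdf_of_le_ae mY Y_atomless a)).
  have y01 : 0 <= cdf_of P Y a <= 1 by exact: cdf_of_01.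
  set y := cdf_of P Y a in y01 *; have Vy := V_uniform y01.
  have mB : measurable [set t | V t <= y] by exact: measurable_set_le.
  (* At the end points 0 and 1 the event is null or almost sure, hence determined by anything. *)
  have [y_gt0|y_le0] := ltP 0 y; last first.
    apply: (almost_determined_eq (C := set0)).
      rewrite setY0; apply/negligibleP => //.
      by rewrite [LHS]Vy; congr EFin; lra.
    by rewrite -(preimage_set0 X); exact: almost_determined_preimage.
  have [y_lt1|y_ge1] := ltP y 1; last first.
    apply: (almost_determined_eq (C := setT)).
      have B1 : P [set t | V t <= y] = 1%E by rewrite Vy; congr EFin; lra.
      by apply: negligibleS (probability1_negligible mB B1) => t [[_ /(_ Logic.I)]|[]].
    by rewrite -(preimage_setT X); exact: almost_determined_preimage.
  by apply: full_advantage_determined; rewrite ?y_gt0 ?M1.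
apply: determined_full_advantage => //; first exact: V_uniform.
pose F := cdf_of P Y.
have mF : measurable_fun setT F by exact: measurable_cdf_of.
apply: (almost_determined_eq (C := (X @^-1` [set x | F (f x) <= y]))); last first.
  apply: almost_determined_preimage; apply: measurable_set_le.
  exact: measurableT_comp.
have mfX : measurable_fun setT (f \o X) by exact: measurableT_comp.
have mYf : measurable [set t | Y t = f (X t)].
  have -> : [set t | Y t = f (X t)] = [set t | Y t <= f (X t)] `&` [set t | f (X t) <= Y t].
    by apply/seteqP; split=> t /= => [->//|[h1 h2]]; apply/eqP; rewrite eq_le h1 h2.
  by apply: measurableI; exact: measurable_set_lef.
apply: negligibleS (probability1_negligible mYf Yf) => t + /= Yt.
by case=> -[/= Vy nVy]; apply: nVy; move: Vy; rewrite /= /V Yt.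
Qed.

End functional_dependence.
Theorem theorem5p6 (R : realType) (dT : measure_display)
    (T : measurableType dT) (P : probability T R) (d : nat) (d_gt0 : (0 < d)%N)
    (X : {RV P >-> d.-tuple R}) (Y : {RV P >-> R}) (A : d.+1.-tuple R -> R)
    (H_continuous : continuous_cdf P (join_vector X Y))
    (A_copula : is_copula_of P (join_vector X Y) A) :
  [/\ (0 <= zeta1_rv P X Y <= 1)%E,
      (zeta1_rv P X Y = 0%E <-> independent_of P X Y) /\
      (zeta1_rv P X Y = 0%E <->
        forall x, cube d.+1 x -> linkage A x = Pi_copula x),
      (zeta1_rv P X Y = 1%E <->
        exists f : d.-tuple R -> R,
          measurable_fun setT f /\ P [set t | Y t = f (X t)] = 1%E),
      (forall (phi : 'I_d -> R -> R) (psi : R -> R),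
        (forall i, strictly_monotone (phi i)) -> strictly_monotone psi ->
        zeta1_rv P (fun t => [tuple phi i (tnth (X t) i) | i < d])
          (psi \o Y) = zeta1_rv P X Y) &
      (forall k : nat, (0 < k < d)%N ->
        (zeta1_rv P (first_coords k \o X) Y <=
         zeta1_rv P (first_coords k.+1 \o X) Y)%E)].
Proof.
have mX : measurable_fun setT X by exact: measurable_funPT.
have mY : measurable_fun setT Y by exact: measurable_funPT.
have Z_atomless := continuous_cdf_atomless (measurable_snoc mX mY) H_continuous.
have X_atomless i a : P [set t | tnth (X t) i = a] = 0%E.
  have ilt : (widen_ord (leqnSn d) i < d)%N by exact: (ltn_ord i).
  rewrite -(Z_atomless (widen_ord (leqnSn d) i) a); congr (P _).
  apply/seteqP; split=> t; rewrite /= (tnth_snoc_lt _ _ ilt) => <-;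
    by congr tnth; apply: val_inj.
have Y_atomless a : P [set t | Y t = a] = 0%E.
  rewrite -(Z_atomless ord_max a); congr (P _).
  by apply/seteqP; split=> t; rewrite /= tnth_snoc_last.
have mV := measurable_probability_transform P mY.
have V_uniform y := @probability_transform_uniform _ _ _ P _ mY Y_atomless y.
split.
- exact: zeta1_rv_itv.
- rewrite zeta1_rvE//; split; (apply: iff_trans; first exact: integrated_advantage_eq0).
    exact: max_advantage_independent.
  apply: iff_trans (max_advantage_linkage A_copula.1).
  (* [zeta1_rv] uses the copula picked by [copula_of], the linkage that of the given [A]; both
     reduce to the advantage of the random vector itself. *)
  by split=> M0 y y01; move: (M0 y y01); rewrite (max_advantage_copula mX mY X_atomless Y_atomless).
- rewrite zeta1_rvE//; apply: iff_trans; first exact: integrated_advantage_eq1.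
  exact: max_advantage_function.
- by move=> phi psi hphi hpsi; exact: zeta1_rv_strictly_monotone.
- by move=> k /andP[_ kd]; exact: zeta1_rv_first_coords.
Qed.
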